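(* Let $M_2(c)$, $c\neq 0$, be the complex projective plane $\mathbb{C}P^2$ (if $c>0$) or the complex hyperbolic plane $\mathbb{C}H^2$ (if $c<0$), of constant holomorphic sectional curvature $c$. There exists no connected real hypersurface $M$ in $M_2(c)$ whose structure Jacobi operator $l$ is Lie $\mathbb{D}$-parallel, i.e. no such $M$ for which $L_X l=0$ for every vector field $X$ on $M$ with values in $\mathbb{D}=\ker(\eta)$; explicitly, there is no such $M$ for which $$\nabla_{X}(lY)+l\nabla_{Y}X=\nabla_{lY}X+l\nabla_{X}Y$$ for all vector fields $X$ in $\mathbb{D}$ and all vector fields $Y$ tangent to $M$.
   Context: All manifolds and vector fields are of class $C^\infty$ and manifolds are connected. $M_2(c)$ carries its Kaehler metric $G$ and complex structure $J$. For a (immersed) real hypersurface $M$ of $M_2(c)$ (real dimension 3), $g$ is the induced metric, $\nabla$ its Levi-Civita connection, $N$ a locally defined unit normal field, $\xi=-JN$ the structure vector field, $\eta(X)=g(X,\xi)$, $\mathbb{D}=\ker(\eta)$ the distribution orthogonal to $\xi$. With $R$ the Riemannian curvature tensor of $M$ (convention $R(X,Y)Z=\nabla_X\nabla_YZ-\nabla_Y\nabla_XZ-\nabla_{[X,Y]}Z$), the structure Jacobi operator is the $(1,1)$ tensor field $lX=R(X,\xi)\xi$. The Lie derivative is $(L_Xl)Y=[X,lY]-l[X,Y]$. The operator $l$ and the distribution $\mathbb{D}$ do not depend on the choice of sign of $N$. *)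

(* Defs.v *)
From HB Require Import structures.
From mathcomp Require Import all_boot all_order all_algebra.
From mathcomp Require Import complex.
From mathcomp Require Import all_classical all_reals all_analysis.

Set Implicit Arguments.
Unset Strict Implicit.
Unset Printing Implicit Defensive.
Import Order.TTheory GRing.Theory Num.Theory.
Import numFieldNormedType.Exports.

Local Open Scope classical_set_scope.
Local Open Scope ring_scope.
Local Open Scope complex_scope.

(** ** The complex projective and hyperbolic planes

   [M_2(c)] is the set of complex lines [C z] of [C^3] on which
   [sg c * h(z,z) > 0], where [h] is the Hermitian form
   [sg c |z_0|^2 + |z_1|^2 + |z_2|^2]: all lines if [c > 0] ([CP^2]), the
   negative lines of [C^(1,2)] if [c < 0] ([CH^2]).  A line is encoded by the
   [h]-orthogonal projector onto it.  This encoding is a smooth embedding of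
   [M_2(c)] into the real vector space of complex 3x3 matrices, so that smooth
   maps to [M_2(c)] and tangent vectors of [M_2(c)] are matrix valued. *)

Definition herm_mx (R : realType) (c : R) : 'M[R[i]]_3 :=
  diag_mx (\row_j (if j == 0 then (Num.sg c)%:C else 1)).

Definition adjmx (R : realType) (m n : nat) (A : 'M[R[i]]_(m, n)) :
  'M[R[i]]_(n, m) := (map_mx (@conjc R) A)^T.

Definition herm (R : realType) (c : R) (z w : 'cV[R[i]]_3) : R[i] :=
  (adjmx w *m herm_mx c *m z) 0 0.

Definition line_proj (R : realType) (c : R) (z : 'cV[R[i]]_3) : 'M[R[i]]_3 :=
  (herm c z z)^-1 *: (z *m adjmx z *m herm_mx c).

Definition M2 (R : realType) (c : R) : set 'M[R[i]]_3 :=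
  [set P | exists z : 'cV[R[i]]_3,
     0 < Num.sg c * complex.Re (herm c z z) /\ P = line_proj c z].

(** Linearization at [P] of the equations "[P] is [h]-selfadjoint" and
   "[P^2 = P]".  For [P = line_proj c z], [X |-> X z] identifies this real
   vector space with the [h]-orthogonal complement of [z], that is, with
   [Hom(C z, z^perp)]. *)
Definition tangentM2 (R : realType) (c : R) (P : 'M[R[i]]_3) :
    set 'M[R[i]]_3 :=
  [set X | adjmx X *m herm_mx c = herm_mx c *m X /\ X *m P + P *m X = X].

(** The Fubini-Study (resp. Bergman) metric of constant holomorphic sectional
   curvature [c]; see [kmetricE] for its usual expression. *)
Definition kmetric (R : realType) (c : R) (X Y : 'M[R[i]]_3) : R :=
  2 / c * complex.Re (\tr (X *m Y)).

(** The complex structure, i.e. multiplication by [i] on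
   [Hom(C z, z^perp)]; see [cstructE]. *)
Definition cstruct (R : realType) (P X : 'M[R[i]]_3) : 'M[R[i]]_3 :=
  ('i : R[i]) *: (X *m P - P *m X).

(** ** Smooth functions on open subsets of [R^3] *)

Definition e_ (R : realType) (i : 'I_3) : 'rV[R]_3 := delta_mx 0 i.

Fixpoint Ck (R : realType) (k : nat) (U : set 'rV[R]_3) (f : 'rV[R]_3 -> R) :
    Prop :=
  (forall x, U x -> {for x, continuous f}) /\
  match k with
  | 0%N => True
  | k'.+1 => forall i, (forall x, U x -> derivable f x (e_ R i)) /\
                       Ck k' U ('D_(e_ R i) f)
  end.

Definition smooth (R : realType) (U : set 'rV[R]_3) (f : 'rV[R]_3 -> R) :=
  forall k, Ck k U f.

Definition smooth_rv (R : realType) (U : set 'rV[R]_3)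
    (f : 'rV[R]_3 -> 'rV[R]_3) :=
  forall i, smooth U (fun x => f x 0 i).

Definition smooth_mx (R : realType) (U : set 'rV[R]_3)
    (f : 'rV[R]_3 -> 'M[R[i]]_3) :=
  forall i j, smooth U (fun x => complex.Re (f x i j)) /\
              smooth U (fun x => complex.Im (f x i j)).

Definition Dmx (R : realType) (f : 'rV[R]_3 -> 'M[R[i]]_3)
    (x v : 'rV[R]_3) : 'M[R[i]]_3 :=
  \matrix_(i, j) ('D_v (fun y => complex.Re (f y i j)) x +i*
                  'D_v (fun y => complex.Im (f y i j)) x).

(** ** Smooth 3-manifolds and their vector fields *)

Record chart (R : realType) (M : topologicalType) := Chart {
  cdom : set M;
  ccod : set 'rV[R]_3;
  cmap : M -> 'rV[R]_3;
  cinv : 'rV[R]_3 -> M }.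

Definition is_chart (R : realType) (M : topologicalType) (a : chart R M) :=
  [/\ open (cdom a) /\ open (ccod a),
      (forall p, cdom a p -> ccod a (cmap a p) /\ cinv a (cmap a p) = p),
      (forall x, ccod a x -> cdom a (cinv a x) /\ cmap a (cinv a x) = x),
      (forall p, cdom a p -> {for p, continuous (cmap a)}) &
      (forall x, ccod a x -> {for x, continuous (cinv a)})].

Definition overlap (R : realType) (M : topologicalType) (a b : chart R M) :
    set 'rV[R]_3 :=
  ccod a `&` (cinv a @^-1` cdom b).

Definition transition (R : realType) (M : topologicalType) (a b : chart R M) :
    'rV[R]_3 -> 'rV[R]_3 :=
  cmap b \o cinv a.

Definition smooth_atlas (R : realType) (M : topologicalType)
    (A : set (chart R M)) :=
  [/\ (forall a, A a -> is_chart a),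
      (forall p : M, exists2 a, A a & cdom a p) &
      (forall a b, A a -> A b -> smooth_rv (overlap a b) (transition a b))].

(** [connected] holds for the empty set in the library. *)
Definition connected_manifold (R : realType) (M : topologicalType)
    (A : set (chart R M)) :=
  [/\ smooth_atlas A, hausdorff_space M, second_countable (T := M),
      [set: M] !=set0 & connected [set: M]].

(** A vector field on [M] is the family of its component vectors in the charts
   of the atlas. *)
Definition vector_field (R : realType) (M : topologicalType)
    (A : set (chart R M)) (X : chart R M -> 'rV[R]_3 -> 'rV[R]_3) :=
  (forall a, A a -> smooth_rv (ccod a) (X a)) /\
  (forall a b x, A a -> A b -> overlap a b x ->
     X b (transition a b x) = 'D_(X a x) (transition a b) x).

(** ** Riemannian geometry in a chart

   [f] is the immersion read in a chart, and [X], [Y], [Z] are vector fields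
   read in that chart. *)

Definition gram (R : realType) (c : R) (f : 'rV[R]_3 -> 'M[R[i]]_3)
    (x : 'rV[R]_3) : 'M[R]_3 :=
  \matrix_(i, j) kmetric c (Dmx f x (e_ R i)) (Dmx f x (e_ R j)).

Definition induced (R : realType) (c : R) (f : 'rV[R]_3 -> 'M[R[i]]_3)
    (x v w : 'rV[R]_3) : R :=
  (v *m gram c f x *m w^T) 0 0.

Definition christoffel (R : realType) (c : R) (f : 'rV[R]_3 -> 'M[R[i]]_3)
    (x : 'rV[R]_3) (k i j : 'I_3) : R :=
  2^-1 * \sum_(l < 3) invmx (gram c f x) k l *
    ('D_(e_ R i) (fun y => gram c f y j l) x
     + 'D_(e_ R j) (fun y => gram c f y i l) x
     - 'D_(e_ R l) (fun y => gram c f y i j) x).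

(** Levi-Civita connection [nabla_X Y] of the induced metric *)
Definition nabla (R : realType) (c : R) (f : 'rV[R]_3 -> 'M[R[i]]_3)
    (X Y : 'rV[R]_3 -> 'rV[R]_3) (x : 'rV[R]_3) : 'rV[R]_3 :=
  'D_(X x) Y x +
  \row_k \sum_(i < 3) \sum_(j < 3) christoffel c f x k i j * X x 0 i * Y x 0 j.

Definition bracket (R : realType) (X Y : 'rV[R]_3 -> 'rV[R]_3)
    (x : 'rV[R]_3) : 'rV[R]_3 :=
  'D_(X x) Y x - 'D_(Y x) X x.

Definition curvature (R : realType) (c : R) (f : 'rV[R]_3 -> 'M[R[i]]_3)
    (X Y Z : 'rV[R]_3 -> 'rV[R]_3) (x : 'rV[R]_3) : 'rV[R]_3 :=
  nabla c f X (nabla c f Y Z) x - nabla c f Y (nabla c f X Z) x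
  - nabla c f (bracket X Y) Z x.

Definition jacobi (R : realType) (c : R) (f : 'rV[R]_3 -> 'M[R[i]]_3)
    (xi X : 'rV[R]_3 -> 'rV[R]_3) : 'rV[R]_3 -> 'rV[R]_3 :=
  curvature c f X xi xi.

(** [(L_X l) Y = [X, l Y] - l [X, Y]] *)
Definition lie_jacobi (R : realType) (c : R) (f : 'rV[R]_3 -> 'M[R[i]]_3)
    (xi X Y : 'rV[R]_3 -> 'rV[R]_3) (x : 'rV[R]_3) : 'rV[R]_3 :=
  bracket X (jacobi c f xi Y) x - jacobi c f xi (bracket X Y) x.

(** ** Real hypersurfaces *)

Definition real_hypersurface (R : realType) (c : R) (M : topologicalType)
    (A : set (chart R M)) (F : M -> 'M[R[i]]_3) :=
  [/\ (forall p, M2 c (F p)),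
      (forall a, A a -> smooth_mx (ccod a) (F \o cinv a)) &
      (forall a x v, A a -> ccod a x -> Dmx (F \o cinv a) x v = 0 -> v = 0)].

(** [N] is a unit normal field along the immersion [f] on the open set [V]. *)
Definition unit_normal (R : realType) (c : R) (f : 'rV[R]_3 -> 'M[R[i]]_3)
    (V : set 'rV[R]_3) (N : 'rV[R]_3 -> 'M[R[i]]_3) :=
  smooth_mx V N /\
  forall x, V x ->
    [/\ tangentM2 c (f x) (N x), kmetric c (N x) (N x) = 1 &
        forall v, kmetric c (N x) (Dmx f x v) = 0].

(** [xi = - J N] on [V], for some unit normal field [N] on [V] *)
Definition structure_field (R : realType) (c : R)
    (f : 'rV[R]_3 -> 'M[R[i]]_3) (V : set 'rV[R]_3)
    (xi : 'rV[R]_3 -> 'rV[R]_3) :=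
  exists2 N, unit_normal c f V N &
    forall x, V x -> Dmx f x (xi x) = - cstruct (f x) (N x).

(** The local structure vector fields of [M] in the chart [a] *)
Definition structure_on (R : realType) (c : R) (M : topologicalType)
    (F : M -> 'M[R[i]]_3) (a : chart R M) (V : set 'rV[R]_3)
    (xi : 'rV[R]_3 -> 'rV[R]_3) :=
  [/\ open V, V `<=` ccod a & structure_field c (F \o cinv a) V xi].

(** [X] takes its values in the distribution [D = ker eta]. *)
Definition in_D (R : realType) (c : R) (M : topologicalType)
    (A : set (chart R M)) (F : M -> 'M[R[i]]_3)
    (X : chart R M -> 'rV[R]_3 -> 'rV[R]_3) :=
  forall a V xi x, A a -> structure_on c F a V xi -> V x ->
    induced c (F \o cinv a) x (X a x) (xi x) = 0.

Definition lie_D_parallel (R : realType) (c : R) (M : topologicalType)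
    (A : set (chart R M)) (F : M -> 'M[R[i]]_3) :=
  forall X Y, vector_field A X -> in_D c A F X -> vector_field A Y ->
  forall a V xi x, A a -> structure_on c F a V xi -> V x ->
    lie_jacobi c (F \o cinv a) xi (X a) (Y a) x = 0.

(** ** The Kaehler structure in terms of homogeneous coordinates *)

Lemma adjmxM (R : realType) (m n p : nat) (A : 'M[R[i]]_(m, n))
    (B : 'M[R[i]]_(n, p)) : adjmx (A *m B) = adjmx B *m adjmx A.
Proof. by rewrite /adjmx map_mxM trmx_mul. Qed.

Lemma adjmxK (R : realType) (m n : nat) (A : 'M[R[i]]_(m, n)) :
  adjmx (adjmx A) = A.
Proof. by apply/matrixP => i j; rewrite !mxE conjcK. Qed.

Lemma adjmx_herm (R : realType) (c : R) : adjmx (herm_mx c) = herm_mx c.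
Proof.
apply/matrixP => i j; rewrite !mxE.
case: (eqVneq i j) => [->|ij]; rewrite ?eqxx ?[j == i]eq_sym ?(negbTE ij).
  by rewrite !mulr1n; case: eqP => _ /=; rewrite oppr0.
by rewrite !mulr0n /= oppr0.
Qed.

Lemma herm_conj (R : realType) (c : R) (z w : 'cV[R[i]]_3) :
  herm c w z = (herm c z w)^*.
Proof.
have -> : (herm c z w)^* = (adjmx (adjmx w *m herm_mx c *m z)) 0 0.
  by rewrite [RHS]mxE [RHS]mxE.
by rewrite !adjmxM adjmxK adjmx_herm mulmxA.
Qed.

Lemma line_projz (R : realType) (c : R) (z : 'cV[R[i]]_3) :
  herm c z z != 0 -> line_proj c z *m z = z.
Proof.
move=> hz; rewrite /line_proj -scalemxAl -!mulmxA.
rewrite [adjmx z *m _]mx11_scalar mulmxA -/(herm c z z).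
by rewrite mul_mx_scalar scalerA mulVf // scale1r.
Qed.

Lemma kmetricE (R : realType) (c : R) (z : 'cV[R[i]]_3) (X Y : 'M[R[i]]_3) :
  herm c z z != 0 ->
  tangentM2 c (line_proj c z) X -> tangentM2 c (line_proj c z) Y ->
  kmetric c X Y =
    4 / c * complex.Re (herm c (X *m z) (Y *m z) / herm c z z).
Proof.
move=> hz [aX eX] [aY eY].
have trP (A : 'M[R[i]]_3) :
    \tr (line_proj c z *m A) = (adjmx z *m herm_mx c *m A *m z) 0 0 / herm c z z.
  rewrite /line_proj -scalemxAl mxtraceZ mulrC; congr (_ / _).
  by rewrite -!mulmxA mxtrace_mulC !mulmxA trace_mx11.
have trXY : \tr (X *m Y) =
    herm c (X *m z) (Y *m z) / herm c z z + herm c (Y *m z) (X *m z) / herm c z z.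
  rewrite -{1}eX mulmxDl mxtraceD -mulmxA mxtrace_mulC -!mulmxA !trP.
  by rewrite /herm !adjmxM -[adjmx z *m adjmx Y *m _]mulmxA aY
    -[adjmx z *m adjmx X *m _]mulmxA aX !mulmxA.
have hR : (herm c z z)^* = herm c z z by rewrite -herm_conj.
have trE : \tr (X *m Y) = herm c (X *m z) (Y *m z) / herm c z z
    + (herm c (X *m z) (Y *m z) / herm c z z)^*.
  rewrite trXY (herm_conj c (X *m z)); congr (_ + _).
  by rewrite -{1}hR; exact/esym/fmorph_div.
rewrite /kmetric trE; case: (_ / herm c z z) => a b /=.
by rewrite -mulr2n -[a *+ 2]mulr_natl mulrA [2 / c * 2]mulrAC -natrM.
Qed.


Lemma cstructE (R : realType) (c : R) (z : 'cV[R[i]]_3) (X : 'M[R[i]]_3) :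
  herm c z z != 0 -> tangentM2 c (line_proj c z) X ->
  cstruct (line_proj c z) X *m z = ('i : R[i]) *: (X *m z).
Proof.
move=> hz [_ eX]; have Pz := line_projz hz.
have PX0 : line_proj c z *m X *m z = 0.
  have := congr1 (fun B => line_proj c z *m B *m z) eX.
  have PP : line_proj c z *m line_proj c z = line_proj c z.
    by rewrite {2}/line_proj -scalemxAr !mulmxA Pz -/(line_proj c z).
  rewrite mulmxDr mulmxDl !mulmxA PP -[_ *m X *m _ *m z]mulmxA Pz.
  by move=> /(canRL (addrK _)); rewrite subrr.
by rewrite /cstruct -scalemxAl mulmxBl -mulmxA Pz PX0 subr0.
Qed.

(* Main.v *)
Require Import Defs.
From HB Require Import structures.
From mathcomp Require Import all_boot all_order all_algebra.
From mathcomp Require Import complex ring lra.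
From mathcomp Require Import all_classical all_reals all_analysis.

(** Moving frames.  A point of [M_2(c)] is a complex line, so near a point of a
   hypersurface the immersion is [f = Phi e00 Phi^-1] for a smooth frame
   [Phi = (z, e1, e2)] of [C^3] that is unitary for the Hermitian form and whose
   first vector spans the line ([frame_exists]).  All the geometry is contained in
   the connection form [Om = Phi^-1 dPhi], which satisfies [dO + O /\ O = 0]
   ([integrability]).  After a change of [(e1, e2)] the vector [e1] is the unit
   normal [N] ([adapted_exists]); then [xi = - J N] is the first field of a frame
   [(xi, U, V)], with [V = J U], the entries of [Om] are the dual frame, the
   components of the shape operator [S] and one connection coefficient, and
   the Gauss equation gives
   [l X = k X + g(S xi, xi) S X - g(S X, xi) S xi] modulo [xi], with [k = c / 4]
   ([jacobi_frame]).

   If [l] is Lie parallel along the distribution [D], then [l] vanishes on [D]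
   ([lf_fr_eq0]).  Indeed for [X] in [D] vanishing at a point and [Y] proportional
   to [xi] one has [l Y = 0], hence [l [X, Y] = 0]; at that point [X, Y] is
   [- nabla_Y X], an arbitrary vector of [D].  Such fields are obtained
   by multiplying frame fields by bump functions and extending them by 0
   ([pushfield_vector_field]).

   Where [S xi] has a component in [D], rotate [U] so that
   [S xi = a xi + b U] ([rotate_exists]); elsewhere [b = 0].  The equation
   [l = 0] forces [S U = b xi + g U], [S V = m V] with [a g = b^2 - k] and
   [a m = - k] ([shape_alg]).  The Codazzi and Gauss equations ([codazzi_gauss])
   then form an overdetermined system for [a], [b], [g], [m] and the three
   connection coefficients [k0], [k1], [k2] of [(U, V)].  If [b = 0] identically,
   they give [g = m] and [g m = 0], against [a m = - k].  Otherwise, where [b] does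
   not vanish, differentiating [a g = b^2 - k] along [V] gives [k0 = - 4 a], one
   Gauss equation gives [k2 = 0], the other [a^2 (10 b^2 - 4 k) = k (b^2 - k)], and
   the derivative of the latter along [V] leads to
   [9 b^4 - 8 k b^2 + 2 k^2 = 0], which has no real solution
   ([scalar_contradiction]). *)

Set Implicit Arguments.
Unset Strict Implicit.
Unset Printing Implicit Defensive.
Import Order.TTheory GRing.Theory Num.Theory.
Import numFieldNormedType.Exports.

Local Open Scope classical_set_scope.
Local Open Scope ring_scope.

Implicit Type R : realType.
Local Notation Re := complex.Re.
Local Notation Im := complex.Im.

(** * Symmetry of second derivatives *)

Lemma shift_derive R (V W : normedModType R) (f : V -> W) (y v : V) (t : R) :
  derivable f (t *: v + y) v ->
  is_derive t 1 (fun s : R => f (s *: v + y)) ('D_v f (t *: v + y)).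
Proof.
have E : (fun h : R => h^-1 *: (f ((h *: 1 + t) *: v + y) - f (t *: v + y)))
   = (fun h : R => h^-1 *: (f (h *: v + (t *: v + y)) - f (t *: v + y))).
  by apply/funext => h; rewrite [h *: 1]mulr1 scalerDl addrA.
by move=> df; split; rewrite /derivable /derive /= E.
Qed.

(** The mean value theorem on the segment from [y] to [s *: v + y], for [s] of
   either sign. *)
Lemma MVT_dir R (V : normedModType R) (f : V -> R) (y v : V) (s : R) :
  (forall t : R, `|t| <= `|s| -> derivable f (t *: v + y) v) ->
  exists2 t, `|t| <= `|s| & f (s *: v + y) - f y = s * 'D_v f (t *: v + y).
Proof.
move=> df; pose g t := f (t *: v + y).
have dg (t : R) : `|t| <= `|s| -> is_derive t 1 g ('D_v f (t *: v + y)).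
  by move=> /df; exact: shift_derive.
have cg (a b : R) : (forall t : R, t \in `[a, b] -> `|t| <= `|s|) ->
    {within `[a, b], continuous g}.
  move=> ab; apply: derivable_within_continuous => t /ab /dg dt.
  exact: ex_derive.
have [s0|s0|s0] := ltgtP s 0.
- have [t||c] := @MVT _ g (fun t => 'D_v f (t *: v + y)) s 0 s0.
  + rewrite in_itv/= => /andP[st t0]; apply: dg.
    by rewrite !ltr0_norm// lerN2 ltW.
  + apply: cg => u; rewrite in_itv/= => /andP[su u0].
    by rewrite (ltr0_norm s0) ler0_norm// lerN2.
  rewrite in_itv/= => /andP[sc c0]; rewrite /g scale0r add0r => E.
  exists c; first by rewrite !ltr0_norm// lerN2 ltW.
  by rewrite -opprB E sub0r mulrN opprK mulrC.
- have [t||c] := @MVT _ g (fun t => 'D_v f (t *: v + y)) 0 s s0.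
  + rewrite in_itv/= => /andP[st t0]; apply: dg.
    by rewrite !gtr0_norm// ltW.
  + apply: cg => u; rewrite in_itv/= => /andP[su u0].
    by rewrite (gtr0_norm s0) ger0_norm.
  rewrite in_itv/= => /andP[sc c0]; rewrite /g scale0r add0r subr0 => E.
  exists c; first by rewrite !gtr0_norm// ltW.
  by rewrite E mulrC.
- exists 0; first by rewrite s0.
  by rewrite s0 scale0r add0r subrr mul0r.
Qed.

(** Both mixed derivatives are the limit, as [s] tends to 0, of the second
   difference of [f] along the parallelogram spanned by [s v] and [s w], divided
   by [s^2]; two applications of the mean value theorem give this for one of
   them, and the second difference is symmetric in [v] and [w]. *)
Lemma derive_comm R (V : normedModType R) (f : V -> R) (x v w : V) :
  (\forall y \near x, derivable f y v) -> (\forall y \near x, derivable f y w) ->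
  (\forall y \near x, derivable ('D_v f) y w) ->
  (\forall y \near x, derivable ('D_w f) y v) ->
  {for x, continuous ('D_w ('D_v f))} -> {for x, continuous ('D_v ('D_w f))} ->
  'D_w ('D_v f) x = 'D_v ('D_w f) x.
Proof.
wlog suff gen : v w / (\forall y \near x, derivable f y v) ->
  (\forall y \near x, derivable ('D_v f) y w) ->
  {for x, continuous ('D_w ('D_v f))} ->
  forall e : R, 0 < e -> \forall s \near 0^'+,
    `|f (s *: v + (s *: w + x)) - f (s *: v + x) - (f (s *: w + x) - f x)
       - s ^+ 2 * 'D_w ('D_v f) x| <= s ^+ 2 * e.
  move=> fv fw fvw fwv cvw cwv.
  apply/eqP; rewrite -subr_eq0 -normr_le0; apply/ler_addgt0Pl => e e0; rewrite ?addr0.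
  have e20 : 0 < e / 2 by rewrite divr_gt0.
  have G1 := gen v w fv fvw cvw _ e20.
  have G2 := gen w v fw fwv cwv _ e20.
  have [s [[H1 H2] s0]] := filter_ex (filterI (filterI G1 G2) (nbhs_right_gt (0 : R))).
  have s20 : 0 < s ^+ 2 by rewrite exprn_gt0.
  rewrite -(ler_pM2l s20) -{1}(gtr0_norm s20) -normrM.
  rewrite [in leRHS](splitr e) [in leRHS]mulrDr.
  apply: le_trans (lerD H2 H1).
  apply: le_trans (ler_normB _ _).
  rewrite [s *: w + (s *: v + x)]addrCA le_eqVlt; apply/orP; left; apply/eqP.
  move: (f (s *: v + (s *: w + x))) (f (s *: v + x)) (f (s *: w + x)) (f x)
    ('D_w ('D_v f) x) ('D_v ('D_w f) x) => a b c1 d p q.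
  by rewrite (_ : _ * (p - q) = a - c1 - (b - d) - s ^+ 2 * q
    - (a - b - (c1 - d) - s ^+ 2 * p)) //; ring.
move=> fv fvw cvw e e0.
have [d d0 H] : exists2 d, 0 < d & forall y, `|x - y| < d ->
    [/\ derivable f y v, derivable ('D_v f) y w &
      `|'D_w ('D_v f) x - 'D_w ('D_v f) y| < e].
  have /nbhs_normP [d /= d0 dP] : \forall y \near x,
     [/\ derivable f y v, derivable ('D_v f) y w &
      `|'D_w ('D_v f) x - 'D_w ('D_v f) y| < e].
    move/cvgrPdist_lt : cvw => /(_ _ e0) cvw.
    by apply: filterS (filterI (filterI fv fvw) cvw) => y [[]].
  by exists d => // y xy; exact: dP.
have small : \forall s \near 0^'+, s * (`|v| + `|w| + 1) < d.
  have M0 : 0 < `|v| + `|w| + 1 by rewrite ltr_wpDl// addr_ge0.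
  near=> s; rewrite -ltr_pdivlMr//.
  by near: s; apply: nbhs_right_lt; rewrite divr_gt0.
near=> s.
have s0 : 0 < s by near: s; exact: nbhs_right_gt.
have sM : s * (`|v| + `|w| + 1) < d by near: s.
have nb (t t' : R) : `|t| <= s -> `|t'| <= s -> `|x - (t' *: w + (t *: v + x))| < d.
  move=> ts ts'; apply: le_lt_trans sM.
  rewrite addrA opprD addrCA subrr addr0 opprD.
  apply: le_trans (ler_normB _ _) _; rewrite normrN !normrZ.
  rewrite addrC 2!mulrDr mulr1 -[leLHS]addr0.
  by apply: lerD; [apply: lerD; exact: ler_wpM2r|exact: ltW].
pose g z := f (s *: w + z) - f z.
have absS : `|s| = s by rewrite gtr0_norm.
have dsh z : derivable f (s *: w + z) v -> is_derive z v (fun z => f (s *: w + z)) ('D_v f (s *: w + z)).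
  move=> df.
  have E : (fun h : R => h^-1 *: (f (s *: w + (h *: v + z)) - f (s *: w + z)))
   = (fun h : R => h^-1 *: (f (h *: v + (s *: w + z)) - f (s *: w + z))).
    by apply/funext => h; rewrite addrCA.
  by split; rewrite /derivable /derive /= E.
have dg (t : R) : `|t| <= s -> is_derive (t *: v + x) v g
     ('D_v f (s *: w + (t *: v + x)) - 'D_v f (t *: v + x)).
  move=> ts.
  have [|d1 _ _] := H (s *: w + (t *: v + x)); first by apply: nb => //; rewrite absS.
  have [|d2 _ _] := H (0 *: w + (t *: v + x)); first by apply: nb => //; rewrite normr0 ltW.
  rewrite scale0r add0r in d2.
  have i1 := dsh _ d1; have i2 := derivableP d2.
  exact: is_deriveB.
have [|t ts E] := @MVT_dir _ _ g x v s.
  by move=> t; rewrite absS => /dg [].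
rewrite absS in ts.
have [|t' ts' E'] := @MVT_dir _ _ ('D_v f) (t *: v + x) w s.
  move=> t'; rewrite absS => t's.
  by have [|] := H (t' *: w + (t *: v + x)); first by exact: nb.
rewrite absS in ts'.
have [_ gd] := dg _ ts.
rewrite gd E' in E.
have -> : f (s *: v + (s *: w + x)) - f (s *: v + x) - (f (s *: w + x) - f x)
  = s ^+ 2 * 'D_w ('D_v f) (t' *: w + (t *: v + x)).
  by rewrite expr2 -mulrA -E /g [s *: w + (s *: v + x)]addrCA.
rewrite -mulrBr normrM (gtr0_norm (exprn_gt0 _ s0)) ler_wpM2l ?exprn_ge0 ?ltW//.
rewrite distrC.
by have [|] := H (t' *: w + (t *: v + x)); first exact: nb.
Unshelve. all: by end_near. Qed.

(** * Differentiability from continuous partial derivatives *)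

Lemma norm_delta_le1 R (i : 'I_3) : `|e_ R i| <= 1.
Proof.
rewrite /Num.Def.normr/= mx_normrE; apply: bigmax_le => //= j _.
by rewrite /e_ mxE; case: (_ && _); rewrite ?normr1 ?normr0.
Qed.

Lemma coord_le_norm R (h : 'rV[R]_3) (i : 'I_3) : `|h 0 i| <= `|h|.
Proof. by rewrite [leRHS]/Num.Def.normr/= mx_normrE; exact: (le_bigmax _ _ (0, i)). Qed.

Lemma rowE3 R (h : 'rV[R]_3) : h = \sum_i h 0 i *: e_ R i.
Proof. exact: row_sum_delta. Qed.

(** [f (h + x) - f x] telescopes into three increments along the coordinate
   axes, each controlled by the mean value theorem. *)
Lemma C1_differentiable R (f : 'rV[R]_3 -> R) (x : 'rV[R]_3) :
  (forall i, \forall y \near x, derivable f y (e_ R i)) ->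
  (forall i, {for x, continuous ('D_(e_ R i) f)}) -> differentiable f x.
Proof.
move=> df cf.
pose L (h : 'rV[R]_3) : R := \sum_i h 0 i * 'D_(e_ R i) f x.
have Llin : linear L.
  move=> a u v; rewrite /L scaler_sumr -big_split; apply: eq_bigr => i _ /=.
  by rewrite !mxE mulrDl -mulrA.
pose LM := GRing.isLinear.Build _ _ _ _ _ Llin.
pose LL : {linear 'rV[R]_3 -> R} := HB.pack L LM.
have Lcont : continuous LL.
  move=> y; rewrite /=.
  have -> : L = fun h => h 0 0 * 'D_(e_ R 0) f x + (h 0 (lift 0 0) * 'D_(e_ R (lift 0 0)) f x
     + h 0 (lift 0 (lift 0 0)) * 'D_(e_ R (lift 0 (lift 0 0))) f x).
    by apply/funext => h; rewrite /L !big_ord_recl big_ord0 addr0.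
  have c i : {for y, continuous (fun h : 'rV[R]_3 => h 0 i * 'D_(e_ R i) f x)}.
    by apply: (@cvgMr_tmp R _ (nbhs y)); exact: coord_continuous.
  exact: (cvgD (c _) (cvgD (c _) (c _))).
suff key (e : R) : 0 < e ->
    \forall h \near (0 : 'rV[R]_3), `|f (h + x) - (f x + L h)| <= e * `|h|.
  have E : 'd f x = LL :> ('rV[R]_3 -> R).
    by apply: diff_unique => //; apply/eqaddoP => e e0; exact: key.
  by apply/diff_locallyP; rewrite E; split => //; apply/eqaddoP => e e0; exact: key.
move=> e0.
have e30 : 0 < e / 3 by rewrite divr_gt0.
have [d d0 H] : exists2 d : R, 0 < d & forall i y, `|x - y| < d ->
    derivable f y (e_ R i) /\ `|'D_(e_ R i) f x - 'D_(e_ R i) f y| < e / 3.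
  suff /nbhs_normP [d /= d0 dP] : \forall y \near x, forall i,
     derivable f y (e_ R i) /\ `|'D_(e_ R i) f x - 'D_(e_ R i) f y| < e / 3.
    by exists d => // i y xy; exact: dP.
  apply: (@filter_forall _ _ (fun i y => derivable f y (e_ R i) /\ `|'D_(e_ R i) f x - 'D_(e_ R i) f y| < e / 3) (nbhs x) _) => i.
  have /cvgrPdist_lt/(_ _ e30) ci := cf i.
  exact: filterI (df i) ci.
have step i (t0 : R) (z : 'rV[R]_3) : `|t0| + `|z| < d ->
    `|f (t0 *: e_ R i + (z + x)) - f (z + x) - t0 * 'D_(e_ R i) f x| <= `|t0| * (e / 3).
  move=> tz.
  have nb t : `|t| <= `|t0| -> `|x - (t *: e_ R i + (z + x))| < d.
    move=> tt0; rewrite addrA opprD addrCA subrr addr0 normrN.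
    apply: le_lt_trans tz; apply: le_trans (ler_normD _ _) _; rewrite lerD2r normrZ.
    by rewrite -[leRHS]mulr1 ler_pM// norm_delta_le1.
  have [t /nb/H-/(_ i)[]|t /nb/H-/(_ i)[_ ti] ->] // := @MVT_dir _ _ f (z + x) (e_ R i) t0.
  by rewrite -mulrBr normrM ler_wpM2l// distrC ltW.
have small : \forall h \near (0 : 'rV[R]_3), `|h| + `|h| + `|h| < d.
  apply/nbhs_normP; exists (d / 3) => /=; first by rewrite divr_gt0.
  move=> h; rewrite /ball_/= sub0r normrN => hd.
  have -> : d = d / 3 + d / 3 + d / 3 by field.
  by rewrite !ltrD.
apply: filterS small => h hd.
have hc := coord_le_norm h.
pose h0 := h 0 0; pose h1 := h 0 1; pose h2 := h 0 (lift 0 (lift 0 0)).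
pose u0 := e_ R 0; pose u1 := e_ R 1; pose u2 := e_ R (lift 0 (lift 0 0)).
have i1 : lift 0 0 = 1 :> 'I_3 by apply/val_inj.
have hE : h = h0 *: u0 + (h1 *: u1 + (h2 *: u2 + 0)).
  by rewrite [LHS]rowE3 !big_ord_recl big_ord0 i1.
have n1 (i : 'I_3) : `|h 0 i *: e_ R i| <= `|h|.
  by rewrite normrZ -[leRHS]mulr1 ler_pM// norm_delta_le1.
have S2 := @step (lift 0 (lift 0 0)) h2 0.
have S1 := @step 1 h1 (h2 *: u2 + 0).
have S0 := @step 0 h0 (h1 *: u1 + (h2 *: u2 + 0)).
have {}S2 := S2 (le_lt_trans _ hd).
have {}S1 := S1 (le_lt_trans _ hd).
have {}S0 := S0 (le_lt_trans _ hd).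
rewrite [X in X <= _](_ : _ = `|(f (h0 *: u0 + (h1 *: u1 + (h2 *: u2 + 0) + x)) - f (h1 *: u1 + (h2 *: u2 + 0) + x) - h0 * 'D_u0 f x) +
  ((f (h1 *: u1 + (h2 *: u2 + 0 + x)) - f (h2 *: u2 + 0 + x) - h1 * 'D_u1 f x) +
   (f (h2 *: u2 + (0 + x)) - f (0 + x) - h2 * 'D_u2 f x))|); last first.
  congr `|_|; rewrite /= /L !big_ord_recl big_ord0 i1 /=.
  rewrite -/h0 -/h1 -/h2 -/u0 -/u1 -/u2.
  rewrite {1}hE !addr0 !add0r -!addrA.
  move: (f _) (f _) (f _) (f _) => a b c1 c2.
  by ring.
apply: le_trans (ler_normD _ _) _.
have -> : e * `|h| = `|h| * (e / 3) + (`|h| * (e / 3) + `|h| * (e / 3)) by field.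
apply: lerD.
  apply: le_trans (S0 _) _; last by apply: ler_wpM2r; [exact: ltW|exact: hc].
  rewrite addr0 -addrA; apply: lerD; first exact: hc.
  by apply: le_trans (ler_normD _ _) _; apply: lerD; exact: n1.
apply: le_trans (ler_normD _ _) _; apply: lerD.
  apply: le_trans (S1 _) _; last by apply: ler_wpM2r; [exact: ltW|exact: hc].
  by rewrite addr0 -[leLHS]addr0; apply: lerD => //; apply: lerD; [exact: hc|exact: n1].
apply: le_trans (S2 _) _; last by apply: ler_wpM2r; [exact: ltW|exact: hc].
by apply: lerD; rewrite ?normr0// -[leLHS]addr0; apply: lerD => //; exact: hc.
Qed.

(** * Smooth functions on open subsets of R^3 *)

Lemma derive_lin R (W : normedModType R) (f : 'rV[R]_3 -> W) (x v : 'rV[R]_3) :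
  differentiable f x -> 'D_v f x = \sum_i v 0 i *: 'D_(e_ R i) f x.
Proof.
move=> df; rewrite deriveE// {1}[v]rowE3 linear_sum; apply: eq_bigr => i _.
by rewrite linearZ deriveE.
Qed.

Lemma differentiable_rv R (V : normedModType R) (t : V -> 'rV[R]_3) (x : V) :
  (forall i, differentiable (fun y => t y 0 i) x) -> differentiable t x.
Proof.
move=> dt; have -> : t = \sum_(i < 3) (fun y => t y 0 i *: e_ R i).
  by apply/funext => y; rewrite fct_sumE [LHS]rowE3.
by apply: differentiable_sum => i; exact: differentiableZl.
Qed.

Lemma derive_rv R (V : normedModType R) (t : V -> 'rV[R]_3) (x v : V) (i : 'I_3) :
  differentiable t x -> ('D_v t x) 0 i = 'D_v (fun y => t y 0 i) x.
Proof. by move=> dt; rewrite derive_mx ?mxE//; exact: diff_derivable. Qed.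

Lemma derive_coord R (x v : 'rV[R]_3) (i : 'I_3) :
  'D_v (fun y : 'rV[R]_3 => y 0 i) x = v 0 i.
Proof. by rewrite -(derive_rv (t := id))// derive_id. Qed.

Lemma is_derive_comp1 R (V : normedModType R) (f : V -> R) (phi : R -> R) (x v : V) (d : R) :
  differentiable f x -> is_derive (f x) 1 phi d ->
  is_derive x v (phi \o f) (d * 'D_v f x).
Proof.
move=> df [dphi <-]; have /derivable1_diffP dp := dphi.
have dc : differentiable (phi \o f) x by exact: differentiable_comp.
split; first exact: diff_derivable.
rewrite (deriveE _ dc) (deriveE _ df) (deriveE _ dp) (diff_comp df dp) /= -[X in 'd phi (f x) X = _]mulr1.
by rewrite [LHS]linearZ mulrC.
Qed.

Lemma derive_comp R (V W : normedModType R) (t : V -> W) (g : W -> R) (x v : V) :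
  differentiable t x -> differentiable g (t x) ->
  'D_v (g \o t) x = 'D_('D_v t x) g (t x).
Proof.
move=> dt dg; have dc : differentiable (g \o t) x by exact: differentiable_comp.
by rewrite (deriveE _ dc) (deriveE _ dt) (deriveE _ dg) (diff_comp dt dg).
Qed.

Lemma Ck_cont R k (U : set 'rV[R]_3) f x :
  Ck k U f -> U x -> {for x, continuous f}.
Proof. by case: k => [|k] [c _]; exact: c. Qed.

Lemma Ck_der R k (U : set 'rV[R]_3) f i x :
  Ck k.+1 U f -> U x -> derivable f x (e_ R i).
Proof. by move=> [_ /(_ i) [d _]]; exact: d. Qed.

Lemma CkW R k (U : set 'rV[R]_3) f : Ck k.+1 U f -> Ck k U f.
Proof.
elim: k f => [|k IH] f fk; first by case: fk => c _; split.
split=> [x Ux|i]; first exact: Ck_cont fk Ux.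
by case: fk => _ /(_ i) [? ?]; split => //; exact: IH.
Qed.

Lemma Ck_sub R k (U V : set 'rV[R]_3) f :
  V `<=` U -> Ck k U f -> Ck k V f.
Proof.
move=> VU; elim: k f => [|k IH] f [c D]; split => //; try by move=> x /VU; exact: c.
by move=> i; case: (D i) => d Df; split; [move=> x /VU; exact: d|exact: IH].
Qed.

(** Being [C^k] is a condition at each point of the open set once the derivatives
   are taken in the ambient space, so it may be checked on neighbourhoods. *)
Lemma Ck_local R k (U : set 'rV[R]_3) f :
  (forall x, U x -> exists2 V : set 'rV[R]_3, V x & Ck k V f) -> Ck k U f.
Proof.
elim: k f => [|k IH] f H; split => //.
- by move=> x /H [V Vx fk]; exact: Ck_cont fk Vx.
- by move=> x /H [V Vx fk]; exact: Ck_cont fk Vx.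
move=> i; split; first by move=> x /H [V Vx fk]; exact: Ck_der fk Vx.
by apply: IH => x /H [V Vx [_ /(_ i) [_ fk]]]; exists V.
Qed.

Lemma near_open R (U : set 'rV[R]_3) (P : 'rV[R]_3 -> Prop) x :
  open U -> U x -> (forall y, U y -> P y) -> \forall y \near x, P y.
Proof. by move=> oU Ux UP; apply: filterS UP _; exact: open_nbhs_nbhs. Qed.

Lemma Ck_ext R k (U : set 'rV[R]_3) f g : open U ->
  (forall x, U x -> f x = g x) -> Ck k U f -> Ck k U g.
Proof.
move=> oU.
have cont h1 h2 x : (forall x, U x -> h1 x = h2 x) -> U x ->
    {for x, continuous (h1 : 'rV[R]_3 -> R)} -> {for x, continuous (h2 : 'rV[R]_3 -> R)}.
  move=> hE Ux ch; rewrite /prop_for /continuous_at -(hE x Ux).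
  exact: (cvg_trans (near_eq_cvg (near_open oU Ux hE)) ch).
elim: k f g => [|k IH] f g fg fk; split => //.
- by move=> x Ux; apply: (cont f) => //; exact: Ck_cont fk Ux.
- by move=> x Ux; apply: (cont f) => //; exact: Ck_cont fk Ux.
have fgn x : U x -> {near x, f =1 g} by move=> Ux; exact: (near_open oU Ux fg).
move=> i; split=> [x Ux|].
  by apply: near_eq_derivable (fgn x Ux) _; exact: Ck_der fk Ux.
apply: (IH ('D_(e_ R i) f)); last by case: fk => _ /(_ i) [].
by move=> x Ux; exact: near_eq_derive (fgn x Ux).
Qed.

Lemma Ck_diff R k (U : set 'rV[R]_3) f x : open U ->
  Ck k.+1 U f -> U x -> differentiable f x.
Proof.
move=> oU fk Ux; apply: C1_differentiable => i.
  by apply: (near_open oU Ux) => y Uy; exact: Ck_der fk Uy.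
by case: fk => _ /(_ i) [_ fk]; exact: Ck_cont fk Ux.
Qed.

(** All closure properties below are inductions on [k] through this criterion:
   the derivative of the new function is a polynomial in functions that are
   already known to be [C^k]. *)
Lemma CkS R k (U : set 'rV[R]_3) g (g' : 'I_3 -> 'rV[R]_3 -> R) : open U ->
  Ck k U g ->
  (forall i x, U x -> is_derive x (e_ R i) g (g' i x)) ->
  (forall i, Ck k U (g' i)) -> Ck k.+1 U g.
Proof.
move=> oU gk dg g'k; split=> [x Ux|i]; first exact: Ck_cont gk Ux.
split=> [x Ux|]; first by have [] := dg i x Ux.
by apply: Ck_ext (g'k i) => // x Ux; have [_ ->] := dg i x Ux.
Qed.

Lemma Ck_cst R k (U : set 'rV[R]_3) (a : R) : open U -> Ck k U (fun=> a).
Proof.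
move=> oU; elim: k a => [|k IH] a; first by split=> // x _; exact: cst_continuous.
by apply: (@CkS _ _ _ _ (fun _ _ => 0)) => // i x _; exact: is_derive_cst.
Qed.

Lemma Ck_coord R k (U : set 'rV[R]_3) (j : 'I_3) : open U ->
  Ck k U (fun x => x 0 j).
Proof.
move=> oU; elim: k => [|k IH]; first by split=> // x _; exact: coord_continuous.
apply: (@CkS _ _ _ _ (fun i _ => e_ R i 0 j)) => // [i x _|i]; last exact: Ck_cst.
by split; [apply: diff_derivable; exact: differentiable_coord|exact: derive_coord].
Qed.

Lemma Ck_add R k (U : set 'rV[R]_3) f g : open U ->
  Ck k U f -> Ck k U g -> Ck k U (fun x => f x + g x).
Proof.
move=> oU; elim: k f g => [|k IH] f g fk gk.
  by split=> // x Ux; exact: (cvgD (Ck_cont fk Ux) (Ck_cont gk Ux)).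
apply: (@CkS _ _ _ _ (fun i x => 'D_(e_ R i) f x + 'D_(e_ R i) g x)) => //.
- by apply: IH; exact: CkW.
- move=> i x Ux; have /derivableP df := Ck_der (i := i) fk Ux.
  by have /derivableP dg := Ck_der (i := i) gk Ux; exact: is_deriveD.
- by move=> i; apply: IH; [case: fk => _ /(_ i) []|case: gk => _ /(_ i) []].
Qed.

Lemma Ck_mul R k (U : set 'rV[R]_3) f g : open U ->
  Ck k U f -> Ck k U g -> Ck k U (fun x => f x * g x).
Proof.
move=> oU; elim: k f g => [|k IH] f g fk gk.
  by split=> // x Ux; exact: (cvgM (Ck_cont fk Ux) (Ck_cont gk Ux)).
apply: (@CkS _ _ _ _ (fun i x => f x * 'D_(e_ R i) g x + g x * 'D_(e_ R i) f x)) => //.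
- by apply: IH; exact: CkW.
- move=> i x Ux; have /derivableP df := Ck_der (i := i) fk Ux.
  by have /derivableP dg := Ck_der (i := i) gk Ux; exact: is_deriveM.
- move=> i; apply: Ck_add => //; apply: IH; try exact: CkW.
    by case: gk => _ /(_ i) [].
  by case: fk => _ /(_ i) [].
Qed.

Lemma Ck_inv R k (U : set 'rV[R]_3) f : open U ->
  (forall x, U x -> f x != 0) -> Ck k U f -> Ck k U (fun x => (f x)^-1).
Proof.
move=> oU f0; elim: k => [|k IH] fk.
  by split=> // x Ux; exact: (cvgV (f0 x Ux) (Ck_cont fk Ux)).
have ik := IH (CkW fk).
apply: (@CkS _ _ _ _ (fun i x => -1 * ((f x)^-1 * (f x)^-1) * 'D_(e_ R i) f x)) => //.
- move=> i x Ux; have df := Ck_der (i := i) fk Ux.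
  split; first exact: derivableV (f0 x Ux) df.
  by rewrite (deriveV (f0 x Ux) df) mulN1r -invfM -expr2.
- move=> i; apply: Ck_mul => //; last by case: fk => _ /(_ i) [].
  by apply: Ck_mul => //; [exact: Ck_cst|exact: Ck_mul].
Qed.

Lemma Ck_ln R k (U : set 'rV[R]_3) f : open U ->
  (forall x, U x -> 0 < f x) -> Ck k.+1 U f -> Ck k.+1 U (fun x => ln (f x)).
Proof.
move=> oU f0; elim: k => [|k IH] fk.
- have dl i x : U x -> is_derive x (e_ R i) (fun x => ln (f x)) ((f x)^-1 * 'D_(e_ R i) f x).
    move=> Ux; apply: (@is_derive_comp1 _ _ f (@ln R)); first exact: Ck_diff fk Ux.
    exact: is_derive1_ln (f0 x Ux).
  apply: (@CkS _ _ _ _ (fun i x => (f x)^-1 * 'D_(e_ R i) f x)) => //.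
    split=> // x Ux; apply: (@continuous_comp _ _ _ f (@ln R)).
      exact: Ck_cont fk Ux.
    exact: continuous_ln (f0 x Ux).
  move=> i; apply: Ck_mul => //; last by case: fk => _ /(_ i) [].
  by apply: Ck_inv => // [x /f0 /lt0r_neq0//|]; exact: CkW.
- have lk := IH (CkW fk).
  apply: (@CkS _ _ _ _ (fun i x => (f x)^-1 * 'D_(e_ R i) f x)) => //.
    move=> i x Ux; apply: (@is_derive_comp1 _ _ f (@ln R)); first exact: Ck_diff fk Ux.
    exact: is_derive1_ln (f0 x Ux).
  move=> i; apply: Ck_mul => //; last by case: fk => _ /(_ i) [].
  by apply: Ck_inv => // [x /f0 /lt0r_neq0//|]; exact: CkW.
Qed.

Lemma Ck_expR R k (U : set 'rV[R]_3) f : open U ->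
  Ck k U f -> Ck k U (fun x => expR (f x)).
Proof.
move=> oU; elim: k => [|k IH] fk.
  split=> // x Ux; apply: (@continuous_comp _ _ _ f (@expR R)).
    exact: Ck_cont fk Ux.
  exact: continuous_expR.
have ek := IH (CkW fk).
apply: (@CkS _ _ _ _ (fun i x => expR (f x) * 'D_(e_ R i) f x)) => //.
  move=> i x Ux; apply: (@is_derive_comp1 _ _ f (@expR R)); first exact: Ck_diff fk Ux.
by move=> i; apply: Ck_mul => //; case: fk => _ /(_ i) [].
Qed.

Lemma smooth_cst R (U : set 'rV[R]_3) (a : R) : open U -> smooth U (fun=> a).
Proof. by move=> oU k; exact: Ck_cst. Qed.

Lemma smooth_coord R (U : set 'rV[R]_3) j : open U -> smooth U (fun x => x 0 j).
Proof. by move=> oU k; exact: Ck_coord. Qed.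

Lemma smooth_add R (U : set 'rV[R]_3) f g : open U ->
  smooth U f -> smooth U g -> smooth U (fun x => f x + g x).
Proof. by move=> oU fs gs k; exact: Ck_add. Qed.

Lemma smooth_mul R (U : set 'rV[R]_3) f g : open U ->
  smooth U f -> smooth U g -> smooth U (fun x => f x * g x).
Proof. by move=> oU fs gs k; exact: Ck_mul. Qed.

Lemma smooth_ext R (U : set 'rV[R]_3) f g : open U ->
  (forall x, U x -> f x = g x) -> smooth U f -> smooth U g.
Proof. by move=> oU fg fs k; exact: Ck_ext (fs k). Qed.

Lemma smooth_opp R (U : set 'rV[R]_3) f : open U ->
  smooth U f -> smooth U (fun x => - f x).
Proof.
move=> oU fs; apply: (@smooth_ext _ _ (fun x => -1 * f x)) => // [x _|].
  by rewrite mulN1r.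
by apply: smooth_mul => //; exact: smooth_cst.
Qed.

Lemma smooth_sub_fun R (U : set 'rV[R]_3) f g : open U ->
  smooth U f -> smooth U g -> smooth U (fun x => f x - g x).
Proof. by move=> oU fs gs; apply: smooth_add => //; exact: smooth_opp. Qed.

Lemma smooth_inv R (U : set 'rV[R]_3) f : open U ->
  (forall x, U x -> f x != 0) -> smooth U f -> smooth U (fun x => (f x)^-1).
Proof. by move=> oU f0 fs k; exact: Ck_inv. Qed.

(** On positive numbers the square root is [exp (ln / 2)]. *)
Lemma smooth_sqrt R (U : set 'rV[R]_3) f : open U ->
  (forall x, U x -> 0 < f x) -> smooth U f -> smooth U (fun x => Num.sqrt (f x)).
Proof.
move=> oU f0 fs; apply: (@smooth_ext _ _ (fun x => expR (ln (f x) * 2^-1))) => //.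
  move=> x /f0 fx0; rewrite -powR12_sqrt ?ltW// /powR gt_eqF//.
  by rewrite mulrC.
move=> k; apply: Ck_expR => //; apply: Ck_mul => //; last exact: Ck_cst.
by apply: CkW; exact: Ck_ln.
Qed.

Lemma smooth_restr R (U V : set 'rV[R]_3) f :
  V `<=` U -> smooth U f -> smooth V f.
Proof. by move=> VU fs k; exact: Ck_sub (fs k). Qed.

Lemma smooth_local R (U : set 'rV[R]_3) f :
  (forall x, U x -> exists2 V : set 'rV[R]_3, V x & smooth V f) -> smooth U f.
Proof.
by move=> H k; apply: Ck_local => x /H [V Vx fs]; exists V.
Qed.

Lemma smooth_sum R (U : set 'rV[R]_3) (I : Type) (r : seq I) (P : pred I)
    (f : I -> 'rV[R]_3 -> R) : open U ->
  (forall i, P i -> smooth U (f i)) -> smooth U (fun x => \sum_(i <- r | P i) f i x).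
Proof.
move=> oU fs; elim: r => [|i r IH].
  apply: (@smooth_ext _ _ (fun=> 0)) => // [x _|]; last exact: smooth_cst.
  by rewrite big_nil.
apply: (@smooth_ext _ _ (fun x => (if P i then f i x else 0) + \sum_(i <- r | P i) f i x)) => // [x _|].
  by rewrite big_cons; case: ifP => //; rewrite add0r.
by apply: smooth_add => //; case Pi: (P i); [exact: fs|exact: smooth_cst].
Qed.

Lemma smooth_prod R (U : set 'rV[R]_3) (I : Type) (r : seq I)
    (f : I -> 'rV[R]_3 -> R) : open U ->
  (forall i, smooth U (f i)) -> smooth U (fun x => \prod_(i <- r) f i x).
Proof.
move=> oU fs; elim: r => [|i r IH].
  apply: (@smooth_ext _ _ (fun=> 1)) => // [x _|]; last exact: smooth_cst.
  by rewrite big_nil.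
apply: (@smooth_ext _ _ (fun x => f i x * \prod_(i <- r) f i x)) => // [x _|].
  by rewrite big_cons.
exact: smooth_mul.
Qed.

Lemma smooth_diff R (U : set 'rV[R]_3) f x : open U ->
  smooth U f -> U x -> differentiable f x.
Proof. by move=> oU /(_ 1%N) fs; exact: Ck_diff fs. Qed.

Lemma smooth_derivable R (U : set 'rV[R]_3) f x v : open U ->
  smooth U f -> U x -> derivable f x v.
Proof. by move=> oU fs Ux; apply: diff_derivable; exact: smooth_diff fs Ux. Qed.

Lemma smooth_continuous R (U : set 'rV[R]_3) f x :
  smooth U f -> U x -> {for x, continuous f}.
Proof. by move=> /(_ 0%N) fs; exact: Ck_cont fs. Qed.

Lemma smooth_D R (U : set 'rV[R]_3) f i :
  smooth U f -> smooth U ('D_(e_ R i) f).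
Proof. by move=> fs k; have [_ /(_ i) []] := fs k.+1. Qed.

Lemma smooth_rv_diff R (U : set 'rV[R]_3) X x : open U ->
  smooth_rv U X -> U x -> differentiable X x.
Proof. by move=> oU Xs Ux; apply: differentiable_rv => i; exact: smooth_diff (Xs i) Ux. Qed.

Lemma smooth_Dfield R (U : set 'rV[R]_3) X f : open U ->
  smooth_rv U X -> smooth U f -> smooth U (fun x => 'D_(X x) f x).
Proof.
move=> oU Xs fs.
apply: (@smooth_ext _ _ (fun x => \sum_i X x 0 i * 'D_(e_ R i) f x)) => // [x Ux|].
  by rewrite [RHS]derive_lin//; exact: smooth_diff fs Ux.
by apply: smooth_sum => // i _; apply: smooth_mul => //; exact: smooth_D.
Qed.

(** The chain rule expresses the partial derivatives of [g \o t] by functions of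
   the form [h \o t] with [h] a partial derivative of [g], so the induction on
   the order runs over all [g] at once. *)
Lemma smooth_comp R (U W : set 'rV[R]_3) t g : open U -> open W ->
  (forall y, W y -> U (t y)) -> smooth_rv W t -> smooth U g -> smooth W (g \o t).
Proof.
move=> oU oW tU ts gs k; move: (gs k) => {gs}; elim: k g => [|k IH] g gk.
  split=> // x Wx; apply: continuous_comp.
    exact/differentiable_continuous/(smooth_rv_diff oW ts Wx).
  exact: Ck_cont gk (tU _ Wx).
apply: (@CkS _ _ _ _ (fun i x => \sum_j 'D_(e_ R i) (fun y => t y 0 j) x * 'D_(e_ R j) g (t x))) => //.
- by apply: IH; exact: CkW.
- move=> i x Wx; have dt := smooth_rv_diff oW ts Wx.
  have dg := Ck_diff oU gk (tU _ Wx).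
  split; first by apply: diff_derivable; exact: differentiable_comp.
  rewrite derive_comp// derive_lin//; apply: eq_bigr => j _.
  by rewrite derive_rv.
- move=> i.
  suff H (r : seq 'I_3) : Ck k W (fun x => \sum_(j <- r)
      'D_(e_ R i) (fun y => t y 0 j) x * 'D_(e_ R j) g (t x)) by exact: H.
  elim: r => [|j r IHr].
    apply: (@Ck_ext _ _ _ (fun=> 0)) => // [x _|]; last exact: Ck_cst.
    by rewrite big_nil.
  apply: (@Ck_ext _ _ _ (fun x => 'D_(e_ R i) (fun y => t y 0 j) x * 'D_(e_ R j) g (t x) +
     \sum_(j <- r) 'D_(e_ R i) (fun y => t y 0 j) x * 'D_(e_ R j) g (t x))) => // [x _|].
    by rewrite big_cons.
  apply: Ck_add => //; apply: Ck_mul => //.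
    by have [_ /(_ i) []] := ts j k.+1.
  by apply: (IH ('D_(e_ R j) g)); case: gk => _ /(_ j) [].
Qed.

Lemma smooth_derive_comm R (U : set 'rV[R]_3) f x i j : open U ->
  smooth U f -> U x -> 'D_(e_ R i) ('D_(e_ R j) f) x = 'D_(e_ R j) ('D_(e_ R i) f) x.
Proof.
move=> oU fs Ux; apply: derive_comm.
- by apply: (near_open oU Ux) => y Uy; exact: smooth_derivable fs Uy.
- by apply: (near_open oU Ux) => y Uy; exact: smooth_derivable fs Uy.
- by apply: (near_open oU Ux) => y Uy; exact: smooth_derivable (smooth_D j fs) Uy.
- by apply: (near_open oU Ux) => y Uy; exact: smooth_derivable (smooth_D i fs) Uy.
- exact: smooth_continuous (smooth_D _ (smooth_D _ fs)) Ux.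
- exact: smooth_continuous (smooth_D _ (smooth_D _ fs)) Ux.
Qed.

(** * Bump functions *)

(** The functions [t^-n exp (- 1/t)], extended by 0 to [t <= 0].  The family is
   stable under derivation, which makes all its members smooth. *)
Definition psi R (n : nat) (t : R) : R :=
  if 0 < t then t^-1 ^+ n * expR (- t^-1) else 0.

(** [exp s >= s^(n+1) / (n+1)!] with [s = 1/t] makes [psi n] flat at the origin. *)
Lemma psi_bound R n (t : R) : `|psi n t| <= (n.+1)`!%:R * `|t|.
Proof.
rewrite /psi; case: ifPn => [t0|_]; last by rewrite normr0 mulr_ge0.
have s0 : 0 < t^-1 by rewrite invr_gt0.
rewrite !gtr0_norm ?mulr_gt0 ?exprn_gt0 ?expR_gt0//.
have := expR_ge1Dxn n (ltW s0).
set s := t^-1 => h.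
have h' : s ^+ n.+1 / (n.+1)`!%:R <= expR s by apply: le_trans h; rewrite lerDr.
have F0 : 0 < (n.+1)`!%:R :> R by rewrite ltr0n fact_gt0.
rewrite expRN ler_pdivrMr ?expR_gt0//.
have -> : s ^+ n = (n.+1)`!%:R * t * (s ^+ n.+1 / (n.+1)`!%:R).
  rewrite exprS /s; field; by rewrite !gt_eqF.
by rewrite ler_wpM2l// mulr_ge0// ?ltW.
Qed.

Lemma psi0 R n : psi n (0 : R) = 0.
Proof. by rewrite /psi ltxx. Qed.

Lemma psi_S R n (h : R) : h != 0 -> h^-1 * psi n h = psi n.+1 h.
Proof. by move=> h0; rewrite /psi; case: ifP => _; rewrite ?mulr0// exprS mulrA. Qed.

Lemma cvg_psi0 R n : psi n (h : R) @[h --> 0] --> (0 : R).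
Proof.
apply/cvgrPdist_le => e e0.
have F0 : 0 < (n.+1)`!%:R :> R by rewrite ltr0n fact_gt0.
apply/nbhs_normP; exists (e / (n.+1)`!%:R) => /=; first by rewrite divr_gt0.
move=> h; rewrite /ball_/= !sub0r !normrN => hd.
apply: le_trans (psi_bound n h) _.
by rewrite -ler_pdivlMl// mulrC ltW.
Qed.

Lemma is_derive_psi R n (t : R) :
  is_derive t 1 (psi n) (psi n.+2 t - n%:R * psi n.+1 t).
Proof.
have [t0|t0|->] := ltgtP t 0.
- have E : \forall u \near t, cst 0 u = psi n u.
    have h : nbhs t [set u : R | u < 0] by apply: open_nbhs_nbhs; split=> //; exact: open_lt.
    by apply: (filterS _ h) => u /= u0; rewrite /psi ltNge ltW.
  rewrite /psi ltNge (ltW t0) /= mulr0 subr0.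
  exact: (near_eq_is_derive E (is_derive_cst _ _ _)).
- have E : \forall u \near t, (fun u : R => u^-1 ^+ n * expR (- u^-1)) u = psi n u.
    have h : nbhs t [set u : R | 0 < u] by apply: open_nbhs_nbhs; split=> //; exact: open_gt.
    by apply: (filterS _ h) => u /= u0; rewrite /psi u0.
  apply: (near_eq_is_derive E).
  have tn0 : t != 0 by rewrite gt_eqF.
  pose phi (s : R) := s ^+ n * expR (- s).
  have dphi (s : R) : is_derive s 1 phi (s ^+ n * - expR (- s) + expR (- s) * (n%:R * s ^+ n.-1)).
    have d1 : is_derive s 1 (fun s : R => s ^+ n) (n%:R * s ^+ n.-1).
      split; first exact: exprn_derivable.
      by apply: etrans (exp_derive n s 1) _; exact: mulr1.
    have d2 : is_derive s 1 (fun s : R => expR (- s)) (- expR (- s)).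
      have := @is_derive_comp1 R R (-%R) (@expR R) s 1 (expR (- s)).
      have df : differentiable (-%R : R -> R) s by apply: differentiableN.
      by move=> /(_ df (is_derive_expR _)); rewrite deriveN// derive_id mulrN1.
    exact: (is_deriveM d1 d2).
  have dV : is_derive t 1 (fun u : R => u^-1) (- t ^- 2 *: (1 : R)).
    exact: (is_deriveV (f := id) tn0 (is_derive_id _ _)).
  have [dv dvE] := dV.
  have := @is_derive_comp1 R R (fun u : R => u^-1) phi t 1 _ (proj1 (@derivable1_diffP R R _ t) dv) (dphi _).
  rewrite dvE /psi t0.
  congr (is_derive _ _ _ _).
  move: (expR _) => ex; rewrite -[_%:A]/(- t ^- 2 * 1).
  case: n E phi dphi => [|n] _ _ _; first by rewrite !mul0r mulr0 addr0 expr0; field.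
  by rewrite /= !exprS; field.
- rewrite !psi0 mulr0 subr0.
  have cv : h^-1 *: (psi n (h *: 1 + 0) - psi n 0) @[h --> (0 : R)^'] --> (0 : R).
    have cv0 : psi n.+1 (h : R) @[h --> (0 : R)^'] --> (0 : R).
      by move=> A /(@cvg_psi0 R n.+1) hA; exact: nbhs_dnbhs hA.
    apply: cvg_trans cv0; apply: near_eq_cvg.
    have h := nbhs_dnbhs_neq (0 : R).
    apply: (filterS _ h) => u /= u0.
    by rewrite psi0 subr0 addr0 [u *: 1]mulr1 -psi_S.
  split; last exact: (cvg_lim _ cv).
  by apply/cvg_ex; exists 0.
Qed.

Lemma Ck_psi R k n (U : set 'rV[R]_3) q : open U ->
  smooth U q -> Ck k U (fun x => psi n (q x)).
Proof.
move=> oU qs; elim: k n => [|k IH] n.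
  split=> // x Ux; apply: (@continuous_comp _ _ _ q (@psi R n)).
    exact: smooth_continuous qs Ux.
  have [d _] := is_derive_psi n (q x).
  exact/differentiable_continuous/derivable1_diffP.
apply: (@CkS _ _ _ _ (fun i x => (psi n.+2 (q x) + - n%:R * psi n.+1 (q x)) * 'D_(e_ R i) q x)) => //.
  move=> i x Ux; rewrite mulNr.
  exact: (@is_derive_comp1 _ _ q (@psi R n) x _ _ (smooth_diff oU qs Ux) (is_derive_psi n (q x))).
move=> i; apply: Ck_mul => //; last exact: (smooth_D i qs).
by apply: Ck_add => //; apply: Ck_mul => //; exact: Ck_cst.
Qed.

(** [psi 0 (d^2 - |x - x0|^2)], with the Euclidean norm, vanishes outside the
   cube of half-side [d], which is compact. *)
Lemma bump_exists R (V : set 'rV[R]_3) (x0 : 'rV[R]_3) : open V -> V x0 ->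
  exists (rho : 'rV[R]_3 -> R) (K : set 'rV[R]_3),
    [/\ smooth setT rho, rho x0 != 0, compact K, K `<=` V & forall x, ~ K x -> rho x = 0].
Proof.
move=> oV Vx0.
have /nbhs_ballP [e /= e0 eV] : nbhs x0 V by exact: open_nbhs_nbhs.
pose d := e / 2; have d0 : 0 < d by rewrite divr_gt0.
pose q (x : 'rV[R]_3) := d ^+ 2 + - \sum_i (x 0 i - x0 0 i) * (x 0 i - x0 0 i).
exists (fun x => psi 0 (q x)).
exists [set v : 'rV[R]_3 | forall i, `[x0 0 i - d, x0 0 i + d]%classic (v ord0 i)].
split.
- move=> k; apply: Ck_psi; first exact: openT.
  have oT : open [set: 'rV[R]_3] by exact: openT.
  apply: smooth_add => //; first exact: smooth_cst.
  apply: smooth_opp => //; apply: smooth_sum => // i _.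
  have s : smooth [set: 'rV[R]_3] (fun x => x 0 i - x0 0 i).
    by apply: smooth_sub_fun => //; [exact: smooth_coord|exact: smooth_cst].
  exact: smooth_mul.
- rewrite /q big1 ?oppr0 ?addr0; last by move=> i _; rewrite subrr mul0r.
  rewrite /psi exprn_gt0// gt_eqF// mulr_gt0 ?expR_gt0// expr0 ltr01.
- by apply: (@rV_compact R 3 (fun i => `[x0 0 i - d, x0 0 i + d]%classic)) => i; exact: segment_compact.
- move=> v Kv; apply: eV.
  rewrite -ball_normE /ball_ /=.
  apply: le_lt_trans (_ : d < e); last by rewrite /d ltr_pdivrMr// ltr_pMr// ltr1n.
  rewrite [leLHS]/Num.Def.normr/= mx_normrE; apply: bigmax_le => /=; first exact: ltW.
  move=> -[i j] _ /=; rewrite (ord1 i) !mxE.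
  have := Kv j; rewrite /= in_itv /= => /andP[h1 h2].
  by rewrite ler_norml; apply/andP; split; lra.
- move=> x nK; rewrite /psi ifF//; apply/negP => qx; apply: nK => i.
  rewrite /= in_itv /=.
  have h : (x 0 i - x0 0 i) * (x 0 i - x0 0 i) <= \sum_j (x 0 j - x0 0 j) * (x 0 j - x0 0 j).
    rewrite (bigD1 i) //= lerDl sumr_ge0 // => j _.
    by rewrite -expr2 sqr_ge0.
  have h' : (x 0 i - x0 0 i) ^+ 2 <= d ^+ 2.
    rewrite expr2; apply: le_trans h _; rewrite /q in qx; lra.
  have : `|x 0 i - x0 0 i| <= d.
    by rewrite -(ger0_norm (ltW d0)) -ler_sqr ?nnegrE// !real_normK ?num_real.
  by rewrite ler_norml => /andP[h1 h2]; apply/andP; split; lra.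
Qed.

(** * Derivations, and complex and matrix valued functions *)

Local Open Scope complex_scope.

Lemma derive_mulf R (U : set 'rV[R]_3) f g x v : open U ->
  smooth U f -> smooth U g -> U x ->
  'D_v (fun y => f y * g y) x = 'D_v f x * g x + f x * 'D_v g x.
Proof.
move=> oU fs gs Ux.
rewrite (deriveM (smooth_derivable oU fs Ux) (smooth_derivable oU gs Ux)).
by rewrite [RHS]addrC [in RHS](mulrC _ (g x)).
Qed.

Lemma derive_addf R (U : set 'rV[R]_3) f g x v : open U ->
  smooth U f -> smooth U g -> U x ->
  'D_v (fun y => f y + g y) x = 'D_v f x + 'D_v g x.
Proof.
move=> oU fs gs Ux.
exact: (deriveD (smooth_derivable oU fs Ux) (smooth_derivable oU gs Ux)).
Qed.

Lemma derive_oppf R (U : set 'rV[R]_3) f x v : open U ->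
  smooth U f -> U x -> 'D_v (fun y => - f y) x = - 'D_v f x.
Proof. by move=> oU fs Ux; exact: (deriveN (smooth_derivable oU fs Ux)). Qed.

Lemma derive_ext R (W : normedModType R) (U : set 'rV[R]_3) (f g : 'rV[R]_3 -> W) x v :
  open U -> U x -> (forall y, U y -> f y = g y) -> 'D_v f x = 'D_v g x.
Proof. by move=> oU Ux fg; exact: near_eq_derive (near_open oU Ux fg). Qed.

Lemma derive_sumf R (U : set 'rV[R]_3) (I : Type) (r : seq I)
    (f : I -> 'rV[R]_3 -> R) x v : open U ->
  (forall i, smooth U (f i)) -> U x ->
  'D_v (fun y => \sum_(i <- r) f i y) x = \sum_(i <- r) 'D_v (f i) x.
Proof.
move=> oU fs Ux; elim: r => [|i r IH].
  rewrite big_nil -[RHS](derive_cst (0 : R) x v); congr ('D_v _ x).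
  by apply/funext => y; rewrite big_nil.
rewrite big_cons -IH -(derive_addf _ oU (fs i) _ Ux); last exact: smooth_sum.
by congr ('D_v _ x); apply/funext => y; rewrite big_cons.
Qed.

Lemma derive_dirD R (U : set 'rV[R]_3) f x v w (a : R) : open U ->
  smooth U f -> U x -> 'D_(a *: v + w) f x = a * 'D_v f x + 'D_w f x.
Proof.
move=> oU fs Ux; have df := smooth_diff oU fs Ux.
by rewrite (deriveE _ df) (deriveE v df) (deriveE w df) linearP.
Qed.

(** The second order part is symmetric, so that it cancels in a bracket. *)
Lemma derive_Dfield R (U : set 'rV[R]_3) Y f x w : open U ->
  smooth_rv U Y -> smooth U f -> U x ->
  'D_w (fun y => 'D_(Y y) f y) x =
   'D_('D_w Y x) f x + \sum_i \sum_j w 0 i * Y x 0 j * 'D_(e_ R i) ('D_(e_ R j) f) x.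
Proof.
move=> oU Ys fs Ux.
rewrite (@derive_ext _ _ U _ (fun y => \sum_j Y y 0 j * 'D_(e_ R j) f y)) //; last first.
  by move=> y Uy; rewrite derive_lin//; exact: smooth_diff fs Uy.
rewrite (@derive_sumf _ U) //; last first.
  by move=> j; apply: smooth_mul => //; exact: smooth_D.
rewrite exchange_big /= [in RHS]derive_lin; last exact: smooth_diff fs Ux.
rewrite -big_split; apply: eq_bigr => j _ /=.
rewrite (@derive_mulf _ U) //; last exact: smooth_D.
rewrite derive_rv; last exact: smooth_rv_diff Ys Ux.
congr (_ + _).
rewrite [in LHS]derive_lin; last exact: smooth_diff (smooth_D _ fs) Ux.
rewrite mulr_sumr; apply: eq_bigr => i _.
by rewrite mulrCA mulrA.
Qed.

Lemma derive_bracket R (U : set 'rV[R]_3) X Y f x : open U ->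
  smooth_rv U X -> smooth_rv U Y -> smooth U f -> U x ->
  'D_(X x) (fun y => 'D_(Y y) f y) x - 'D_(Y x) (fun y => 'D_(X y) f y) x =
  'D_(bracket X Y x) f x.
Proof.
move=> oU Xs Ys fs Ux.
have Ssym : \sum_i \sum_j X x 0 i * Y x 0 j * 'D_(e_ R i) ('D_(e_ R j) f) x =
    \sum_i \sum_j Y x 0 i * X x 0 j * 'D_(e_ R i) ('D_(e_ R j) f) x.
  rewrite exchange_big; apply: eq_bigr => i _; apply: eq_bigr => j _ /=.
  by rewrite (smooth_derive_comm i j oU fs Ux) (mulrC (X x 0 j)).
have E : 'D_(bracket X Y x) f x = 'D_('D_(X x) Y x) f x - 'D_('D_(Y x) X x) f x.
  by rewrite /bracket addrC -scaleN1r (derive_dirD _ _ _ oU fs Ux) mulN1r addrC.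
rewrite (derive_Dfield _ oU Ys fs Ux) (derive_Dfield _ oU Xs fs Ux) Ssym E.
move: ('D_('D_(X x) Y x) f x) ('D_('D_(Y x) X x) f x) (\sum_i _) => a b S.
by rewrite opprD addrACA subrr addr0.
Qed.

Definition smoothC R (U : set 'rV[R]_3) (f : 'rV[R]_3 -> R[i]) :=
  smooth U (fun x => Re (f x)) /\ smooth U (fun x => Im (f x)).

(** Derivative of a complex valued function along a real vector. *)
Definition DC R (f : 'rV[R]_3 -> R[i]) (x v : 'rV[R]_3) : R[i] :=
  'D_v (fun y => Re (f y)) x +i* 'D_v (fun y => Im (f y)) x.

Lemma cReM R (a b : R[i]) :
  Re (a * b) = Re a * Re b - Im a * Im b.
Proof. by case: a; case: b. Qed.

Lemma cImM R (a b : R[i]) :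
  Im (a * b) = Re a * Im b + Im a * Re b.
Proof. by case: a => ? ?; case: b => ? ? /=. Qed.

Lemma cReD R (a b : R[i]) : Re (a + b) = Re a + Re b.
Proof. by case: a; case: b. Qed.

Lemma cImD R (a b : R[i]) : Im (a + b) = Im a + Im b.
Proof. by case: a; case: b. Qed.

Lemma cReN R (a : R[i]) : Re (- a) = - Re a.
Proof. by case: a. Qed.

Lemma cImN R (a : R[i]) : Im (- a) = - Im a.
Proof. by case: a. Qed.

Lemma cReJ R (a : R[i]) : Re (conjc a) = Re a.
Proof. by case: a. Qed.

Lemma cImJ R (a : R[i]) : Im (conjc a) = - Im a.
Proof. by case: a. Qed.

Lemma cReC R (a : R) : Re (a%:C) = a.
Proof. by []. Qed.

Lemma cImC R (a : R) : Im (a%:C) = 0.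
Proof. by []. Qed.

Definition ReImE := (cReM, cImM, cReD, cImD, cReN, cImN, cReJ, cImJ, cReC, cImC).

Lemma cplxP R (a b : R[i]) :
  Re a = Re b -> Im a = Im b -> a = b.
Proof. by case: a => ? ?; case: b => ? ? /= -> ->. Qed.

Lemma ReDC R (f : 'rV[R]_3 -> R[i]) x v :
  Re (DC f x v) = 'D_v (fun y => Re (f y)) x.
Proof. by []. Qed.

Lemma ImDC R (f : 'rV[R]_3 -> R[i]) x v :
  Im (DC f x v) = 'D_v (fun y => Im (f y)) x.
Proof. by []. Qed.

Lemma smoothC_cst R (U : set 'rV[R]_3) (a : R[i]) : open U -> smoothC U (fun=> a).
Proof. by move=> oU; split; exact: smooth_cst. Qed.

Lemma smoothC_ext R (U : set 'rV[R]_3) f g : open U ->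
  (forall x, U x -> f x = g x) -> smoothC U f -> smoothC U g.
Proof.
move=> oU fg [fr fi]; split; [apply: smooth_ext fr|apply: smooth_ext fi] => // x /fg ->//.
Qed.

Lemma smoothC_restr R (U V : set 'rV[R]_3) f :
  V `<=` U -> smoothC U f -> smoothC V f.
Proof. by move=> VU [fr fi]; split; apply: smooth_restr VU _. Qed.

Lemma smoothC_add R (U : set 'rV[R]_3) f g : open U ->
  smoothC U f -> smoothC U g -> smoothC U (fun x => f x + g x).
Proof.
move=> oU [fr fi] [gr gi]; split.
  by apply: smooth_ext (smooth_add oU fr gr) => // x _; rewrite cReD.
by apply: smooth_ext (smooth_add oU fi gi) => // x _; rewrite cImD.
Qed.

Lemma smoothC_mul R (U : set 'rV[R]_3) f g : open U ->
  smoothC U f -> smoothC U g -> smoothC U (fun x => f x * g x).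
Proof.
move=> oU [fr fi] [gr gi]; split.
  apply: smooth_ext (smooth_sub_fun oU (smooth_mul oU fr gr) (smooth_mul oU fi gi)) => // x _.
  by rewrite cReM.
apply: smooth_ext (smooth_add oU (smooth_mul oU fr gi) (smooth_mul oU fi gr)) => // x _.
by rewrite cImM.
Qed.

Lemma smoothC_conj R (U : set 'rV[R]_3) f : open U ->
  smoothC U f -> smoothC U (fun x => conjc (f x)).
Proof.
move=> oU [fr fi]; split; first by apply: smooth_ext fr => // x _; rewrite cReJ.
by apply: smooth_ext (smooth_opp oU fi) => // x _; rewrite cImJ.
Qed.

Lemma smoothC_real R (U : set 'rV[R]_3) f : open U ->
  smooth U f -> smoothC U (fun x => (f x)%:C).
Proof. by move=> oU fs; split => //=; exact: smooth_cst. Qed.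

Lemma smoothC_sum R (U : set 'rV[R]_3) (I : Type) (r : seq I)
    (f : I -> 'rV[R]_3 -> R[i]) : open U ->
  (forall i, smoothC U (f i)) -> smoothC U (fun x => \sum_(i <- r) f i x).
Proof.
move=> oU fs; elim: r => [|i r IH].
  by apply: smoothC_ext (smoothC_cst 0 oU) => // x _; rewrite big_nil.
by apply: smoothC_ext (smoothC_add oU (fs i) IH) => // x _; rewrite big_cons.
Qed.

Lemma DC_ext R (U : set 'rV[R]_3) f g (x v : 'rV[R]_3) : open U -> U x ->
  (forall y, U y -> f y = g y) -> DC f x v = DC g x v.
Proof.
by move=> oU Ux fg; congr (_ +i* _); apply: (derive_ext _ oU Ux) => y /fg ->.
Qed.

Lemma DC_cst R (a : R[i]) (x v : 'rV[R]_3) : DC (fun=> a) x v = 0.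
Proof. by rewrite /DC !derive_cst. Qed.

Lemma DC_add R (U : set 'rV[R]_3) f g x v : open U ->
  smoothC U f -> smoothC U g -> U x -> DC (fun y => f y + g y) x v = DC f x v + DC g x v.
Proof.
move=> oU [fr fi] [gr gi] Ux; apply/cplxP; [rewrite [RHS]cReD !ReDC|rewrite [RHS]cImD !ImDC].
  by rewrite -(derive_addf _ oU fr gr Ux); apply: (derive_ext _ oU Ux) => y _; rewrite cReD.
by rewrite -(derive_addf _ oU fi gi Ux); apply: (derive_ext _ oU Ux) => y _; rewrite cImD.
Qed.

Lemma DC_mul R (U : set 'rV[R]_3) f g x v : open U ->
  smoothC U f -> smoothC U g -> U x ->
  DC (fun y => f y * g y) x v = DC f x v * g x + f x * DC g x v.
Proof.
move=> oU [fr fi] [gr gi] Ux; apply/cplxP.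
  rewrite ReDC [RHS]cReD 2!cReM !(ReDC, ImDC).
  rewrite (_ : (fun y => _) = fun y => Re (f y) * Re (g y)
    + - (Im (f y) * Im (g y))); last by apply/funext => y; rewrite cReM.
  have m1 := smooth_mul oU fr gr; have m2 := smooth_mul oU fi gi.
  rewrite (derive_addf _ oU m1 (smooth_opp oU m2) Ux) (derive_oppf _ oU m2 Ux).
  rewrite (derive_mulf _ oU fr gr Ux) (derive_mulf _ oU fi gi Ux).
  by ring.
rewrite ImDC [RHS]cImD 2!cImM !(ReDC, ImDC).
rewrite (_ : (fun y => _) = fun y => Re (f y) * Im (g y)
    + (Im (f y) * Re (g y))); last by apply/funext => y; rewrite cImM.
have m1 := smooth_mul oU fr gi; have m2 := smooth_mul oU fi gr.
rewrite (derive_addf _ oU m1 m2 Ux).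
rewrite (derive_mulf _ oU fr gi Ux) (derive_mulf _ oU fi gr Ux).
by ring.
Qed.

Lemma DC_conj R (U : set 'rV[R]_3) f x v : open U ->
  smoothC U f -> U x -> DC (fun y => conjc (f y)) x v = conjc (DC f x v).
Proof.
move=> oU [fr fi] Ux; apply/cplxP; [rewrite [RHS]cReJ !ReDC|rewrite [RHS]cImJ !ImDC].
  by apply: (derive_ext _ oU Ux) => y _; rewrite cReJ.
by rewrite -(derive_oppf _ oU fi Ux); apply: (derive_ext _ oU Ux) => y _; rewrite cImJ.
Qed.

Lemma DC_sum R (U : set 'rV[R]_3) (I : Type) (r : seq I)
    (f : I -> 'rV[R]_3 -> R[i]) x v : open U ->
  (forall i, smoothC U (f i)) -> U x ->
  DC (fun y => \sum_(i <- r) f i y) x v = \sum_(i <- r) DC (f i) x v.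
Proof.
move=> oU fs Ux; elim: r => [|i r IH].
  by rewrite big_nil -[RHS](DC_cst 0 x v); apply: (DC_ext _ oU Ux) => y _; rewrite big_nil.
rewrite big_cons -IH -(DC_add _ oU (fs i) _ Ux); last exact: smoothC_sum.
by apply: (DC_ext _ oU Ux) => y _; rewrite big_cons.
Qed.

Lemma DC_dirD R (U : set 'rV[R]_3) f x v w (a : R) : open U ->
  smoothC U f -> U x -> DC f x (a *: v + w) = a%:C * DC f x v + DC f x w.
Proof.
move=> oU [fr fi] Ux; apply/cplxP.
  rewrite [RHS]cReD cReM cReC cImC mul0r subr0 !ReDC.
  exact: (derive_dirD _ _ _ oU fr Ux).
rewrite [RHS]cImD cImM cReC cImC mul0r addr0 !ImDC.
exact: (derive_dirD _ _ _ oU fi Ux).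
Qed.

Lemma smoothC_Dfield R (U : set 'rV[R]_3) X f : open U ->
  smooth_rv U X -> smoothC U f -> smoothC U (fun x => DC f x (X x)).
Proof. by move=> oU Xs [fr fi]; split; exact: smooth_Dfield. Qed.

Lemma DC_bracket R (U : set 'rV[R]_3) X Y f x : open U ->
  smooth_rv U X -> smooth_rv U Y -> smoothC U f -> U x ->
  DC (fun y => DC f y (Y y)) x (X x) - DC (fun y => DC f y (X y)) x (Y x) =
  DC f x (bracket X Y x).
Proof.
move=> oU Xs Ys [fr fi] Ux; apply/cplxP; [rewrite [LHS]cReD cReN|rewrite [LHS]cImD cImN].
  exact: (derive_bracket oU Xs Ys fr Ux).
exact: (derive_bracket oU Xs Ys fi Ux).
Qed.

Lemma smooth_mx_mul R (U : set 'rV[R]_3) F G : open U ->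
  smooth_mx U F -> smooth_mx U G -> smooth_mx U (fun x => F x *m G x).
Proof.
move=> oU Fs Gs i j.
have H : smoothC U (fun x => \sum_k F x i k * G x k j).
  by apply: smoothC_sum => // k; exact: (smoothC_mul oU (Fs _ _) (Gs _ _)).
by apply: smoothC_ext H => // x _; rewrite mxE.
Qed.

Lemma smooth_mx_cst R (U : set 'rV[R]_3) (A : 'M[R[i]]_3) : open U ->
  smooth_mx U (fun=> A).
Proof. by move=> oU i j; exact: smoothC_cst. Qed.

Lemma smooth_mx_adj R (U : set 'rV[R]_3) F : open U ->
  smooth_mx U F -> smooth_mx U (fun x => adjmx (F x)).
Proof.
move=> oU Fs i j.
have H : smoothC U (fun x => conjc (F x j i)) by apply: smoothC_conj => //; exact: Fs.
by apply: smoothC_ext H => // x _; rewrite !mxE.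
Qed.

Lemma smooth_mx_restr R (U V : set 'rV[R]_3) F :
  V `<=` U -> smooth_mx U F -> smooth_mx V F.
Proof. by move=> VU Fs i j; exact: smoothC_restr (Fs i j). Qed.

Lemma smooth_mx_ext R (U : set 'rV[R]_3) F G : open U ->
  (forall x, U x -> F x = G x) -> smooth_mx U F -> smooth_mx U G.
Proof. by move=> oU FG Fs i j; apply: smoothC_ext (Fs i j) => // x /FG ->. Qed.

Lemma DmxE R F (x v : 'rV[R]_3) i j : Dmx F x v i j = DC (fun y => F y i j) x v.
Proof. by rewrite mxE. Qed.

Lemma smooth_mx_Dfield R (U : set 'rV[R]_3) X F : open U ->
  smooth_rv U X -> smooth_mx U F -> smooth_mx U (fun x => Dmx F x (X x)).
Proof.
move=> oU Xs Fs i j; apply: smoothC_ext (smoothC_Dfield oU Xs (Fs i j)) => // x _.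
by rewrite DmxE.
Qed.

Lemma Dmx_ext R (U : set 'rV[R]_3) F G (x v : 'rV[R]_3) : open U -> U x ->
  (forall y, U y -> F y = G y) -> Dmx F x v = Dmx G x v.
Proof.
by move=> oU Ux FG; apply/matrixP => i j; rewrite !DmxE; apply: (DC_ext _ oU Ux) => y /FG ->.
Qed.

Lemma Dmx_cst R A (x v : 'rV[R]_3) : Dmx (fun=> A) x v = 0.
Proof. by apply/matrixP => i j; rewrite DmxE DC_cst mxE. Qed.

Lemma Dmx_mul R (U : set 'rV[R]_3) F G x v : open U ->
  smooth_mx U F -> smooth_mx U G -> U x ->
  Dmx (fun y => F y *m G y) x v = Dmx F x v *m G x + F x *m Dmx G x v.
Proof.
move=> oU Fs Gs Ux; apply/matrixP => i j.
rewrite DmxE (@DC_ext _ U _ (fun y => \sum_k F y i k * G y k j)) //; last first.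
  by move=> y _; rewrite mxE.
rewrite (@DC_sum _ U) //; last by move=> k; exact: (smoothC_mul oU (Fs _ _) (Gs _ _)).
rewrite !mxE -big_split; apply: eq_bigr => k _ /=.
by rewrite (DC_mul _ oU (Fs i k) (Gs k j) Ux) !DmxE.
Qed.

Lemma Dmx_adj R (U : set 'rV[R]_3) F x v : open U ->
  smooth_mx U F -> U x -> Dmx (fun y => adjmx (F y)) x v = adjmx (Dmx F x v).
Proof.
move=> oU Fs Ux; apply/matrixP => i j; rewrite DmxE [RHS]mxE [RHS]mxE DmxE.
rewrite -(DC_conj _ oU (Fs j i) Ux); apply: (DC_ext _ oU Ux) => y _.
by rewrite !mxE.
Qed.

Lemma Dmx_dirD R (U : set 'rV[R]_3) F x v w (a : R) : open U ->
  smooth_mx U F -> U x -> Dmx F x (a *: v + w) = a%:C *: Dmx F x v + Dmx F x w.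
Proof.
move=> oU Fs Ux; apply/matrixP => i j; rewrite DmxE (DC_dirD _ _ _ oU (Fs i j) Ux).
by rewrite [RHS]mxE [X in _ = X + _]mxE !DmxE.
Qed.

Lemma Dmx_bracket R (U : set 'rV[R]_3) X Y F x : open U ->
  smooth_rv U X -> smooth_rv U Y -> smooth_mx U F -> U x ->
  Dmx (fun y => Dmx F y (Y y)) x (X x) - Dmx (fun y => Dmx F y (X y)) x (Y x) =
  Dmx F x (bracket X Y x).
Proof.
move=> oU Xs Ys Fs Ux; apply/matrixP => i j.
apply: etrans (esym (DmxE _ _ _ _ _)).
apply: etrans (DC_bracket oU Xs Ys (Fs i j) Ux).
have E Z W : DC (fun y => Dmx F y (Z y) i j) x W = DC (fun y => DC (fun z => F z i j) y (Z y)) x W.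
  by apply: (DC_ext _ oU Ux) => y _; rewrite DmxE.
by rewrite -!E mxE DmxE; congr (_ + _); rewrite mxE DmxE.
Qed.

Lemma smooth_det R (U : set 'rV[R]_3) n (B : 'rV[R]_3 -> 'M[R]_n) : open U ->
  (forall i j, smooth U (fun x => B x i j)) -> smooth U (fun x => \det (B x)).
Proof.
move=> oU Bs; rewrite /determinant; apply: smooth_sum => // s _.
apply: smooth_mul => //; first exact: smooth_cst.
by apply: smooth_prod => // i; exact: Bs.
Qed.

(** Cramer's formula. *)
Lemma smooth_invmx R (U : set 'rV[R]_3) n (B : 'rV[R]_3 -> 'M[R]_n) i j : open U ->
  (forall i j, smooth U (fun x => B x i j)) -> (forall x, U x -> B x \in unitmx) ->
  smooth U (fun x => invmx (B x) i j).
Proof.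
move=> oU Bs Bu.
have H : smooth U (fun x => (\det (B x))^-1 * cofactor (B x) j i).
  apply: smooth_mul => //.
    apply: smooth_inv => // [x /Bu|]; last exact: smooth_det.
    by rewrite unitmxE unitfE.
  apply: smooth_mul => //; first exact: smooth_cst.
  apply: smooth_det => // k l.
  by apply: smooth_ext (Bs (lift j k) (lift i l)) => // x _; rewrite !mxE.
by apply: smooth_ext H => // x /Bu Bx; rewrite /invmx Bx !mxE.
Qed.

Lemma open_gt0 R (U : set 'rV[R]_3) f : open U -> smooth U f ->
  open [set x | U x /\ 0 < f x].
Proof.
move=> oU fs; rewrite openE => x [Ux fx].
apply: filterI; first exact: open_nbhs_nbhs.
exact: (@cvgr_gt _ _ _ _ f (f x) (smooth_continuous fs Ux) 0 fx).
Qed.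

Lemma open_neq0 R (U : set 'rV[R]_3) f : open U -> smooth U f ->
  open [set x | U x /\ f x != 0].
Proof.
move=> oU fs; have := open_gt0 oU (smooth_mul oU fs fs).
congr open; apply/seteqP; split=> x [Ux /= fx]; split => //.
  by move: fx; rewrite -expr2 exprn_even_gt0//= orbF.
by rewrite -expr2 exprn_even_gt0//= fx orbT.
Qed.

(** * Unitary frames and their connection form *)

Lemma ord3P (P : 'I_3 -> Prop) : P 0 -> P 1 -> P ord_max -> forall i, P i.
Proof.
move=> P0 P1 P2 i; case: i => [[|[|[|//]]] Hi].
- by rewrite (_ : Ordinal Hi = 0)//; exact/val_inj.
- by rewrite (_ : Ordinal Hi = 1)//; exact/val_inj.
- by rewrite (_ : Ordinal Hi = ord_max)//; exact/val_inj.
Qed.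

Lemma sum3 (V : nmodType) (F : 'I_3 -> V) : \sum_i F i = F 0 + F 1 + F ord_max.
Proof.
rewrite !big_ord_recl big_ord0 addr0 addrA.
by congr (_ + F _ + F _); apply/val_inj.
Qed.

Lemma mulmx3 (R : pzRingType) m n (A : 'M[R]_(m, 3)) (B : 'M[R]_(3, n)) i j :
  (A *m B) i j = A i 0 * B 0 j + A i 1 * B 1 j + A i ord_max * B ord_max j.
Proof. by rewrite mxE sum3. Qed.

Lemma mxtrace3 (R : pzRingType) (A : 'M[R]_3) : \tr A = A 0 0 + A 1 1 + A ord_max ord_max.
Proof. by rewrite /mxtrace sum3. Qed.

(** Gram matrix [diag (1/k, 1, 1)], [k = c / 4], of a frame [(z, e1, e2)] of [C^3]
   with [h(z,z) = 1/k] and [e1], [e2] orthonormal and orthogonal to [z].  With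
   this normalization of [z] the components of a tangent vector in the frame are
   isometric for [kmetric], whatever the sign of [c]. *)
Definition Kmx R (c : R) : 'M[R[i]]_3 :=
  diag_mx (\row_j (if j == 0 then (4 / c)%:C else 1)).
Definition Kinv R (c : R) : 'M[R[i]]_3 :=
  diag_mx (\row_j (if j == 0 then (c / 4)%:C else 1)).

Definition unit_frame R (c : R) (Phi : 'M[R[i]]_3) :=
  adjmx Phi *m herm_mx c *m Phi = Kmx c.

(** The inverse of a unitary frame.  It is locked, as [Om] and the frame fields
   below, to keep unification from unfolding it. *)
Fact frinv_key : unit. Proof. exact: tt. Qed.
Definition frinv R (c : R) (Phi : 'M[R[i]]_3) : 'M[R[i]]_3 :=
  locked_with frinv_key (Kinv c *m adjmx Phi *m herm_mx c).

Lemma frinvE R (c : R) (Phi : 'M[R[i]]_3) :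
  frinv c Phi = Kinv c *m adjmx Phi *m herm_mx c.
Proof. by rewrite /frinv unlock. Qed.

(** The line spanned by the first vector of a frame [Phi] is
   [Phi *m e00 *m frinv c Phi]. *)
Definition e00 R : 'M[R[i]]_3 := delta_mx 0 0.

Lemma mul_e00 R (A : 'M[R[i]]_3) i j : (A *m e00 R) i j = A i 0 *+ (j == 0).
Proof.
rewrite mulmx3 !mxE /= !mulr0n !mulr0 !addr0.
by case: (j == 0); rewrite ?mulr1n ?mulr0n ?mulr1 ?mulr0.
Qed.

Lemma e00_mul R (A : 'M[R[i]]_3) i j : (e00 R *m A) i j = A 0 j *+ (i == 0).
Proof.
rewrite mulmx3 !mxE /= andbT !andbF !mulr0n !mul0r !addr0.
by case: (i == 0); rewrite ?mulr1n ?mulr0n ?mul1r ?mul0r.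
Qed.

(** The tangent vector of [M_2(c)] mapping [z] to [p e1 + q e2], written in the
   frame; the first row is forced by [h]-selfadjointness. *)
Definition tmx R (c : R) (p q : R[i]) : 'M[R[i]]_3 :=
  \matrix_(i, j) match nat_of_ord i, nat_of_ord j with
    | 1%N, 0%N => p | 2%N, 0%N => q
    | 0%N, 1%N => (c / 4)%:C * conjc p | 0%N, 2%N => (c / 4)%:C * conjc q
    | _, _ => 0 end.

Lemma KinvK R (c : R) : c != 0 -> Kinv c *m Kmx c = 1%:M.
Proof.
move=> c0; apply/matrixP; apply: ord3P; apply: ord3P; rewrite mulmx3 !mxE //=;
  rewrite ?mulr1n ?mulr0n ?mulr0 ?mul0r ?addr0 ?add0r ?mulr1 //.
by rewrite -rmorphM /= mulrA divfK ?pnatr_eq0// divff.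
Qed.

Lemma frinvM R (c : R) (Phi : 'M[R[i]]_3) : c != 0 ->
  unit_frame c Phi -> frinv c Phi *m Phi = 1%:M.
Proof. by move=> c0 uP; rewrite frinvE -!mulmxA (mulmxA (adjmx Phi)) uP KinvK. Qed.

Lemma mulVfr R (c : R) (Phi : 'M[R[i]]_3) : c != 0 ->
  unit_frame c Phi -> Phi *m frinv c Phi = 1%:M.
Proof. by move=> c0 uP; apply: mulmx1C; exact: frinvM. Qed.

Lemma KKinv R (c : R) : c != 0 -> Kmx c *m Kinv c = 1%:M.
Proof. by move=> c0; apply: mulmx1C; exact: KinvK. Qed.

Lemma Kfrinv R (c : R) (Phi : 'M[R[i]]_3) : c != 0 ->
  Kmx c *m frinv c Phi = adjmx Phi *m herm_mx c.
Proof. by move=> c0; rewrite frinvE -!mulmxA mulmxA KKinv// mul1mx. Qed.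

Lemma adjmx_K R (c : R) : adjmx (Kmx c) = Kmx c.
Proof.
apply/matrixP; apply: ord3P; apply: ord3P; rewrite !mxE //= ?mulr1n ?mulr0n ?rmorph0 ?rmorph1 ?oppr0 //.
Qed.

Lemma conj_cancel R (c : R) (Phi A B : 'M[R[i]]_3) : c != 0 ->
  unit_frame c Phi ->
  (Phi *m A *m frinv c Phi) *m (Phi *m B *m frinv c Phi) = Phi *m (A *m B) *m frinv c Phi.
Proof.
move=> c0 uP; rewrite -!mulmxA (mulmxA (frinv c Phi)) frinvM//.
by rewrite mul1mx.
Qed.

Lemma kmetric_frame R (c : R) (Phi A B : 'M[R[i]]_3) : c != 0 ->
  unit_frame c Phi ->
  kmetric c (Phi *m A *m frinv c Phi) (Phi *m B *m frinv c Phi) = 2 / c * Re (\tr (A *m B)).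
Proof.
move=> c0 uP; rewrite /kmetric conj_cancel//.
by rewrite mxtrace_mulC (mulmxA (frinv c Phi)) frinvM// mul1mx.
Qed.

Lemma tr_tmx R (c : R) (A : 'M[R[i]]_3) p q : c != 0 ->
  A 0 1 = (c / 4)%:C * conjc (A 1 0) -> A 0 ord_max = (c / 4)%:C * conjc (A ord_max 0) ->
  2 / c * Re (\tr (A *m tmx c p q)) =
  Re (A 1 0 * conjc p + A ord_max 0 * conjc q).
Proof.
move=> c0 A1 A2; rewrite mxtrace3 !mulmx3 /tmx !mxE /= A1 A2 !ReImE.
by field.
Qed.

Lemma kmetric_tmx R (c : R) (Phi : 'M[R[i]]_3) p q p' q' : c != 0 ->
  unit_frame c Phi ->
  kmetric c (Phi *m tmx c p q *m frinv c Phi) (Phi *m tmx c p' q' *m frinv c Phi) =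
  Re (p * conjc p' + q * conjc q').
Proof. by move=> c0 uP; rewrite kmetric_frame// tr_tmx// !mxE. Qed.

Lemma cstruct_tmx R (c : R) (Phi : 'M[R[i]]_3) p q : c != 0 ->
  unit_frame c Phi ->
  cstruct (Phi *m e00 R *m frinv c Phi) (Phi *m tmx c p q *m frinv c Phi) =
  Phi *m tmx c ('i * p) ('i * q) *m frinv c Phi.
Proof.
move=> c0 uP; rewrite /cstruct !conj_cancel// -mulmxBl -mulmxBr scalemxAl scalemxAr.
congr (_ *m _ *m _).
apply/matrixP; apply: ord3P; apply: ord3P; rewrite mxE [X in _ * X]mxE [X in _ * (_ + X)]mxE;
  rewrite mul_e00 e00_mul !mxE /= ?mulr1n ?mulr0n ?subr0 ?sub0r ?subrr ?mulr0 //.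
- by case: p => a b; apply/cplxP; rewrite /=; ring.
- by case: q => a b; apply/cplxP; rewrite /=; ring.
Qed.

Lemma tangent_tmx R (c : R) (Phi : 'M[R[i]]_3) p q : c != 0 ->
  unit_frame c Phi ->
  tangentM2 c (Phi *m e00 R *m frinv c Phi) (Phi *m tmx c p q *m frinv c Phi).
Proof.
move=> c0 uP; split; last first.
  rewrite !conj_cancel// -mulmxDl -mulmxDr; congr (_ *m _ *m _).
  apply/matrixP; apply: ord3P; apply: ord3P; rewrite mxE;
    by rewrite mul_e00 e00_mul !mxE /= ?mulr1n ?mulr0n ?add0r ?addr0.
have HH : adjmx (frinv c Phi) *m adjmx (tmx c p q) *m Kmx c = herm_mx c *m Phi *m tmx c p q.
  have -> : adjmx (frinv c Phi) = herm_mx c *m Phi *m Kinv c.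
    rewrite frinvE !adjmxM adjmxK adjmx_herm mulmxA; congr (_ *m _).
    apply/matrixP; apply: ord3P; apply: ord3P; rewrite !mxE //= ?mulr1n ?mulr0n ?rmorph0 ?rmorph1 ?oppr0 //.
  rewrite -!mulmxA; congr (_ *m (_ *m _)).
  case: p => p1 p2; case: q => q1 q2.
  apply/matrixP; apply: ord3P; apply: ord3P; rewrite !mulmx3 !mxE /=;
    rewrite ?mulr1n ?mulr0n; apply/cplxP; rewrite /=; by field.
have := Kfrinv Phi c0; move: (Kmx c) (tmx c p q) (frinv c Phi) (herm_mx c) HH => K T F H HH KF.
by rewrite !adjmxM -!mulmxA -KF !mulmxA HH.
Qed.

Fact Om_key : unit. Proof. exact: tt. Qed.

Section MovingFrame.
Context (R : realType) (c : R) (c0 : c != 0).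
Context (V : set 'rV[R]_3) (oV : open V).
Context (Phi : 'rV[R]_3 -> 'M[R[i]]_3) (Ps : smooth_mx V Phi).
Context (uP : forall x, V x -> unit_frame c (Phi x)).

(** The pulled back Maurer-Cartan form [Phi^-1 dPhi]. *)
Definition Om (x v : 'rV[R]_3) : 'M[R[i]]_3 :=
  locked_with Om_key (frinv c (Phi x) *m Dmx Phi x v).

Lemma OmE x v : Om x v = frinv c (Phi x) *m Dmx Phi x v.
Proof. by rewrite /Om unlock. Qed.

Lemma smooth_frinv : smooth_mx V (fun x => frinv c (Phi x)).
Proof.
have H : smooth_mx V (fun x => Kinv c *m adjmx (Phi x) *m herm_mx c).
  apply: smooth_mx_mul => //; last exact: smooth_mx_cst.
  apply: smooth_mx_mul => //; first exact: smooth_mx_cst.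
  exact: smooth_mx_adj.
by apply: smooth_mx_ext H => // x _; rewrite frinvE.
Qed.

Lemma Dmx_Phi x v : V x -> Dmx Phi x v = Phi x *m Om x v.
Proof. by move=> Vx; rewrite OmE mulmxA mulVfr ?mul1mx//; exact: uP. Qed.

Lemma Dmx_frinv x v : V x -> Dmx (fun y => frinv c (Phi y)) x v = - (Om x v *m frinv c (Phi x)).
Proof.
move=> Vx; have sf := smooth_frinv.
have : Dmx (fun y => frinv c (Phi y) *m Phi y) x v = 0.
  rewrite -[RHS](Dmx_cst 1%:M x v); apply: (Dmx_ext _ oV Vx) => y Vy.
  by rewrite frinvM//; exact: uP.
rewrite (Dmx_mul _ oV sf Ps Vx) -OmE.
move=> /eqP; rewrite addr_eq0 => /eqP E.
have := congr1 (mulmx^~ (frinv c (Phi x))) E.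
by rewrite -mulmxA mulVfr ?mulmx1 ?mulNmx//; exact: uP.
Qed.

Lemma Om_smooth X : smooth_rv V X -> smooth_mx V (fun x => Om x (X x)).
Proof.
move=> Xs; have H := smooth_mx_mul oV smooth_frinv (smooth_mx_Dfield oV Xs Ps).
by apply: smooth_mx_ext H => // x _; rewrite OmE.
Qed.

Lemma Om_dirD x v w (a : R) : V x -> Om x (a *: v + w) = a%:C *: Om x v + Om x w.
Proof. by move=> Vx; rewrite !OmE (Dmx_dirD _ _ _ oV Ps Vx) mulmxDr -scalemxAr. Qed.

(** Derivative of the constant Gram matrix of the frame. *)
Lemma Om_skew x v : V x -> adjmx (Om x v) *m Kmx c + Kmx c *m Om x v = 0.
Proof.
move=> Vx.
have E : Kmx c *m Om x v = adjmx (Phi x) *m herm_mx c *m Dmx Phi x v.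
  by rewrite OmE mulmxA Kfrinv.
have E' : adjmx (Om x v) *m Kmx c = adjmx (Dmx Phi x v) *m herm_mx c *m Phi x.
  rewrite -{1}(adjmx_K c) -adjmxM E !adjmxM adjmxK adjmx_herm.
  by rewrite mulmxA.
have sa := smooth_mx_adj oV Ps.
have sH := smooth_mx_cst (herm_mx c) oV.
rewrite E E' -(Dmx_adj _ oV Ps Vx).
have : Dmx (fun y => adjmx (Phi y) *m herm_mx c *m Phi y) x v = 0.
  by rewrite -[RHS](Dmx_cst (Kmx c) x v); apply: (Dmx_ext _ oV Vx) => y /uP.
rewrite (Dmx_mul _ oV (smooth_mx_mul oV sa sH) Ps Vx) (Dmx_mul _ oV sa sH Vx).
by rewrite Dmx_cst mulmx0 addr0.
Qed.

Lemma Om_skewE x v i j : V x ->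
  conjc (Om x v j i) * (if j == 0 then (4 / c)%:C else 1)
   + (if i == 0 then (4 / c)%:C else 1) * Om x v i j = 0.
Proof.
move=> Vx; have /matrixP /(_ i j) := Om_skew v Vx.
rewrite mxE /Kmx mul_mx_diag mul_diag_mx.
by rewrite !mxE.
Qed.

Lemma Dmx_conj A x v : V x ->
  Dmx (fun y => Phi y *m A *m frinv c (Phi y)) x v =
  Phi x *m (Om x v *m A - A *m Om x v) *m frinv c (Phi x).
Proof.
move=> Vx; have sA := smooth_mx_cst A oV.
rewrite (Dmx_mul _ oV (smooth_mx_mul oV Ps sA) smooth_frinv Vx).
rewrite (Dmx_mul _ oV Ps sA Vx) Dmx_cst mulmx0 addr0 Dmx_frinv// Dmx_Phi//.
move: (Phi x) (Om x v) (frinv c (Phi x)) => P O F.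
by rewrite mulmxBr mulmxBl mulmxN !mulmxA.
Qed.

Lemma Dmx_conj_fun A x v : V x -> smooth_mx V A ->
  Dmx (fun y => Phi y *m A y *m frinv c (Phi y)) x v =
  Phi x *m (Dmx A x v + (Om x v *m A x - A x *m Om x v)) *m frinv c (Phi x).
Proof.
move=> Vx sA.
rewrite (Dmx_mul _ oV (smooth_mx_mul oV Ps sA) smooth_frinv Vx).
rewrite (Dmx_mul _ oV Ps sA Vx) Dmx_frinv// Dmx_Phi//.
move: (Phi x) (Om x v) (frinv c (Phi x)) (Dmx A x v) (A x) => P O F D B.
rewrite mulmxDr mulmxBr !mulmxDl !mulNmx mulmxN !mulmxA.
by rewrite addrA [P *m D *m F + _]addrC.
Qed.

(** The Maurer-Cartan equation [dO + O /\ O = 0].  It is the only source of the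
   Gauss and Codazzi equations in what follows. *)
Lemma integrability X Y x : smooth_rv V X -> smooth_rv V Y -> V x ->
  Dmx (fun y => Om y (Y y)) x (X x) - Dmx (fun y => Om y (X y)) x (Y x)
   + (Om x (X x) *m Om x (Y x) - Om x (Y x) *m Om x (X x)) = Om x (bracket X Y x).
Proof.
move=> Xs Ys Vx.
have H Z w : smooth_rv V Z -> Dmx (fun y => Om y (Z y)) x w =
    - (Om x w *m Om x (Z x)) + frinv c (Phi x) *m Dmx (fun y => Dmx Phi y (Z y)) x w.
  move=> Zs; rewrite (Dmx_ext (G := fun y => frinv c (Phi y) *m Dmx Phi y (Z y)) w oV Vx); last first.
    by move=> y _; rewrite OmE.
  rewrite (Dmx_mul _ oV smooth_frinv (smooth_mx_Dfield oV Zs Ps) Vx).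
  by rewrite Dmx_frinv// mulNmx -mulmxA -OmE.
rewrite (H Y)// (H X)// [in RHS]OmE -(Dmx_bracket oV Xs Ys Ps Vx) mulmxBr.
have alg (T : zmodType) (a b p q : T) : - a + p - (- b + q) + (a - b) = p - q.
  by rewrite opprD opprK addrACA (addrC (- a)) subrK (addrC b) addrK.
exact: alg.
Qed.
End MovingFrame.

(** * Levi-Civita connection of an immersion *)

Lemma Re_sum R (I : Type) (r : seq I) (F : I -> R[i]) :
  Re (\sum_(i <- r) F i) = \sum_(i <- r) Re (F i).
Proof. by elim: r => [|i r IH]; rewrite ?big_nil// !big_cons cReD IH. Qed.

Lemma Im_sum R (I : Type) (r : seq I) (F : I -> R[i]) :
  Im (\sum_(i <- r) F i) = \sum_(i <- r) Im (F i).
Proof. by elim: r => [|i r IH]; rewrite ?big_nil// !big_cons cImD IH. Qed.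

Lemma Re_realM R (a : R) (z : R[i]) : Re (a%:C * z) = a * Re z.
Proof. by rewrite cReM cImC mul0r subr0. Qed.

Lemma Im_realM R (a : R) (z : R[i]) : Im (a%:C * z) = a * Im z.
Proof. by rewrite cImM cImC mul0r addr0. Qed.

Lemma DC_lin R (U : set 'rV[R]_3) f x v : open U ->
  smoothC U f -> U x -> DC f x v = \sum_i (v 0 i)%:C * DC f x (e_ R i).
Proof.
move=> oU [fr fi] Ux; apply/cplxP.
  rewrite Re_sum; apply: etrans (derive_lin v (smooth_diff oU fr Ux)) _.
  by apply: eq_bigr => i _; rewrite Re_realM.
rewrite Im_sum; apply: etrans (derive_lin v (smooth_diff oU fi Ux)) _.
by apply: eq_bigr => i _; rewrite Im_realM.
Qed.

Lemma Dmx_lin R (U : set 'rV[R]_3) F x v : open U ->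
  smooth_mx U F -> U x -> Dmx F x v = \sum_i (v 0 i)%:C *: Dmx F x (e_ R i).
Proof.
move=> oU Fs Ux; apply/matrixP => i j; rewrite summxE DmxE (DC_lin _ oU (Fs i j) Ux).
by apply: eq_bigr => k _; rewrite [RHS]mxE DmxE.
Qed.

Lemma DC_Dfield R (U : set 'rV[R]_3) Y f x w : open U ->
  smooth_rv U Y -> smoothC U f -> U x ->
  DC (fun y => DC f y (Y y)) x w = DC f x ('D_w Y x) +
    \sum_i \sum_j (w 0 i * Y x 0 j)%:C * DC (fun y => DC f y (e_ R j)) x (e_ R i).
Proof.
move=> oU Ys [fr fi] Ux; apply/cplxP.
  apply: etrans (derive_Dfield w oU Ys fr Ux) _; rewrite [RHS]cReD; congr (_ + _).
  rewrite Re_sum; apply: eq_bigr => i _; rewrite Re_sum; apply: eq_bigr => j _.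
  by rewrite Re_realM.
apply: etrans (derive_Dfield w oU Ys fi Ux) _; rewrite [RHS]cImD; congr (_ + _).
rewrite Im_sum; apply: eq_bigr => i _; rewrite Im_sum; apply: eq_bigr => j _.
by rewrite Im_realM.
Qed.

Lemma Dmx_Dfield R (U : set 'rV[R]_3) Y F x w : open U ->
  smooth_rv U Y -> smooth_mx U F -> U x ->
  Dmx (fun y => Dmx F y (Y y)) x w = Dmx F x ('D_w Y x) +
    \sum_i \sum_j (w 0 i * Y x 0 j)%:C *: Dmx (fun y => Dmx F y (e_ R j)) x (e_ R i).
Proof.
move=> oU Ys Fs Ux; apply/matrixP => i j; rewrite DmxE mxE DmxE.
have E Z W : DC (fun y => Dmx F y (Z y) i j) x W = DC (fun y => DC (fun z => F z i j) y (Z y)) x W.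
  by apply: (DC_ext _ oU Ux) => y _; rewrite DmxE.
rewrite (E Y) (DC_Dfield w oU Ys (Fs i j) Ux); congr (_ + _).
rewrite summxE; apply: eq_bigr => k _; rewrite summxE; apply: eq_bigr => l _.
by rewrite mxE DmxE (E (fun=> e_ R l)).
Qed.

Lemma DC_comm R (U : set 'rV[R]_3) f x i j : open U ->
  smoothC U f -> U x ->
  DC (fun y => DC f y (e_ R j)) x (e_ R i) = DC (fun y => DC f y (e_ R i)) x (e_ R j).
Proof.
move=> oU [fr fi] Ux.
by apply/cplxP; [exact: (smooth_derive_comm i j oU fr Ux)|exact: (smooth_derive_comm i j oU fi Ux)].
Qed.

Lemma Dmx_comm R (U : set 'rV[R]_3) F x i j : open U ->
  smooth_mx U F -> U x ->
  Dmx (fun y => Dmx F y (e_ R j)) x (e_ R i) = Dmx (fun y => Dmx F y (e_ R i)) x (e_ R j).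
Proof.
move=> oU Fs Ux; apply/matrixP => k l.
have E a b : Dmx (fun y => Dmx F y (e_ R b)) x (e_ R a) k l =
    DC (fun y => DC (fun z => F z k l) y (e_ R b)) x (e_ R a).
  apply: etrans (DmxE _ _ _ _ _) _.
  by apply: (DC_ext _ oU Ux) => y _; exact: DmxE.
exact: (etrans (E i j) (etrans (DC_comm i j oU (Fs k l) Ux) (esym (E j i)))).
Qed.

Lemma smooth_mx_e R (U : set 'rV[R]_3) F i : open U ->
  smooth_mx U F -> smooth_mx U (fun y => Dmx F y (e_ R i)).
Proof. by move=> oU Fs; apply: (smooth_mx_Dfield (X := fun=> e_ R i)) => // j; exact: smooth_cst. Qed.

Lemma kmetricC R (c : R) A B : kmetric c A B = kmetric c B A.
Proof. by rewrite /kmetric mxtrace_mulC. Qed.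

Lemma kmetricDl R (c : R) A A' B : kmetric c (A + A') B = kmetric c A B + kmetric c A' B.
Proof. by rewrite /kmetric mulmxDl mxtraceD cReD mulrDr. Qed.

Lemma kmetricZl R (c : R) (a : R) A B : kmetric c (a%:C *: A) B = a * kmetric c A B.
Proof. by rewrite /kmetric -scalemxAl mxtraceZ cReM cReC cImC mul0r subr0 mulrCA. Qed.

Lemma kmetric0l R (c : R) B : kmetric c 0 B = 0.
Proof. by rewrite /kmetric mul0mx mxtrace0 mulr0. Qed.

Lemma kmetricNl R (c : R) A B : kmetric c (- A) B = - kmetric c A B.
Proof. by rewrite /kmetric mulNmx raddfN cReN mulrN. Qed.

Lemma kmetricZr R (c : R) (a : R) A B : kmetric c A (a%:C *: B) = a * kmetric c A B.
Proof. by rewrite kmetricC kmetricZl kmetricC. Qed.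

Lemma kmetric_suml R (c : R) (I : Type) (r : seq I) F B :
  kmetric c (\sum_(i <- r) F i) B = \sum_(i <- r) kmetric c (F i) B.
Proof.
elim: r => [|i r IH]; first by rewrite !big_nil kmetric0l.
by rewrite !big_cons kmetricDl IH.
Qed.

Lemma kmetric_sumr R (c : R) (I : Type) (r : seq I) F B :
  kmetric c B (\sum_(i <- r) F i) = \sum_(i <- r) kmetric c B (F i).
Proof. by rewrite kmetricC kmetric_suml; apply: eq_bigr => i _; rewrite kmetricC. Qed.

Lemma derive_kmetric R (c : R) (U : set 'rV[R]_3) F G x v : open U ->
  smooth_mx U F -> smooth_mx U G -> U x ->
  'D_v (fun y => kmetric c (F y) (G y)) x =
  kmetric c (Dmx F x v) (G x) + kmetric c (F x) (Dmx G x v).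
Proof.
move=> oU Fs Gs Ux.
have FG := smooth_mx_mul oU Fs Gs.
have [trr tri] : smoothC U (fun y => \tr (F y *m G y)).
  by apply: smoothC_sum => // i; exact: FG.
rewrite (derive_mulf v oU (smooth_cst _ oU) trr Ux) derive_cst mul0r add0r.
rewrite /kmetric -mulrDr -cReD -mxtraceD -(Dmx_mul _ oU Fs Gs Ux) -ReDC.
congr (_ * Re _).
have D i : smoothC U (fun y => (F y *m G y) i i) by exact: FG.
rewrite /mxtrace (DC_sum _ _ oU D Ux).
by apply: eq_bigr => i _; rewrite DmxE.
Qed.

Section Gram.
Context (R : realType) (c : R) (U : set 'rV[R]_3) (oU : open U).
Context (f : 'rV[R]_3 -> 'M[R[i]]_3) (fs : smooth_mx U f).

Let F i y := Dmx f y (e_ R i).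
Let Fs i : smooth_mx U (F i). Proof. exact: smooth_mx_e. Qed.

Lemma gram_sym x i j : gram c f x i j = gram c f x j i.
Proof. by rewrite !mxE kmetricC. Qed.

Lemma christoffelE x k i j : U x -> christoffel c f x k i j =
  \sum_l invmx (gram c f x) k l * kmetric c (Dmx (F j) x (e_ R i)) (F l x).
Proof.
move=> Ux; rewrite /christoffel mulr_sumr; apply: eq_bigr => l _.
have [G [DG SG ->]] : exists G : 'I_3 -> 'I_3 -> 'I_3 -> R,
    [/\ forall a b d, 'D_(e_ R a) (fun y => gram c f y b d) x = G a b d + G a d b,
        forall a b d, G a b d = G b a d &
        kmetric c (Dmx (F j) x (e_ R i)) (F l x) = G i j l].
  exists (fun a b d => kmetric c (Dmx (F b) x (e_ R a)) (F d x)); split; [move=> a b d|move=> a b d|by []].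
    rewrite [X in _ = _ + X]kmetricC.
    apply: etrans (derive_kmetric c (e_ R a) oU (Fs b) (Fs d) Ux).
    by apply: (derive_ext _ oU Ux) => y _; rewrite mxE.
  by rewrite -[LHS]/(kmetric c (Dmx (F b) x (e_ R a)) (F d x)) (Dmx_comm a b oU fs Ux).
rewrite !DG mulrCA; congr (_ * _).
by rewrite (SG l j) (SG l i) (SG i j); field.
Qed.

(** Koszul's formula in coordinates: the Levi-Civita derivative is the tangential
   part of the derivative of [Dmx f], because [kmetric] is a constant bilinear
   form on matrices and second derivatives of [f] are symmetric. *)
Lemma nabla_gram X Y x m : U x -> smooth_rv U Y -> gram c f x \in unitmx ->
  kmetric c (Dmx f x (nabla c f X Y x)) (F m x) =
  kmetric c (Dmx (fun y => Dmx f y (Y y)) x (X x)) (F m x).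
Proof.
move=> Ux Ys Gu.
have H1 w : kmetric c (Dmx f x w) (F m x) = \sum_i w 0 i * gram c f x i m.
  rewrite (Dmx_lin w oU fs Ux) kmetric_suml; apply: eq_bigr => i _.
  by rewrite kmetricZl [gram _ _ _ _ _]mxE.
have H2 i : nabla c f X Y x 0 i * gram c f x i m = 'D_(X x) Y x 0 i * gram c f x i m +
   (\sum_(a < 3) \sum_(b < 3) christoffel c f x i a b * X x 0 a * Y x 0 b) * gram c f x i m.
  by rewrite -mulrDl [nabla _ _ _ _ _ _ _]mxE; congr ((_ + _) * _); rewrite mxE.
rewrite (Dmx_Dfield (X x) oU Ys fs Ux) kmetricDl !H1.
apply: etrans (eq_bigr _ (fun i _ => H2 i)) _.
rewrite big_split; congr (_ + _) => /=.
under eq_bigr do rewrite mulr_suml.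
rewrite exchange_big kmetric_suml; apply: eq_bigr => a _ /=.
under eq_bigr do rewrite mulr_suml.
rewrite exchange_big kmetric_suml; apply: eq_bigr => b _ /=.
rewrite kmetricZl.
transitivity (X x 0 a * Y x 0 b * \sum_i (gram c f x m i * \sum_l invmx (gram c f x) i l * kmetric c (Dmx (F b) x (e_ R a)) (F l x))).
  rewrite mulr_sumr; apply: eq_bigr => i _.
  rewrite christoffelE// (gram_sym x i m).
  by move: (\sum_l _) (gram c f x m i) => s g; ring.
congr (_ * _).
under eq_bigr do rewrite mulr_sumr.
rewrite exchange_big /=.
under eq_bigr => l _.
  under eq_bigr do rewrite mulrA.
  rewrite -mulr_suml.
  have -> : \sum_i gram c f x m i * invmx (gram c f x) i l = (m == l)%:R.
    have /matrixP /(_ m l) := mulmxV Gu.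
    by rewrite mxE => ->; rewrite mxE.
  over.
rewrite (bigD1 m) //= eqxx mul1r big1 ?addr0 // => l lm.
by rewrite eq_sym (negbTE lm) mul0r.
Qed.

End Gram.

(** * Adapted frames *)

(** [Re (Om 1 0) = 0] says that the derivative of [f] has no component along
   [e1]: the unit normal is then the tangent vector with components [(1, 0)]. *)
Definition adapted R (c : R) (V : set 'rV[R]_3) (f Phi : 'rV[R]_3 -> 'M[R[i]]_3) :=
  [/\ smooth_mx V Phi, forall x, V x -> unit_frame c (Phi x),
      forall x, V x -> f x = Phi x *m e00 R *m frinv c (Phi x) &
      forall x v, V x -> Re (Om c Phi x v 1 0) = 0].

(** In an adapted frame the connection form consists of the dual frame
   [(- Im p, Re q, Im q)], where [p] and [q] are the components of [df], and of
   the shape operator [S] together with one connection coefficient: the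
   component of [S v] in the distribution is [- rf v] (as a complex number), its
   component along the structure field is [af v], and [kf] is the rotation of
   the frame of the distribution. *)
Definition qf R (c : R) (Phi : 'rV[R]_3 -> 'M[R[i]]_3) x v := Om c Phi x v ord_max 0.
Definition rf R (c : R) (Phi : 'rV[R]_3 -> 'M[R[i]]_3) x v := Om c Phi x v ord_max 1.
Definition af R (c : R) (Phi : 'rV[R]_3 -> 'M[R[i]]_3) x v :=
  Im (Om c Phi x v 1 1) - Im (Om c Phi x v 0 0).
Definition kf R (c : R) (Phi : 'rV[R]_3 -> 'M[R[i]]_3) x v :=
  Im (Om c Phi x v ord_max ord_max) - Im (Om c Phi x v 0 0).

Definition coframe R (c : R) (Phi : 'rV[R]_3 -> 'M[R[i]]_3) (x v : 'rV[R]_3) : 'rV[R]_3 :=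
  \row_a match nat_of_ord a with
    | 0%N => - Im (Om c Phi x v 1 0)
    | 1%N => Re (qf c Phi x v)
    | _ => Im (qf c Phi x v) end.

Definition cobase R (c : R) (Phi : 'rV[R]_3 -> 'M[R[i]]_3) (x : 'rV[R]_3) : 'M[R]_3 :=
  \matrix_i coframe c Phi x (e_ R i).

(** The frame of vector fields dual to [coframe]: the structure field [fr 0],
   then the vectors [U = fr 1] and [V = J U = fr ord_max] of the distribution. *)
Fact fr_key : unit. Proof. exact: tt. Qed.
Definition fr R (c : R) (Phi : 'rV[R]_3 -> 'M[R[i]]_3) (a : 'I_3) (x : 'rV[R]_3) : 'rV[R]_3 :=
  locked_with fr_key (row a (invmx (cobase c Phi x))).

Lemma frE R (c : R) (Phi : 'rV[R]_3 -> 'M[R[i]]_3) a x :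
  fr c Phi a x = row a (invmx (cobase c Phi x)).
Proof. by rewrite /fr unlock. Qed.

Lemma cobaseE R (c : R) Phi x i a :
  cobase c Phi x i a = coframe c Phi x (e_ R i) 0 a.
Proof. by rewrite [LHS]mxE. Qed.

Lemma coframe0E R (c : R) Phi x v :
  coframe c Phi x v 0 0 = - Im (Om c Phi x v 1 0).
Proof. by rewrite [LHS]mxE. Qed.

Lemma coframe1E R (c : R) Phi x v :
  coframe c Phi x v 0 1 = Re (qf c Phi x v).
Proof. by rewrite [LHS]mxE. Qed.

Lemma coframe2E R (c : R) Phi x v :
  coframe c Phi x v 0 ord_max = Im (qf c Phi x v).
Proof. by rewrite [LHS]mxE. Qed.

Lemma smooth_Re R (U : set 'rV[R]_3) (f : 'rV[R]_3 -> R[i]) :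
  smoothC U f -> smooth U (fun x => Re (f x)).
Proof. by case. Qed.

Lemma smooth_Im R (U : set 'rV[R]_3) (f : 'rV[R]_3 -> R[i]) :
  smoothC U f -> smooth U (fun x => Im (f x)).
Proof. by case. Qed.

Lemma Om_lin R (c : R) (V : set 'rV[R]_3) Phi x v i j : open V -> smooth_mx V Phi -> V x ->
  Om c Phi x v i j = \sum_k (v 0 k)%:C * Om c Phi x (e_ R k) i j.
Proof.
move=> oV Ps Vx.
rewrite OmE (Dmx_lin v oV Ps Vx) mulmx_sumr summxE; apply: eq_bigr => k _.
by rewrite -scalemxAr mxE OmE.
Qed.

Section UnitFrame.
Context (R : realType) (c : R) (c0 : c != 0) (V : set 'rV[R]_3) (oV : open V).
Context (f Phi : 'rV[R]_3 -> 'M[R[i]]_3) (Ps : smooth_mx V Phi).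
Context (uP : forall x, V x -> unit_frame c (Phi x)).
Context (fE : forall x, V x -> f x = Phi x *m e00 R *m frinv c (Phi x)).

Local Notation O := (Om c Phi).

Lemma Om01E x v : V x -> O x v 0 1 = - ((c / 4)%:C * conjc (O x v 1 0)).
Proof.
move=> Vx; have := Om_skewE c0 oV Ps uP v 0 1 Vx; rewrite /= mulr1.
move: (O x v 0 1) (O x v 1 0) => [a b] [a' b'] [] E1 E2.
have h1 : 4 / c * a = - a' by lra.
have h2 : 4 / c * b = b' by lra.
apply/cplxP; rewrite /=; [rewrite -[a'](opprK) -h1|rewrite -h2]; by field.
Qed.

Lemma Om02E x v : V x -> O x v 0 ord_max = - ((c / 4)%:C * conjc (O x v ord_max 0)).
Proof.
move=> Vx; have := Om_skewE c0 oV Ps uP v 0 ord_max Vx; rewrite /= mulr1.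
move: (O x v 0 ord_max) (O x v ord_max 0) => [a b] [a' b'] [] E1 E2.
have h1 : 4 / c * a = - a' by lra.
have h2 : 4 / c * b = b' by lra.
apply/cplxP; rewrite /=; [rewrite -[a'](opprK) -h1|rewrite -h2]; by field.
Qed.

Lemma Df_frame x v : V x ->
  Dmx f x v = Phi x *m tmx c (O x v 1 0) (qf c Phi x v) *m frinv c (Phi x).
Proof.
move=> Vx; rewrite (Dmx_ext v oV Vx fE) (Dmx_conj c0 oV Ps uP _ _ Vx).
congr (_ *m _ *m _).
apply/matrixP; apply: ord3P; apply: ord3P; rewrite mxE [X in _ + X]mxE mul_e00 e00_mul [RHS]mxE /=
  ?mulr1n ?mulr0n ?subrr ?subr0 ?sub0r ?oppr0 //.
  by rewrite Om01E// opprK.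
by rewrite Om02E// opprK.
Qed.

End UnitFrame.

Section Adapted.
Context (R : realType) (c : R) (c0 : c != 0) (V : set 'rV[R]_3) (oV : open V).
Context (f Phi : 'rV[R]_3 -> 'M[R[i]]_3) (ad : adapted c V f Phi).
Context (imm : forall x v, V x -> Dmx f x v = 0 -> v = 0).

Let Ps : smooth_mx V Phi. Proof. by case: ad. Qed.
Let uP x : V x -> unit_frame c (Phi x). Proof. by case: ad => _ + _ _; exact. Qed.
Let fE x : V x -> f x = Phi x *m e00 R *m frinv c (Phi x). Proof. by case: ad => _ _ + _; exact. Qed.
Let Re10 x v : V x -> Re (Om c Phi x v 1 0) = 0. Proof. by case: ad => _ _ _; exact. Qed.

Local Notation O := (Om c Phi).

Lemma O01E x v : V x -> O x v 0 1 = - ((c / 4)%:C * conjc (O x v 1 0)).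
Proof. exact: (Om01E c0 oV Ps uP). Qed.

Lemma O02E x v : V x -> O x v 0 ord_max = - ((c / 4)%:C * conjc (O x v ord_max 0)).
Proof. exact: (Om02E c0 oV Ps uP). Qed.

Lemma O12E x v : V x -> O x v 1 ord_max = - conjc (O x v ord_max 1).
Proof.
move=> Vx; have := Om_skewE c0 oV Ps uP v 1 ord_max Vx; rewrite /= mulr1 mul1r.
by move/eqP; rewrite addrC addr_eq0 => /eqP.
Qed.

Lemma OdiagE x v i : V x -> Re (O x v i i) = 0.
Proof.
move=> Vx; have := Om_skewE c0 oV Ps uP v i i Vx.
move: (O x v i i) => [a b]; case: (i == 0) => [] [] /= E _.
  have h : 4 / c * a = 0 by lra.
  by have -> : a = c / 4 * (4 / c * a) by [field]; rewrite h mulr0.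
by lra.
Qed.

Lemma O10E x v : V x -> O x v 1 0 = - 'i * (coframe c Phi x v 0 0)%:C.
Proof.
by move=> Vx; apply/cplxP; rewrite coframe0E /= ?Re10//; ring.
Qed.

Lemma qfE x v : qf c Phi x v = coframe c Phi x v 0 1 +i* coframe c Phi x v 0 ord_max.
Proof. by rewrite coframe1E coframe2E; case: (qf _ _ _ _). Qed.

Lemma Df_tmx x v : V x ->
  Dmx f x v = Phi x *m tmx c (O x v 1 0) (qf c Phi x v) *m frinv c (Phi x).
Proof. exact: (Df_frame c0 oV Ps uP fE). Qed.

Lemma coframe_lin x v : V x -> coframe c Phi x v = v *m cobase c Phi x.
Proof.
move=> Vx; apply/rowP => a.
have OE i j := Om_lin c v i j oV Ps Vx.
rewrite [RHS]mxE; move: a; apply: ord3P.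
- rewrite coframe0E OE Im_sum -sumrN; apply: eq_bigr => k _.
  by rewrite Im_realM cobaseE coframe0E mulrN.
- rewrite coframe1E /qf OE Re_sum; apply: eq_bigr => k _.
  by rewrite Re_realM cobaseE coframe1E.
- rewrite coframe2E /qf OE Im_sum; apply: eq_bigr => k _.
  by rewrite Im_realM cobaseE coframe2E.
Qed.

(** Vectors are determined by their components since [f] is an immersion. *)
Lemma coframe0_inj x v : V x -> coframe c Phi x v = 0 -> v = 0.
Proof.
move=> Vx E; apply: (imm Vx).
rewrite Df_tmx// O10E// qfE E ![(0 : 'rV__) _ _]mxE.
have -> : tmx c (- 'i * (0 : R)%:C) (0 +i* 0) = 0.
  apply/matrixP; apply: ord3P; apply: ord3P; rewrite !mxE //=; apply/cplxP; rewrite /=; ring.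
by rewrite mulmx0 mul0mx.
Qed.

Lemma cobase_unit x : V x -> cobase c Phi x \in unitmx.
Proof.
move=> Vx; rewrite -row_free_unit -kermx_eq0; apply/rowV0P => v /sub_kermxP vB.
by apply: (coframe0_inj Vx); rewrite coframe_lin.
Qed.

Lemma coframe_fr x a : V x -> coframe c Phi x (fr c Phi a x) = e_ R a.
Proof.
move=> Vx; rewrite coframe_lin// frE -row_mul mulVmx ?cobase_unit//.
by rewrite row1.
Qed.

Lemma fr_expand x v : V x -> v = \sum_a coframe c Phi x v 0 a *: fr c Phi a x.
Proof.
move=> Vx; rewrite -{1}[v]mulmx1 -(mulmxV (cobase_unit Vx)) mulmxA -coframe_lin//.
by rewrite [LHS]mulmx_sum_row; apply: eq_bigr => a _; rewrite frE.
Qed.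

Lemma coframe_inj x v w : V x -> coframe c Phi x v = coframe c Phi x w -> v = w.
Proof. by move=> Vx E; rewrite (fr_expand v Vx) (fr_expand w Vx) E. Qed.

Lemma smooth_coframe X a : smooth_rv V X -> smooth V (fun y => coframe c Phi y (X y) 0 a).
Proof.
move=> Xs; have Os := Om_smooth c oV Ps Xs.
have s0 := smooth_opp oV (smooth_Im (Os 1 0)).
have s1 := smooth_Re (Os ord_max 0). have s2 := smooth_Im (Os ord_max 0).
move: a; apply: ord3P; [apply: smooth_ext s0|apply: smooth_ext s1|apply: smooth_ext s2] => // x _;
  by rewrite ?coframe0E ?coframe1E ?coframe2E.
Qed.

Lemma smooth_e i : smooth_rv V (fun=> e_ R i).
Proof. by move=> j; exact: smooth_cst. Qed.

Lemma smooth_fr a : smooth_rv V (fr c Phi a).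
Proof.
move=> j.
have B i k : smooth V (fun x => cobase c Phi x i k).
  by apply: smooth_ext (smooth_coframe k (smooth_e i)) => // x _; rewrite cobaseE.
have S := smooth_invmx a j oV B cobase_unit.
by apply: smooth_ext S => // x _; rewrite frE [RHS]mxE.
Qed.

Lemma fr_smooth X : (forall a, smooth V (fun y => coframe c Phi y (X y) 0 a)) -> smooth_rv V X.
Proof.
move=> Xs j.
have S : smooth V (fun x => \sum_a coframe c Phi x (X x) 0 a * fr c Phi a x 0 j).
  by apply: smooth_sum => // a _; exact: (smooth_mul oV (Xs a) (smooth_fr a j)).
apply: smooth_ext S => // x Vx; rewrite [in RHS](fr_expand (X x) Vx) summxE.
by apply: eq_bigr => a _; rewrite [RHS]mxE.
Qed.

Lemma kmetric_Df x v w : V x -> kmetric c (Dmx f x v) (Dmx f x w) =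
  \sum_a coframe c Phi x v 0 a * coframe c Phi x w 0 a.
Proof.
move=> Vx; rewrite !Df_tmx// kmetric_tmx//; last exact: uP.
rewrite !O10E// !qfE sum3.
move: (coframe c Phi x v) (coframe c Phi x w) => s t.
move: (s 0 0) (s 0 1) (s 0 ord_max) (t 0 0) (t 0 1) (t 0 ord_max) => a b d a' b' d'.
by rewrite /=; ring.
Qed.

Lemma gram_unit x : V x -> gram c f x \in unitmx.
Proof.
move=> Vx; suff -> : gram c f x = cobase c Phi x *m (cobase c Phi x)^T.
  by rewrite unitmx_mul unitmx_tr cobase_unit.
apply/matrixP => i j; rewrite [LHS]mxE kmetric_Df// [RHS]mxE; apply: eq_bigr => a _.
by rewrite [X in _ = _ * X]mxE !cobaseE.
Qed.

Lemma smooth_fmx : smooth_mx V f.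
Proof.
have S := smooth_mx_mul oV (smooth_mx_mul oV Ps (smooth_mx_cst (e00 R) oV)) (smooth_frinv c oV Ps).
by apply: smooth_mx_ext S => // x Vx; rewrite fE.
Qed.

End Adapted.

(** * Covariant derivatives in an adapted frame *)

Lemma mul_tmx R (c : R) (o : 'M[R[i]]_3) p q :
  [/\ (o *m tmx c p q) 1 0 = o 1 1 * p + o 1 ord_max * q,
      (o *m tmx c p q) ord_max 0 = o ord_max 1 * p + o ord_max ord_max * q,
      (o *m tmx c p q) 0 1 = o 0 0 * ((c / 4)%:C * conjc p) &
      (o *m tmx c p q) 0 ord_max = o 0 0 * ((c / 4)%:C * conjc q)].
Proof. by split; rewrite mulmx3 !mxE /= ?mulr0 ?add0r ?addr0. Qed.

Lemma tmx_mul R (c : R) (o : 'M[R[i]]_3) p q :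
  [/\ (tmx c p q *m o) 1 0 = p * o 0 0,
      (tmx c p q *m o) ord_max 0 = q * o 0 0,
      (tmx c p q *m o) 0 1 = (c / 4)%:C * conjc p * o 1 1 + (c / 4)%:C * conjc q * o ord_max 1 &
      (tmx c p q *m o) 0 ord_max = (c / 4)%:C * conjc p * o 1 ord_max + (c / 4)%:C * conjc q * o ord_max ord_max].
Proof. by split; rewrite mulmx3 !mxE /= ?mul0r ?add0r ?addr0. Qed.

Lemma e_E R (a b : 'I_3) : e_ R a 0 b = (b == a)%:R.
Proof. by rewrite /e_ mxE eqxx. Qed.

Section Nabla.
Context (R : realType) (c : R) (c0 : c != 0) (V : set 'rV[R]_3) (oV : open V).
Context (f Phi : 'rV[R]_3 -> 'M[R[i]]_3) (ad : adapted c V f Phi).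
Context (imm : forall x v, V x -> Dmx f x v = 0 -> v = 0).

Let Ps : smooth_mx V Phi. Proof. by case: ad. Qed.
Let uP x : V x -> unit_frame c (Phi x). Proof. by case: ad => _ + _ _; exact. Qed.
Let fE x : V x -> f x = Phi x *m e00 R *m frinv c (Phi x). Proof. by case: ad => _ _ + _; exact. Qed.
Let Re10 x v : V x -> Re (Om c Phi x v 1 0) = 0. Proof. by case: ad => _ _ _; exact. Qed.
Let fs : smooth_mx V f. Proof. exact: smooth_fmx ad. Qed.

Local Notation O := (Om c Phi).

Lemma nabla_Df X Y x v : V x -> smooth_rv V Y ->
  kmetric c (Dmx f x (nabla c f X Y x)) (Dmx f x v) =
  kmetric c (Dmx (fun y => Dmx f y (Y y)) x (X x)) (Dmx f x v).
Proof.
move=> Vx Ys; rewrite (Dmx_lin v oV fs Vx) !kmetric_sumr; apply: eq_bigr => i _.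
by rewrite !kmetricZr (nabla_gram oV fs X i Vx Ys (gram_unit c0 oV ad imm Vx)).
Qed.

Lemma smooth_O X i j : smooth_rv V X -> smoothC V (fun y => O y (X y) i j).
Proof. by move=> Xs; exact: (Om_smooth c oV Ps Xs). Qed.

Lemma smooth_tmx p q : smoothC V p -> smoothC V q -> smooth_mx V (fun y => tmx c (p y) (q y)).
Proof.
move=> ps qs.
have z0 := smoothC_cst (0 : R[i]) oV.
have kc g : smoothC V g -> smoothC V (fun y => (c / 4)%:C * conjc (g y)).
  by move=> gs; apply: smoothC_mul => //; [exact: smoothC_cst|exact: smoothC_conj].
have pc := kc _ ps; have qc := kc _ qs.
apply: ord3P; apply: ord3P.
- by apply: smoothC_ext z0 => // x _; rewrite mxE.
- by apply: smoothC_ext pc => // x _; rewrite mxE.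
- by apply: smoothC_ext qc => // x _; rewrite mxE.
- by apply: smoothC_ext ps => // x _; rewrite mxE.
- by apply: smoothC_ext z0 => // x _; rewrite mxE.
- by apply: smoothC_ext z0 => // x _; rewrite mxE.
- by apply: smoothC_ext qs => // x _; rewrite mxE.
- by apply: smoothC_ext z0 => // x _; rewrite mxE.
- by apply: smoothC_ext z0 => // x _; rewrite mxE.
Qed.

Lemma DC_scal_conj g (k : R) x w : V x -> smoothC V g ->
  DC (fun y => k%:C * conjc (g y)) x w = k%:C * conjc (DC g x w).
Proof.
move=> Vx gs.
rewrite (DC_mul w oV (smoothC_cst k%:C oV) (smoothC_conj oV gs) Vx) DC_cst mul0r add0r.
by rewrite (DC_conj w oV gs Vx).
Qed.

Lemma Dtmx10 p q x w : V x -> smoothC V p -> smoothC V q ->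
  [/\ Dmx (fun y => tmx c (p y) (q y)) x w 1 0 = DC p x w,
      Dmx (fun y => tmx c (p y) (q y)) x w ord_max 0 = DC q x w,
      Dmx (fun y => tmx c (p y) (q y)) x w 0 1 = (c / 4)%:C * conjc (DC p x w) &
      Dmx (fun y => tmx c (p y) (q y)) x w 0 ord_max = (c / 4)%:C * conjc (DC q x w)].
Proof.
move=> Vx ps qs; split; apply: etrans (DmxE _ _ _ _ _) _.
- by apply: (DC_ext _ oV Vx) => y _; rewrite mxE.
- by apply: (DC_ext _ oV Vx) => y _; rewrite mxE.
- rewrite -(DC_scal_conj _ _ Vx ps).
  by apply: (DC_ext _ oV Vx) => y _; rewrite mxE.
- rewrite -(DC_scal_conj _ _ Vx qs).
  by apply: (DC_ext _ oV Vx) => y _; rewrite mxE.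
Qed.

Lemma kmetric_frame_v (A : 'M[R[i]]_3) x v : V x ->
  A 0 1 = (c / 4)%:C * conjc (A 1 0) -> A 0 ord_max = (c / 4)%:C * conjc (A ord_max 0) ->
  kmetric c (Phi x *m A *m frinv c (Phi x)) (Dmx f x v) =
  Re (A 1 0 * conjc (O x v 1 0) + A ord_max 0 * conjc (qf c Phi x v)).
Proof.
move=> Vx A1 A2; rewrite (Df_tmx c0 oV ad)// kmetric_frame//; last exact: uP.
by rewrite tr_tmx.
Qed.

(** The covariant derivative is the tangential part of the ambient one
   ([nabla_Df]); the latter is computed by differentiating
   [Phi *m tmx p q *m Phi^-1]. *)
Lemma nabla_frame X Y x : V x -> smooth_rv V Y ->
  coframe c Phi x (nabla c f X Y x) 0 0 =
    'D_(X x) (fun y => coframe c Phi y (Y y) 0 0) x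
    + Im (conjc (rf c Phi x (X x)) * qf c Phi x (Y x)) /\
  qf c Phi x (nabla c f X Y x) =
    DC (fun y => qf c Phi y (Y y)) x (X x)
    - 'i * rf c Phi x (X x) * (coframe c Phi x (Y x) 0 0)%:C
    + 'i * (kf c Phi x (X x))%:C * qf c Phi x (Y x).
Proof.
move=> Vx Ys; set n := nabla _ _ _ _ _.
pose p y := O y (Y y) 1 0; pose q y := O y (Y y) ord_max 0.
have ps : smoothC V p by exact: smooth_O.
have qs : smoothC V q by exact: smooth_O.
pose T y := tmx c (p y) (q y).
have Ts : smooth_mx V T by exact: smooth_tmx.
set w := X x; set o := O x w.
pose A := Dmx T x w + (o *m T x - T x *m o).
have DA : Dmx (fun y => Dmx f y (Y y)) x w = Phi x *m A *m frinv c (Phi x).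
  rewrite -(Dmx_conj_fun c0 oV Ps uP w Vx Ts).
  by apply: (Dmx_ext w oV Vx) => y Vy; rewrite (Df_tmx c0 oV ad).
have [T10 T20 T01 T02] := Dtmx10 w Vx ps qs.
have e01 : o 0 1 = - ((c / 4)%:C * conjc (o 1 0)) by exact: (O01E c0 oV ad).
have e02 : o 0 ord_max = - ((c / 4)%:C * conjc (o ord_max 0)) by exact: (O02E c0 oV ad).
have e12 : o 1 ord_max = - conjc (o ord_max 1) by exact: (O12E c0 oV ad).
have d0 : Re (o 0 0) = 0 by exact: (OdiagE c0 oV ad).
have d1 : Re (o 1 1) = 0 by exact: (OdiagE c0 oV ad).
have d2 : Re (o ord_max ord_max) = 0 by exact: (OdiagE c0 oV ad).
have AE i j : A i j = Dmx T x w i j + ((o *m T x) i j - (T x *m o) i j).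
  by rewrite /A mxE; congr (_ + _); rewrite mxE; congr (_ + _); rewrite mxE.
have [L10 L20 L01 L02] := mul_tmx c o (p x) (q x).
have [M10 M20 M01 M02] := tmx_mul c o (p x) (q x).
have A10 : A 1 0 = DC p x w + (o 1 1 * p x - conjc (o ord_max 1) * q x - p x * o 0 0).
  by rewrite AE T10 L10 M10 e12 mulNr.
have A20 : A ord_max 0 = DC q x w + (o ord_max 1 * p x + o ord_max ord_max * q x - q x * o 0 0).
  by rewrite AE T20 L20 M20.
have A01 : A 0 1 = (c / 4)%:C * conjc (DC p x w) + (o 0 0 * ((c / 4)%:C * conjc (p x)) - (c / 4)%:C * conjc (p x) * o 1 1 - (c / 4)%:C * conjc (q x) * o ord_max 1).
  by rewrite AE T01 L01 M01; congr (_ + _); rewrite opprD addrA.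
have A02 : A 0 ord_max = (c / 4)%:C * conjc (DC q x w) + (o 0 0 * ((c / 4)%:C * conjc (q x)) + (c / 4)%:C * conjc (p x) * conjc (o ord_max 1) - (c / 4)%:C * conjc (q x) * o ord_max ord_max).
  by rewrite AE T02 L02 M02 e12; congr (_ + _); rewrite mulrN opprD opprK addrA.
have s1 : A 0 1 = (c / 4)%:C * conjc (A 1 0).
  rewrite A01 A10; move: (DC p x w) (o ord_max 1) (p x) (q x) (o 0 0) (o 1 1) d0 d1.
  move=> [? ?] [? ?] [? ?] [? ?] [? ?] [? ?] /= -> ->.
  by apply/cplxP; rewrite /=; ring.
have s2 : A 0 ord_max = (c / 4)%:C * conjc (A ord_max 0).
  rewrite A02 A20; move: (DC q x w) (o ord_max 1) (p x) (q x) (o 0 0) (o ord_max ord_max) d0 d2.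
  move=> [? ?] [? ?] [? ?] [? ?] [? ?] [? ?] /= -> ->.
  by apply/cplxP; rewrite /=; ring.
have na a : coframe c Phi x n 0 a = Re (A 1 0 * conjc (O x (fr c Phi a x) 1 0) + A ord_max 0 * conjc (qf c Phi x (fr c Phi a x))).
  rewrite -(kmetric_frame_v _ Vx s1 s2) -DA -(nabla_Df X _ Vx Ys) -/n.
  rewrite (kmetric_Df c0 oV ad _ _ Vx) (bigD1 a) //= (coframe_fr c0 oV ad imm _ Vx) e_E eqxx mulr1.
  rewrite big1 ?addr0 // => b ba; by rewrite e_E (negbTE ba) mulr0.
have pE a : O x (fr c Phi a x) 1 0 = - 'i * (e_ R a 0 0)%:C.
  by rewrite (O10E ad _ Vx) (coframe_fr c0 oV ad imm _ Vx).
have qE a : qf c Phi x (fr c Phi a x) = (e_ R a 0 1) +i* (e_ R a 0 ord_max).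
  by rewrite qfE (coframe_fr c0 oV ad imm _ Vx).
have Rdp : Re (DC p x w) = 0.
  rewrite ReDC -[RHS](derive_cst (0 : R) x w); apply: (derive_ext w oV Vx) => y Vy.
  exact: Re10.
have Idp : Im (DC p x w) = - 'D_w (fun y => coframe c Phi y (Y y) 0 0) x.
  rewrite ImDC -(derive_oppf w oV (smooth_coframe oV ad 0 Ys) Vx).
  by apply: (derive_ext w oV Vx) => y Vy; rewrite coframe0E opprK.
have pY : p x = - 'i * (coframe c Phi x (Y x) 0 0)%:C by exact: (O10E ad).
have rE : rf c Phi x w = o ord_max 1 by [].
have qxE : qf c Phi x (Y x) = q x by [].
split.
  rewrite na pE qE !e_E /= A10 pY.
  rewrite rE qxE.
  move: Rdp Idp; move: (DC p x w) => [dp1 dp2] /= -> ->.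
  move: (o 1 1) (o 0 0) d0 d1 => [? b1] [? b0] /= -> ->.
  move: (A ord_max 0) (o ord_max 1) (q x) => [? ?] [? ?] [? ?] /=.
  by ring.
have h1 := na 1; have h2 := na ord_max.
rewrite pE qE !e_E /= in h1.
rewrite pE qE !e_E /= in h2.
have -> : qf c Phi x n = A ord_max 0.
  rewrite qfE h1 h2; move: (A 1 0) (A ord_max 0) => [? ?] [? ?].
  by apply/cplxP; rewrite /=; ring.
have -> : DC (fun y => qf c Phi y (Y y)) x w = DC q x w by [].
have -> : kf c Phi x w = Im (o ord_max ord_max) - Im (o 0 0) by [].
rewrite A20 rE qxE pY.
move: (DC q x w) => dq; rewrite -[RHS]addrA; congr (_ + _).
move: (o ord_max ord_max) (o 0 0) d0 d2 => [a1 b1] [a0 b0] /= E0 E1.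
rewrite E0 E1 {E0 E1}; move: (o ord_max 1) (q x) (coframe c Phi x (Y x) 0 0) => [? ?] [? ?] ?.
by apply/cplxP; rewrite /=; ring.
Qed.

End Nabla.

(** * Structure Jacobi operator in an adapted frame *)

Section Jacobi.
Context (R : realType) (c : R) (c0 : c != 0) (V : set 'rV[R]_3) (oV : open V).
Context (f Phi : 'rV[R]_3 -> 'M[R[i]]_3) (ad : adapted c V f Phi).
Context (imm : forall x v, V x -> Dmx f x v = 0 -> v = 0).

Let Ps : smooth_mx V Phi. Proof. by case: ad. Qed.
Let uP x : V x -> unit_frame c (Phi x). Proof. by case: ad => _ + _ _; exact. Qed.

Local Notation O := (Om c Phi).
Local Notation xi := (fr c Phi 0).

Lemma Om_sub x v w : V x -> O x (v - w) = O x v - O x w.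
Proof.
move=> Vx; rewrite -[- w]scaleN1r addrC (Om_dirD c oV Ps)//.
by rewrite addrC rmorphN scaleN1r.
Qed.

Lemma coframe_sub x v w a : V x ->
  coframe c Phi x (v - w) 0 a = coframe c Phi x v 0 a - coframe c Phi x w 0 a.
Proof. by move=> Vx; rewrite !(coframe_lin oV ad)// mulmxBl mxE [X in _ + X]mxE. Qed.

Lemma qf_sub x v w : V x -> qf c Phi x (v - w) = qf c Phi x v - qf c Phi x w.
Proof. by move=> Vx; rewrite /qf Om_sub// mxE [X in _ + X]mxE. Qed.

Lemma coframe_xi x a : V x -> coframe c Phi x (xi x) 0 a = (a == 0)%:R.
Proof. by move=> Vx; rewrite (coframe_fr c0 oV ad imm)// e_E. Qed.

Lemma qf_xi x : V x -> qf c Phi x (xi x) = 0.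
Proof. by move=> Vx; rewrite qfE !coframe_xi. Qed.

Lemma O10_xi x : V x -> O x (xi x) 1 0 = - 'i.
Proof. by move=> Vx; rewrite (O10E ad)// coframe_xi// mulr1. Qed.

(** The identity [nabla_Z xi = phi S Z]. *)
Lemma nabla_xi Z x : V x ->
  coframe c Phi x (nabla c f Z xi x) 0 0 = 0 /\
  qf c Phi x (nabla c f Z xi x) = - 'i * rf c Phi x (Z x).
Proof.
move=> Vx; have [E1 E2] := nabla_frame c0 oV ad imm Z Vx (smooth_fr c0 oV ad imm 0).
have D0 : 'D_(Z x) (fun y => coframe c Phi y (xi y) 0 0) x = 0.
  rewrite -[RHS](derive_cst (1 : R) x (Z x)); apply: (derive_ext _ oV Vx) => y Vy.
  by rewrite coframe_xi.
have D1 : DC (fun y => qf c Phi y (xi y)) x (Z x) = 0.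
  by rewrite -[RHS](DC_cst 0 x (Z x)); apply: (DC_ext _ oV Vx) => y Vy; rewrite qf_xi.
split; [apply: etrans E1 _; rewrite D0|apply: etrans E2 _; rewrite D1]; rewrite qf_xi// !mulr0 addr0 //.
by rewrite coframe_xi// mulr1 add0r mulNr.
Qed.

Lemma smooth_rf Z : smooth_rv V Z -> smoothC V (fun y => rf c Phi y (Z y)).
Proof. by move=> Zs; exact: (smooth_O oV ad _ _ Zs). Qed.

Lemma smooth_nabla_xi Z : smooth_rv V Z -> smooth_rv V (nabla c f Z xi).
Proof.
move=> Zs; apply: (fr_smooth c0 oV ad imm).
have rs : smoothC V (fun y => - 'i * rf c Phi y (Z y)).
  by apply: smoothC_mul => //; [exact: smoothC_cst|exact: smooth_rf].
apply: ord3P.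
- by apply: smooth_ext (smooth_cst 0 oV) => // y /(nabla_xi Z) [->].
- by apply: smooth_ext (smooth_Re rs) => // y /(nabla_xi Z) [_]; rewrite coframe1E => ->.
- by apply: smooth_ext (smooth_Im rs) => // y /(nabla_xi Z) [_]; rewrite coframe2E => ->.
Qed.

Lemma nabla2_xi X Z x : V x -> smooth_rv V Z ->
  coframe c Phi x (nabla c f X (nabla c f Z xi) x) 0 0 =
    - Re (conjc (rf c Phi x (X x)) * rf c Phi x (Z x)) /\
  qf c Phi x (nabla c f X (nabla c f Z xi) x) =
    - 'i * DC (fun y => rf c Phi y (Z y)) x (X x)
    + (kf c Phi x (X x))%:C * rf c Phi x (Z x).
Proof.
move=> Vx Zs; have := nabla_frame c0 oV ad imm X Vx (smooth_nabla_xi Zs).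
have D0 : 'D_(X x) (fun y => coframe c Phi y (nabla c f Z xi y) 0 0) x = 0.
  rewrite -[RHS](derive_cst (0 : R) x (X x)).
  by apply: (derive_ext _ oV Vx) => y /(nabla_xi Z) [].
have D1 : DC (fun y => qf c Phi y (nabla c f Z xi y)) x (X x) =
    - 'i * DC (fun y => rf c Phi y (Z y)) x (X x).
  rewrite (DC_ext (g := fun y => - 'i * rf c Phi y (Z y)) _ oV Vx); last by move=> y /(nabla_xi Z) [].
  by rewrite (DC_mul _ oV (smoothC_cst _ oV) (smooth_rf Zs) Vx) DC_cst mul0r add0r.
have := nabla_xi Z Vx; rewrite D0 D1; move: (nabla c f Z xi x) (nabla c f X _ x) => m n.
move=> [E1 E2] [F1 F2]; rewrite E1 E2 in F2; rewrite E2 in F1.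
split; [apply: etrans F1 _|apply: etrans F2 _].
  rewrite add0r; move: (rf c Phi x (X x)) (rf c Phi x (Z x)) => [? ?] [? ?] /=; ring.
rewrite mulr0 subr0; congr (_ + _).
move: (rf c Phi x (Z x)) (kf c Phi x (X x)) => [? ?] ?.
by apply/cplxP; rewrite /=; ring.
Qed.

Lemma integr_entry X Y x i j : V x -> smooth_rv V X -> smooth_rv V Y ->
  DC (fun y => O y (Y y) i j) x (X x) - DC (fun y => O y (X y) i j) x (Y x) +
  ((O x (X x) *m O x (Y x)) i j - (O x (Y x) *m O x (X x)) i j) = O x (bracket X Y x) i j.
Proof.
move=> Vx Xs Ys; have /matrixP /(_ i j) <- := integrability c0 oV Ps uP Xs Ys Vx.
rewrite [RHS]mxE; congr (_ + _).
  by rewrite [RHS]mxE DmxE; congr (_ + _); rewrite [RHS]mxE DmxE.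
by rewrite [RHS]mxE; congr (_ + _); rewrite [RHS]mxE.
Qed.

(** The Gauss equation: [l X] equals
   [k X + g(S xi, xi) S X - g(S X, xi) S xi] up to multiples of [xi].
   The derivatives of [rf] cancel against [rf] of the bracket by
   [integrability]. *)
Lemma jacobi_frame X x : V x -> smooth_rv V X ->
  coframe c Phi x (jacobi c f xi X x) 0 0 = 0 /\
  qf c Phi x (jacobi c f xi X x) =
    rf c Phi x (xi x) * (af c Phi x (X x))%:C - (af c Phi x (xi x))%:C * rf c Phi x (X x)
    + (c / 4)%:C * qf c Phi x (X x).
Proof.
move=> Vx Xs; have xs := smooth_fr c0 oV ad imm 0.
rewrite /jacobi /curvature.
have := nabla_xi (bracket X xi) Vx; have := nabla2_xi xi Vx Xs; have := nabla2_xi X Vx xs.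
move: (nabla c f X _ x) (nabla c f xi _ x) (nabla c f _ xi x) => n m o [E1 E2] [E3 E4] [E5 E6].
have F1 := etrans (coframe_sub (n - m) o 0 Vx)
  (congr2 (fun a b => a - b) (etrans (coframe_sub n m 0 Vx) (congr2 (fun a b => a - b) E1 E3)) E5).
have F2 := etrans (qf_sub (n - m) o Vx)
  (congr2 (fun a b => a - b) (etrans (qf_sub n m Vx) (congr2 (fun a b => a - b) E2 E4)) E6).
split; [apply: etrans F1 _|apply: etrans F2 _].
  by move: (rf c Phi x (X x)) (rf c Phi x (xi x)) => [? ?] [? ?] /=; ring.
have H := integr_entry ord_max 1 Vx Xs xs.
have q01 := O01E c0 oV ad (xi x) Vx; have q10 := O10_xi Vx; have q20 := qf_xi Vx.
rewrite q10 in q01.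
have d1 := OdiagE c0 oV ad (X x) ord_max Vx.
have d2 := OdiagE c0 oV ad (X x) 1 Vx.
have d3 := OdiagE c0 oV ad (xi x) ord_max Vx.
have d4 := OdiagE c0 oV ad (xi x) 1 Vx.
rewrite /rf /af /kf /qf in q20 *.
move: (DC (fun y => O y (xi y) ord_max 1) x (X x)) (DC (fun y => O y (X y) ord_max 1) x (xi x))
  (O x (bracket X xi x)) (O x (X x)) (O x (xi x)) H q01 q10 q20 d1 d2 d3 d4.
move=> D1 D2 B P Q <- q01 q10 q20.
rewrite !mulmx3 q01 q20.
move: (P ord_max ord_max) (P 1 1) (Q ord_max ord_max) (Q 1 1) (P 0 0) (Q 0 0)
  (P ord_max 0) (P ord_max 1) (Q ord_max 1) (P 0 1) D1 D2.
move=> [? ?] [? ?] [? ?] [? ?] [? ?] [? ?] [? ?] [? ?] [? ?] [? ?] [? ?] [? ?] /= -> -> -> ->.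
by apply/cplxP; rewrite /=; ring.
Qed.

End Jacobi.

(** * The overdetermined scalar system *)

(** Compatibility of the relation [a g = b^2 - k] with the derivatives of [a], [b]
   and [g] along [V]. *)
Lemma solve_k0 R (k a b g m k0 k1 a' b' g' : R) :
  k != 0 -> a != 0 -> b != 0 -> a * m = - k -> a * g = b ^+ 2 - k ->
  a' = b * (a + k0 - 3 * m) -> b' = b ^+ 2 + k1 * b - 2 * m * g ->
  g' = k1 * (g - m) + b * (g + 2 * m) ->
  k0 * (g - m) - b * k1 + g * m = 0 ->
  a' * g + a * g' = 2 * b * b' -> k0 = - 4 * a.
Proof.
move=> k_0 a0 b0 am ag -> -> -> f E.
have mE : m = - k / a by rewrite -am mulrC mulKf.
have gE : g = (b ^+ 2 - k) / a by rewrite -ag mulrC mulKf.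
have k1E : k1 = (k0 * (g - m) + g * m) / b.
  by rewrite (_ : _ + _ = b * k1) ?(mulrC b) ?mulfK//; lra.
have : b * (k0 * m - 4 * k) = 0.
  transitivity (b * (a + k0 - 3 * m) * g + a * (k1 * (g - m) + b * (g + 2 * m))
    - 2 * b * (b ^+ 2 + k1 * b - 2 * m * g)); last by rewrite E subrr.
  by rewrite k1E mE gE; field; rewrite ?a0 ?b0.
move/eqP; rewrite mulf_eq0 (negbTE b0) /= mE => /eqP h.
have : k * (k0 + 4 * a) = 0.
  have -> : k * (k0 + 4 * a) = - a * (k0 * (- k / a) - 4 * k) by field.
  by rewrite h mulr0.
by move/eqP; rewrite mulf_eq0 (negbTE k_0) /= => /eqP h'; lra.
Qed.

Lemma solve_xi_derivatives R (k a b g m q a0 b0 m0 a1 m1 : R) :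
  k != 0 -> a != 0 -> b != 0 -> a * m = - k -> a * g = b ^+ 2 - k ->
  m0 = b * q -> a0 * m + a * m0 = 0 ->
  m1 = q * (g - m) -> a1 * m + a * m1 = 0 -> b0 = a1 ->
  a0 = a ^+ 2 * b * q / k /\ b0 = a * q * b ^+ 2 / k.
Proof.
move=> k_0 an0 bn0 am ag -> E0 -> E1 ->.
have mE : m = - k / a by rewrite -am mulrC mulKf.
have gE : g = (b ^+ 2 - k) / a by rewrite -ag mulrC mulKf.
have m_0 : m != 0 by rewrite mE mulf_neq0 ?oppr_eq0 ?invr_eq0.
split; apply: (mulIf m_0).
  have -> : a0 * m = - (a * (b * q)) by lra.
  by rewrite mE; field; rewrite ?k_0 ?an0.
have -> : a1 * m = - (a * (q * (g - m))) by lra.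
by rewrite mE gE; field; rewrite ?k_0 ?an0.
Qed.

(** The Gauss equation for [(xi, U)] once [k0], [k1] and the derivatives along
   [xi] are eliminated. *)
Lemma reduce_gauss_xiU R (k a b g m k0 k1 q a0 b0 g0 m0 k10 k01 : R) :
  k != 0 -> a != 0 -> b != 0 -> a * m = - k -> a * g = b ^+ 2 - k ->
  k0 = - 4 * a -> b * k1 = - 4 * b ^+ 2 + g * m -> m0 = b * q ->
  a0 = a ^+ 2 * b * q / k -> b0 = a * q * b ^+ 2 / k ->
  a0 * g + a * g0 = 2 * b * b0 ->
  b0 * k1 + b * k10 = - 8 * b * b0 + (g0 * m + g * m0) ->
  k01 = - 4 * b0 ->
  k10 - k01 - (k0 - g) * q = 0 -> q * (b ^+ 2 + 2 * a ^+ 2 - 2 * k) = 0.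
Proof.
move=> k_0 an0 bn0 am ag -> k1E -> -> -> G K -> G1.
have mE : m = - k / a by rewrite -am mulrC mulKf.
have gE : g = (b ^+ 2 - k) / a by rewrite -ag mulrC mulKf.
have g0E : g0 = (2 * b * (a * q * b ^+ 2 / k) - a ^+ 2 * b * q / k * g) / a.
  by rewrite -G addrC addKr (mulrC a) mulfK.
have k1E' : k1 = (- 4 * b ^+ 2 + g * m) / b by rewrite -k1E (mulrC b) mulfK.
have k10E : k10 = (- 8 * b * (a * q * b ^+ 2 / k) + (g0 * m + g * (b * q)) - a * q * b ^+ 2 / k * k1) / b.
  by rewrite -K addrC addKr (mulrC b) mulfK.
have : 2 * (q * (b ^+ 2 + 2 * a ^+ 2 - 2 * k)) / a = 0.
  rewrite -[RHS]G1 k10E k1E' g0E gE mE; field; by rewrite ?k_0 ?an0 ?bn0.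
move/eqP; rewrite !mulf_eq0 invr_eq0 (negbTE an0) orbF pnatr_eq0 /=.
by rewrite -mulf_eq0 => /eqP.
Qed.

(** The Gauss equation for [(xi, V)] once [k2 = 0] and the other unknowns are
   eliminated. *)
Lemma reduce_gauss_xiV R (k a b g m k0 k1 a2 : R) :
  k != 0 -> a != 0 -> b != 0 -> a * m = - k -> a * g = b ^+ 2 - k ->
  k0 = - 4 * a -> b * k1 = - 4 * b ^+ 2 + g * m -> a2 = b * (a + k0 - 3 * m) ->
  m * b - (- 4 * a2) + b * k0 - (m - k0) * k1 = - b * m ->
  a ^+ 2 * (10 * b ^+ 2 - 4 * k) = k * (b ^+ 2 - k).
Proof.
move=> k_0 an0 bn0 am ag -> k1E -> G2.
have mE : m = - k / a by rewrite -am mulrC mulKf.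
have gE : g = (b ^+ 2 - k) / a by rewrite -ag mulrC mulKf.
have k1E' : k1 = (- 4 * b ^+ 2 + g * m) / b by rewrite -k1E (mulrC b) mulfK.
suff : (k / (b * a ^+ 3)) * (a ^+ 2 * (10 * b ^+ 2 - 4 * k) - k * (b ^+ 2 - k)) = 0.
  move/eqP; rewrite mulf_eq0 => /orP[|].
    by rewrite mulf_eq0 invr_eq0 mulf_eq0 expf_eq0 (negbTE k_0) (negbTE bn0) (negbTE an0).
  by rewrite subr_eq0 => /eqP.
transitivity (m * b - (- 4 * (b * (a + - 4 * a - 3 * m))) + b * (- 4 * a) - (m - - 4 * a) * k1 + b * m); last by rewrite G2; ring.
by rewrite k1E' gE mE; field; rewrite ?k_0 ?an0 ?bn0.
Qed.

(** The relation obtained from the Gauss equation for [(xi, V)] and its derivative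
   along [V] are linear in [a^2]; eliminating it gives
   [9 b^4 - 8 k b^2 + 2 k^2 = 0], which has negative discriminant in [b^2]. *)
Lemma no_real_b R (k a b g m k0 k1 a2 b2 : R) :
  k != 0 -> a != 0 -> b != 0 -> a * m = - k -> a * g = b ^+ 2 - k ->
  k0 = - 4 * a -> b * k1 = - 4 * b ^+ 2 + g * m -> a2 = b * (a + k0 - 3 * m) ->
  b2 = b ^+ 2 + k1 * b - 2 * m * g ->
  a ^+ 2 * (10 * b ^+ 2 - 4 * k) = k * (b ^+ 2 - k) ->
  2 * a * a2 * (10 * b ^+ 2 - 4 * k) + a ^+ 2 * (20 * b * b2) = 2 * k * b * b2 -> False.
Proof.
move=> k_0 an0 bn0 am ag -> k1E -> -> P D.
have gm : a ^+ 2 * (g * m) = - k * (b ^+ 2 - k).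
  have -> : a ^+ 2 * (g * m) = (a * g) * (a * m) by ring.
  by rewrite ag am; ring.
have b2E : b ^+ 2 + k1 * b - 2 * m * g = 7 * b ^+ 2 - 4 * k.
  have a20 : a ^+ 2 != 0 by rewrite expf_neq0.
  apply: (mulfI a20).
  have -> : a ^+ 2 * (b ^+ 2 + k1 * b - 2 * m * g) = a ^+ 2 * (- 3 * b ^+ 2) - a ^+ 2 * (g * m).
    by rewrite (mulrC k1) k1E; ring.
  have -> : a ^+ 2 * (7 * b ^+ 2 - 4 * k) = a ^+ 2 * (- 3 * b ^+ 2) + a ^+ 2 * (10 * b ^+ 2 - 4 * k) by ring.
  by rewrite gm P; ring.
rewrite b2E in D.
have aa2 : a * (b * (a + - 4 * a - 3 * m)) = - 3 * b * (a ^+ 2 - k).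
  have -> : a * (b * (a + - 4 * a - 3 * m)) = b * (- 3 * a ^+ 2 - 3 * (a * m)) by ring.
  by rewrite am; ring.
have D2 : b * (40 * (a ^+ 2 * b ^+ 2) - 28 * k * a ^+ 2 + 23 * k * b ^+ 2 - 8 * k ^+ 2) = 0.
  have : 2 * (- 3 * b * (a ^+ 2 - k)) * (10 * b ^+ 2 - 4 * k) + a ^+ 2 * (20 * b * (7 * b ^+ 2 - 4 * k)) - 2 * k * b * (7 * b ^+ 2 - 4 * k) = 0.
    by rewrite -aa2 mulrA -D; ring.
  by move=> h; apply: (@mulfI _ 2) => //; rewrite mulr0 -[RHS]h; ring.
move/eqP: D2; rewrite mulf_eq0 (negbTE bn0) /= => /eqP D3.
have D4 : k * (30 * (9 * b ^+ 4 - 8 * k * b ^+ 2 + 2 * k ^+ 2)) = 0.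
  have : (40 * (a ^+ 2 * b ^+ 2) - 28 * k * a ^+ 2 + 23 * k * b ^+ 2 - 8 * k ^+ 2) * (10 * b ^+ 2 - 4 * k) = 0 by rewrite D3 mul0r.
  have -> : (40 * (a ^+ 2 * b ^+ 2) - 28 * k * a ^+ 2 + 23 * k * b ^+ 2 - 8 * k ^+ 2) * (10 * b ^+ 2 - 4 * k) =
    (a ^+ 2 * (10 * b ^+ 2 - 4 * k)) * (40 * b ^+ 2 - 28 * k) + (23 * k * b ^+ 2 - 8 * k ^+ 2) * (10 * b ^+ 2 - 4 * k) by ring.
  by rewrite P => h; rewrite -[RHS]h; ring.
move/eqP: D4; rewrite mulf_eq0 (negbTE k_0) /= => /eqP D5.
have k2 : 0 < k ^+ 2 by rewrite exprn_even_gt0.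
have : 0 <= (3 * b ^+ 2 - 4 / 3 * k) ^+ 2 by exact: sqr_ge0.
have -> : (3 * b ^+ 2 - 4 / 3 * k) ^+ 2 = 9 * b ^+ 4 - 8 * k * b ^+ 2 + 16 / 9 * k ^+ 2 by field.
by lra.
Qed.

(** The hypotheses are the Codazzi and Gauss equations of a hypersurface with
   shape operator [S xi = a xi + b U], [S U = b xi + g U], [S V = m V], where
   [k0], [k1], [k2] are the connection coefficients of [(U, V)] along [xi], [U]
   and [V].  Where [b] vanishes identically, [a g = a m = - k] forces [g = m] and
   then [g m = 0].  Where [b] does not vanish, successive differentiation yields
   [k0 = - 4 a], [k2 = 0], and at last a polynomial identity for [b] without real
   solutions. *)
Lemma scalar_contradiction R (V : set 'rV[R]_3) (oV : open V) (V0 : V !=set0)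
    (X0 X1 X2 : 'rV[R]_3 -> 'rV[R]_3) (k : R) (a b g m k0 k1 k2 : 'rV[R]_3 -> R) :
  smooth V a -> smooth V b -> smooth V g -> smooth V m ->
  smooth V k0 -> smooth V k1 -> smooth V k2 -> k != 0 ->
  (forall x, V x -> a x != 0) ->
  (forall x, V x -> a x * m x = - k) ->
  (forall x, V x -> a x * g x = b x ^+ 2 - k) ->
  (forall x, V x -> 'D_(X2 x) a x = b x * (a x + k0 x - 3 * m x)) ->
  (forall x, V x -> 'D_(X2 x) b x = b x ^+ 2 + k1 x * b x - 2 * m x * g x) ->
  (forall x, V x -> 'D_(X0 x) m x = b x * k2 x) ->
  (forall x, V x -> 'D_(X0 x) b x = 'D_(X1 x) a x) ->
  (forall x, V x -> k0 x * (g x - m x) - b x * k1 x + g x * m x = 0) ->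
  (forall x, V x -> 'D_(X2 x) g x = k1 x * (g x - m x) + b x * (g x + 2 * m x)) ->
  (forall x, V x -> 'D_(X1 x) m x = k2 x * (g x - m x)) ->
  (forall x, V x -> 'D_(X0 x) k1 x - 'D_(X1 x) k0 x - (k0 x - g x) * k2 x = 0) ->
  (forall x, V x -> m x * b x + 'D_(X0 x) k2 x - 'D_(X2 x) k0 x + b x * k0 x
      - (m x - k0 x) * k1 x = - b x * m x) -> False.
Proof.
move=> as_ bs gs ms k0s k1s k2s k_0 an0 am ag Ea Eb Em Eba Ef Eg Em1 G1 G2.
have [x0 Vx0 bx0] : exists2 x, V x & b x != 0.
  apply: contrapT => H; case: V0 => x Vx.
  have bx : b x = 0 by apply/eqP/negP => h; apply: H; exists x => //; apply/negP.
  have aI := mulfI (an0 x Vx).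
  have gm : g x = m x by apply: aI; rewrite am// ag// bx expr0n /=; ring.
  have := Ef x Vx; rewrite gm bx subrr mulr0 mul0r subr0 add0r => /eqP.
  rewrite mulf_eq0 orbb => /eqP m0; have := am x Vx; rewrite m0 mulr0 => /eqP.
  by rewrite eq_sym oppr_eq0 (negbTE k_0).
pose W : set 'rV[R]_3 := [set x | V x /\ b x != 0].
have oW : open W by exact: open_neq0.
have WV : W `<=` V by move=> x [].
have Wx0 : W x0 by [].
have sW h : smooth V h -> smooth W h by exact: smooth_restr.
have aW := sW _ as_; have bW := sW _ bs; have gW := sW _ gs; have mW := sW _ ms.
have k0W := sW _ k0s; have k1W := sW _ k1s; have k2W := sW _ k2s.
have Dam x v : V x -> 'D_v a x * m x + a x * 'D_v m x = 0.
  move=> Vx; rewrite -(derive_mulf v oV as_ ms Vx) -[RHS](derive_cst (- k) x v).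
  exact: (derive_ext v oV Vx am).
have Dag x v : V x -> 'D_v a x * g x + a x * 'D_v g x = 2 * b x * 'D_v b x.
  move=> Vx; rewrite -(derive_mulf v oV as_ gs Vx).
  have -> : 2 * b x * 'D_v b x = ('D_v b x * b x + b x * 'D_v b x) + 0 by ring.
  rewrite -(derive_mulf v oV bs bs Vx) -(derive_cst (- k) x v).
  rewrite -(derive_addf v oV (smooth_mul oV bs bs) (smooth_cst (- k) oV) Vx).
  by apply: (derive_ext v oV Vx) => y Vy; rewrite ag// expr2.
(* along [V], [a g = b^2 - k] *)
have k0E x : W x -> k0 x = - 4 * a x.
  move=> [Vx bx]; have nz := an0 x Vx.
  exact: (solve_k0 k_0 nz bx (am x Vx) (ag x Vx) (Ea x Vx) (Eb x Vx) (Eg x Vx) (Ef x Vx) (Dag x _ Vx)).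
have Dk0 x v : W x -> 'D_v k0 x = - 4 * 'D_v a x.
  move=> Wx; rewrite (derive_ext v oW Wx k0E).
  by rewrite (derive_mulf v oW (smooth_cst _ oW) aW Wx) derive_cst mul0r add0r.
have k1E x : W x -> b x * k1 x = - 4 * b x ^+ 2 + g x * m x.
  move=> Wx; have Vx := WV x Wx; have := Ef x Vx; rewrite k0E//.
  have -> : - 4 * a x * (g x - m x) = - 4 * (a x * g x - a x * m x) by ring.
  by rewrite ag// am// => h; lra.
have Dk1 x v : W x -> 'D_v b x * k1 x + b x * 'D_v k1 x =
    - 8 * b x * 'D_v b x + ('D_v g x * m x + g x * 'D_v m x).
  move=> Wx; rewrite -(derive_mulf v oW bW k1W Wx) (derive_ext v oW Wx k1E).
  rewrite -(derive_mulf v oW gW mW Wx).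
  have b2s : smooth W (fun y => b y ^+ 2).
    by apply: smooth_ext (smooth_mul oW bW bW) => // y _; rewrite expr2.
  have b4s := smooth_mul oW (smooth_cst (- 4) oW) b2s.
  rewrite (derive_addf v oW b4s (smooth_mul oW gW mW) Wx); congr (_ + _).
  rewrite (derive_mulf v oW (smooth_cst _ oW) b2s Wx) derive_cst mul0r add0r.
  rewrite (derive_ext (g := fun y => b y * b y) v oW Wx); last by move=> y _; rewrite expr2.
  by rewrite (derive_mulf v oW bW bW Wx); ring.
have D0E x : W x -> 'D_(X0 x) a x = a x ^+ 2 * b x * k2 x / k /\
    'D_(X0 x) b x = a x * k2 x * b x ^+ 2 / k.
  move=> [Vx bx].
  exact: (solve_xi_derivatives k_0 (an0 x Vx) bx (am x Vx) (ag x Vx) (Em x Vx) (Dam x _ Vx) (Em1 x Vx) (Dam x _ Vx) (Eba x Vx)).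
have gauss1 x : W x -> k2 x * (b x ^+ 2 + 2 * a x ^+ 2 - 2 * k) = 0.
  move=> Wx; have [Vx bx] := Wx; have [Da Db] := D0E x Wx.
  have Dk01 : 'D_(X1 x) k0 x = - 4 * 'D_(X0 x) b x by rewrite Dk0// Eba.
  exact: (reduce_gauss_xiU k_0 (an0 x Vx) bx (am x Vx) (ag x Vx) (k0E x Wx) (k1E x Wx)
    (Em x Vx) Da Db (Dag x _ Vx) (Dk1 x _ Wx) Dk01 (G1 x Vx)).
(* otherwise [b^2 + 2 a^2 = 2 k] on an open set, and the derivative of the left
   side along [xi] is [4 a b k2], a nonzero number *)
have k20 x : W x -> k2 x = 0.
  move=> Wx; apply/eqP; apply: contrapT => /negP kx.
  pose W' : set 'rV[R]_3 := [set x | W x /\ k2 x != 0].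
  have oW' : open W' by exact: open_neq0.
  have W'x : W' x by [].
  have H y : W' y -> b y * b y + 2 * (a y * a y) = 2 * k.
    by move=> [Wy ky]; have /eqP := gauss1 y Wy; rewrite mulf_eq0 (negbTE ky) /= => /eqP h; lra.
  have W'W : W' `<=` W by move=> y [].
  have a' := smooth_restr W'W aW; have b' := smooth_restr W'W bW.
  have := derive_ext (X0 x) oW' W'x H.
  have aa := smooth_mul oW' a' a'.
  rewrite derive_cst (derive_addf _ oW' (smooth_mul oW' b' b') (smooth_mul oW' (smooth_cst 2 oW') aa) W'x).
  rewrite (derive_mulf _ oW' b' b' W'x) (derive_mulf _ oW' (smooth_cst 2 oW') aa W'x).
  rewrite derive_cst mul0r add0r (derive_mulf _ oW' a' a' W'x).
  have [-> ->] := D0E x Wx; have [Vx bx] := Wx.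
  have -> : a x * k2 x * b x ^+ 2 / k * b x + b x * (a x * k2 x * b x ^+ 2 / k) +
    2 * (a x ^+ 2 * b x * k2 x / k * a x + a x * (a x ^+ 2 * b x * k2 x / k)) =
    (2 * a x * b x * k2 x / k) * (b x ^+ 2 + 2 * a x ^+ 2) by field.
  move/eqP; rewrite !mulf_eq0 invr_eq0 (negbTE (an0 x Vx)) (negbTE bx) (negbTE kx) (negbTE k_0) pnatr_eq0 /=.
  have b2 : 0 < b x ^+ 2 by rewrite exprn_even_gt0.
  have a2 : 0 <= a x ^+ 2 by exact: sqr_ge0.
  by move=> /eqP h; lra.
have gauss2 x : W x -> a x ^+ 2 * (10 * b x ^+ 2 - 4 * k) = k * (b x ^+ 2 - k).
  move=> Wx; have [Vx bx] := Wx.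
  have Dk2 : 'D_(X0 x) k2 x = 0.
    by rewrite -[RHS](derive_cst (0 : R) x (X0 x)); apply: (derive_ext _ oW Wx).
  have := G2 x Vx; rewrite Dk2 addr0 (Dk0 x _ Wx) => G.
  exact: (reduce_gauss_xiV k_0 (an0 x Vx) bx (am x Vx) (ag x Vx) (k0E x Wx) (k1E x Wx) (Ea x Vx) G).
have gauss2' x : W x -> a x * a x * (10 * (b x * b x) + - (4 * k)) = k * (b x * b x) + - (k * k).
  by move=> /gauss2; rewrite !expr2 => h; rewrite h; ring.
have Vx := Vx0.
have aa := smooth_mul oW aW aW; have bb := smooth_mul oW bW bW.
have c10 := smooth_mul oW (smooth_cst 10 oW) bb.
have c4 := smooth_cst (- (4 * k)) oW.
have kbb := smooth_mul oW (smooth_cst k oW) bb.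
have := derive_ext (X2 x0) oW Wx0 gauss2'.
rewrite (derive_mulf _ oW aa (smooth_add oW c10 c4) Wx0) (derive_mulf _ oW aW aW Wx0).
rewrite (derive_addf _ oW c10 c4 Wx0) derive_cst addr0 (derive_mulf _ oW (smooth_cst 10 oW) bb Wx0).
rewrite derive_cst mul0r add0r (derive_mulf _ oW bW bW Wx0).
rewrite (derive_addf _ oW kbb (smooth_cst (- (k * k)) oW) Wx0) derive_cst addr0.
rewrite (derive_mulf _ oW (smooth_cst k oW) bb Wx0) derive_cst mul0r add0r (derive_mulf _ oW bW bW Wx0).
move=> D.
apply: (no_real_b k_0 (an0 _ Vx) bx0 (am _ Vx) (ag _ Vx) (k0E _ Wx0) (k1E _ Wx0) (Ea _ Vx) (Eb _ Vx) (gauss2 _ Wx0)).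
move: D; move: ('D_(X2 x0) a x0) ('D_(X2 x0) b x0) => p q D.
have -> : 2 * a x0 * p * (10 * b x0 ^+ 2 - 4 * k) + a x0 ^+ 2 * (20 * b x0 * q) =
  (p * a x0 + a x0 * p) * (10 * (b x0 * b x0) + - (4 * k)) + a x0 * a x0 * (10 * (q * b x0 + b x0 * q)) by ring.
by rewrite D; ring.
Qed.

(** * Structure equations *)

(** The shape of a matrix in the Lie algebra of the unitary group of [Kmx c]. *)
Definition mkO R (k t s h : R) (p q r : R[i]) : 'M[R[i]]_3 :=
  \matrix_(i, j) match nat_of_ord i, nat_of_ord j with
    | 0%N, 0%N => 'i * t%:C | 0%N, 1%N => - (k%:C * conjc p) | 0%N, _ => - (k%:C * conjc q)
    | 1%N, 0%N => p | 1%N, 1%N => 'i * s%:C | 1%N, _ => - conjc r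
    | _, 0%N => q | _, 1%N => r | _, _ => 'i * h%:C end.

(** Entries of the commutator of two matrices of the form [mkO], in terms of the
   quantities entering the connection form.  On the diagonal only the
   differences of the [t], [s], [h] with [t] matter, as a common phase acts
   trivially on lines. *)
Definition comm10 R (a a' : R) (p q r p' q' r' : R[i]) : R[i] :=
  'i * a%:C * p' - 'i * a'%:C * p - conjc r * q' + conjc r' * q.
Definition comm20 R (l l' : R) (p q r p' q' r' : R[i]) : R[i] :=
  'i * l%:C * q' - 'i * l'%:C * q + r * p' - r' * p.
Definition comm21 R (k d d' : R) (p q r p' q' r' : R[i]) : R[i] :=
  'i * r' * d%:C - 'i * r * d'%:C - k%:C * (q * conjc p' - q' * conjc p).
Definition comm11 R (k : R) (p q r p' q' r' : R[i]) : R :=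
  Im (conjc r' * r - conjc r * r' - k%:C * (2 * (p * conjc p' - p' * conjc p) + (conjc q' * q - conjc q * q'))).
Definition comm22 R (k : R) (p q r p' q' r' : R[i]) : R :=
  Im (r' * conjc r - r * conjc r' - k%:C * (2 * (q * conjc q' - q' * conjc q) + (p * conjc p' - p' * conjc p))).

Lemma comm_mkO R (k t s h t' s' h' : R) (p q r p' q' r' : R[i]) (P Q : 'M[R[i]]_3) :
  P = mkO k t s h p q r -> Q = mkO k t' s' h' p' q' r' ->
  [/\ (P *m Q) 1 0 - (Q *m P) 1 0 = comm10 (s - t) (s' - t') p q r p' q' r',
      (P *m Q) ord_max 0 - (Q *m P) ord_max 0 = comm20 (h - t) (h' - t') p q r p' q' r',
      (P *m Q) ord_max 1 - (Q *m P) ord_max 1 = comm21 k (h - s) (h' - s') p q r p' q' r',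
      Im ((P *m Q) 1 1 - (Q *m P) 1 1) - Im ((P *m Q) 0 0 - (Q *m P) 0 0)
        = comm11 k p q r p' q' r' &
      Im ((P *m Q) ord_max ord_max - (Q *m P) ord_max ord_max)
         - Im ((P *m Q) 0 0 - (Q *m P) 0 0) = comm22 k p q r p' q' r'].
Proof.
move=> -> ->; rewrite !mulmx3 /mkO !mxE /= /comm10 /comm20 /comm21 /comm11 /comm22 {P Q}.
case: p => p1 p2; case: q => q1 q2; case: r => r1 r2.
case: p' => p1' p2'; case: q' => q1' q2'; case: r' => r1' r2'.
split; try (by rewrite /=; ring); by apply/cplxP; rewrite /=; ring.
Qed.

(** Components [p] and [q] of the three frame fields. *)
Definition pc R (a : 'I_3) : R[i] :=
  match nat_of_ord a with 0%N => - 'i | _ => 0 end.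
Definition qc R (a : 'I_3) : R[i] :=
  match nat_of_ord a with 0%N => 0 | 1%N => 1 | _ => 'i end.

Section Structure.
Context (R : realType) (c : R) (c0 : c != 0) (V : set 'rV[R]_3) (oV : open V).
Context (f Phi : 'rV[R]_3 -> 'M[R[i]]_3) (ad : adapted c V f Phi).
Context (imm : forall x v, V x -> Dmx f x v = 0 -> v = 0).

Let Ps : smooth_mx V Phi. Proof. by case: ad. Qed.

Local Notation O := (Om c Phi).
Local Notation E := (fr c Phi).

Lemma Om_mkO x v : V x -> O x v = mkO (c / 4) (Im (O x v 0 0)) (Im (O x v 1 1))
  (Im (O x v ord_max ord_max)) (O x v 1 0) (qf c Phi x v) (rf c Phi x v).
Proof.
move=> Vx.
have e01 := O01E c0 oV ad v Vx; have e02 := O02E c0 oV ad v Vx; have e12 := O12E c0 oV ad v Vx.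
have d0 := OdiagE c0 oV ad v 0 Vx; have d1 := OdiagE c0 oV ad v 1 Vx.
have d2 := OdiagE c0 oV ad v ord_max Vx.
rewrite /qf /rf; move: (O x v) e01 e02 e12 d0 d1 d2 => o e01 e02 e12 d0 d1 d2.
apply/matrixP; apply: ord3P; apply: ord3P; rewrite /mkO [RHS]mxE //=.
- by move: (o 0 0) d0 => [? ?] /= ->; apply/cplxP; rewrite /=; ring.
- by move: (o 1 1) d1 => [? ?] /= ->; apply/cplxP; rewrite /=; ring.
- by move: (o ord_max ord_max) d2 => [? ?] /= ->; apply/cplxP; rewrite /=; ring.
Qed.

Lemma O10_fr x a : V x -> O x (E a x) 1 0 = pc R a.
Proof.
move=> Vx; rewrite (O10E ad)// (coframe_fr c0 oV ad imm)// e_E.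
by move: a; apply: ord3P => /=; rewrite ?mulr1 ?mulr0.
Qed.

Lemma qf_fr x a : V x -> qf c Phi x (E a x) = qc R a.
Proof.
move=> Vx; rewrite qfE !(coframe_fr c0 oV ad imm)// !e_E.
by move: a; apply: ord3P => /=.
Qed.

(** Linearity of the connection form in its vector argument. *)
Lemma O_expand x v i j : V x ->
  O x v i j = \sum_a (coframe c Phi x v 0 a)%:C * O x (E a x) i j.
Proof.
move=> Vx.
have L w := Om_lin c w i j oV Ps Vx.
rewrite L; under [RHS]eq_bigr => a _ do rewrite (L (E a x)) mulr_sumr.
rewrite exchange_big; apply: eq_bigr => k _ /=.
rewrite {1}(fr_expand c0 oV ad imm v Vx) summxE rmorph_sum mulr_suml; apply: eq_bigr => a _.
by rewrite [in LHS]mxE rmorphM mulrA.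
Qed.

(** [integrability] for two frame fields.  The first two equations give their
   bracket, the third and fourth are the Codazzi equations, the last one is the
   Gauss equation. *)
Lemma structure x a b : V x ->
  let B := bracket (E a) (E b) x in
  let r d := rf c Phi x (E d x) in let A d := af c Phi x (E d x) in
  let K d := kf c Phi x (E d x) in
  [/\ O x B 1 0 = comm10 (A a) (A b) (pc R a) (qc R a) (r a) (pc R b) (qc R b) (r b),
      qf c Phi x B = comm20 (K a) (K b) (pc R a) (qc R a) (r a) (pc R b) (qc R b) (r b),
      DC (fun y => rf c Phi y (E b y)) x (E a x) - DC (fun y => rf c Phi y (E a y)) x (E b x)
      + comm21 (c / 4) (K a - A a) (K b - A b) (pc R a) (qc R a) (r a) (pc R b) (qc R b) (r b)
       = rf c Phi x B,
      'D_(E a x) (fun y => af c Phi y (E b y)) x - 'D_(E b x) (fun y => af c Phi y (E a y)) x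
      + comm11 (c / 4) (pc R a) (qc R a) (r a) (pc R b) (qc R b) (r b) = af c Phi x B &
      'D_(E a x) (fun y => kf c Phi y (E b y)) x - 'D_(E b x) (fun y => kf c Phi y (E a y)) x
      + comm22 (c / 4) (pc R a) (qc R a) (r a) (pc R b) (qc R b) (r b) = kf c Phi x B].
Proof.
move=> Vx B r A K.
have sa := smooth_fr c0 oV ad imm a; have sb := smooth_fr c0 oV ad imm b.
have H i j := integr_entry c0 oV ad i j Vx sa sb.
have Dp d w : DC (fun y => O y (E d y) 1 0) x w = 0.
  rewrite -[RHS](DC_cst (pc R d) x w); apply: (DC_ext w oV Vx) => y Vy; exact: O10_fr.
have Dq d w : DC (fun y => O y (E d y) ord_max 0) x w = 0.
  rewrite -[RHS](DC_cst (qc R d) x w); apply: (DC_ext w oV Vx) => y Vy; exact: qf_fr.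
have H10 := H 1 0; have H20 := H ord_max 0; have H21 := H ord_max 1.
have H11 := congr1 (@complex.Im R) (H 1 1); have H22 := congr1 (@complex.Im R) (H ord_max ord_max).
have H00 := congr1 (@complex.Im R) (H 0 0).
have sO d i j : smoothC V (fun y => O y (E d y) i j) by exact: (smooth_O oV ad i j (smooth_fr c0 oV ad imm d)).
have Da d w : 'D_w (fun y => af c Phi y (E d y)) x =
    Im (DC (fun y => O y (E d y) 1 1) x w) - Im (DC (fun y => O y (E d y) 0 0) x w).
  rewrite !ImDC -(derive_oppf w oV (smooth_Im (sO d 0 0)) Vx).
  by rewrite -(derive_addf w oV (smooth_Im (sO d 1 1)) (smooth_opp oV (smooth_Im (sO d 0 0))) Vx).
have Dk d w : 'D_w (fun y => kf c Phi y (E d y)) x =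
    Im (DC (fun y => O y (E d y) ord_max ord_max) x w) - Im (DC (fun y => O y (E d y) 0 0) x w).
  rewrite !ImDC -(derive_oppf w oV (smooth_Im (sO d 0 0)) Vx).
  by rewrite -(derive_addf w oV (smooth_Im (sO d ord_max ord_max)) (smooth_opp oV (smooth_Im (sO d 0 0))) Vx).
have PE d : O x (E d x) = mkO (c / 4) (Im (O x (E d x) 0 0)) (Im (O x (E d x) 1 1))
    (Im (O x (E d x) ord_max ord_max)) (pc R d) (qc R d) (r d).
  exact: (etrans (Om_mkO (E d x) Vx)
    (congr2 (fun p q => mkO _ _ _ _ p q _) (O10_fr d Vx) (qf_fr d Vx))).
have [] := comm_mkO (PE a) (PE b).
move=> C10 C20 C21 C11 C22.
have alg (d1 d2 e1 e2 p q : R[i]) : Im d1 - Im e1 - (Im d2 - Im e2)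
    + (Im p - Im q) = Im (d1 - d2 + p) - Im (e1 - e2 + q).
  by case: d1 d2 e1 e2 p q => [? ?] [? ?] [? ?] [? ?] [? ?] [? ?] /=; ring.
split.
- apply: etrans (esym H10) (etrans (congr2 +%R _ C10) (add0r _)).
  exact: (etrans (congr2 (fun u w => u - w) (Dp b (E a x)) (Dp a (E b x))) (subrr 0)).
- apply: etrans (esym H20) (etrans (congr2 +%R _ C20) (add0r _)).
  exact: (etrans (congr2 (fun u w => u - w) (Dq b (E a x)) (Dq a (E b x))) (subrr 0)).
- apply: etrans _ H21; apply: (congr2 +%R) => //; apply: etrans _ (esym C21).
  by congr comm21; rewrite /K /A /kf /af; ring.
- apply: etrans (congr2 +%R (congr2 (fun u w => u - w) (Da b (E a x)) (Da a (E b x))) (esym C11)) _.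
  exact: (etrans (alg _ _ _ _ _ _) (congr2 (fun u v => u - v) H11 H00)).
- apply: etrans (congr2 +%R (congr2 (fun u w => u - w) (Dk b (E a x)) (Dk a (E b x))) (esym C22)) _.
  exact: (etrans (alg _ _ _ _ _ _) (congr2 (fun u v => u - v) H22 H00)).
Qed.

End Structure.

(** * Vanishing structure Jacobi operator *)

(** The component of [l v] in the distribution, as a complex number; see
   [jacobi_frame]. *)
Definition lf R (c : R) (Phi : 'rV[R]_3 -> 'M[R[i]]_3) (x v : 'rV[R]_3) : R[i] :=
  rf c Phi x (fr c Phi 0 x) * (af c Phi x v)%:C
  - (af c Phi x (fr c Phi 0 x))%:C * rf c Phi x v + (c / 4)%:C * qf c Phi x v.

(** When [l] vanishes on [V = J U], the component of [l V] along [V] reads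
   [a m = - k]; hence [a <> 0], and the remaining components of [l U = l V = 0]
   determine the shape operator up to two functions. *)
Lemma shape_alg R (k al : R) (z0 z1 z2 : R[i]) : k != 0 ->
  Re z2 = Im z1 -> Im z0 = 0 ->
  z0 * (- Im z0)%:C - al%:C * z2 + k%:C * 'i = 0 ->
  z0 * (- Re z0)%:C - al%:C * z1 + k%:C * 1 = 0 ->
  [/\ al != 0, al * - Re z1 = (- Re z0) ^+ 2 - k, al * - Im z2 = - k &
    [/\ z0 = (- - Re z0)%:C, z1 = (- - Re z1)%:C & z2 = 'i * (- - Im z2)%:C]].
Proof.
move=> k_0; move: z0 z1 z2 => [x0 y0] [x1 y1] [x2 y2] /= s3 -> [] e1 e2 [] e3 e4.
have al0 : al != 0.
  by apply: contraNneq k_0 => z; apply/eqP; rewrite z in e2; lra.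
have y10 : y1 = 0 by apply: (mulfI al0); lra.
split; [by []|lra|lra|].
by split; apply/cplxP; rewrite /=; lra.
Qed.

(** The structure equations of three frame fields, with the brackets substituted
   and the shape operator in its reduced form, are linear in the derivatives; the
   listed consequences are linear combinations of them. *)
Lemma codazzi_gauss_alg R (k a b g m k0 k1 k2 al1 al2 : R) (z0 z1 z2 : R[i])
  (u0 u1 u2 v0 v1 v2 w0 w1 w2 b0 b1 b2 g0 g2 m0 m1 a1 a2 K01 K10 K02 K20 e03 e04 e23 e14 : R)
  (d01 d02 d10 d12 d20 d21 : R[i]) :
  a * g = b ^+ 2 - k -> a * m = - k ->
  z0 = (- b)%:C -> z1 = (- g)%:C -> z2 = 'i * (- m)%:C -> al1 = b -> al2 = 0 ->
  d01 = (- g0)%:C -> d02 = 'i * (- m0)%:C -> d10 = (- b1)%:C -> d12 = 'i * (- m1)%:C ->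
  d20 = (- b2)%:C -> d21 = (- g2)%:C -> e03 = b0 -> e04 = 0 -> e23 = b2 -> e14 = 0 ->
  u0 = - Im (comm10 a al1 (pc R 0) (qc R 0) z0 (pc R 1) (qc R 1) z1) ->
  u1 = Re (comm20 k0 k1 (pc R 0) (qc R 0) z0 (pc R 1) (qc R 1) z1) ->
  u2 = Im (comm20 k0 k1 (pc R 0) (qc R 0) z0 (pc R 1) (qc R 1) z1) ->
  v0 = - Im (comm10 a al2 (pc R 0) (qc R 0) z0 (pc R ord_max) (qc R ord_max) z2) ->
  v1 = Re (comm20 k0 k2 (pc R 0) (qc R 0) z0 (pc R ord_max) (qc R ord_max) z2) ->
  v2 = Im (comm20 k0 k2 (pc R 0) (qc R 0) z0 (pc R ord_max) (qc R ord_max) z2) ->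
  w0 = - Im (comm10 al1 al2 (pc R 1) (qc R 1) z1 (pc R ord_max) (qc R ord_max) z2) ->
  w1 = Re (comm20 k1 k2 (pc R 1) (qc R 1) z1 (pc R ord_max) (qc R ord_max) z2) ->
  w2 = Im (comm20 k1 k2 (pc R 1) (qc R 1) z1 (pc R ord_max) (qc R ord_max) z2) ->
  d01 - d10 + comm21 k (k0 - a) (k1 - al1) (pc R 0) (qc R 0) z0 (pc R 1) (qc R 1) z1
    = u0%:C * z0 + u1%:C * z1 + u2%:C * z2 ->
  d02 - d20 + comm21 k (k0 - a) (k2 - al2) (pc R 0) (qc R 0) z0 (pc R ord_max) (qc R ord_max) z2
    = v0%:C * z0 + v1%:C * z1 + v2%:C * z2 ->
  d12 - d21 + comm21 k (k1 - al1) (k2 - al2) (pc R 1) (qc R 1) z1 (pc R ord_max) (qc R ord_max) z2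
    = w0%:C * z0 + w1%:C * z1 + w2%:C * z2 ->
  e03 - a1 + comm11 k (pc R 0) (qc R 0) z0 (pc R 1) (qc R 1) z1 = u0 * a + u1 * al1 + u2 * al2 ->
  e04 - a2 + comm11 k (pc R 0) (qc R 0) z0 (pc R ord_max) (qc R ord_max) z2 = v0 * a + v1 * al1 + v2 * al2 ->
  e14 - e23 + comm11 k (pc R 1) (qc R 1) z1 (pc R ord_max) (qc R ord_max) z2 = w0 * a + w1 * al1 + w2 * al2 ->
  K01 - K10 + comm22 k (pc R 0) (qc R 0) z0 (pc R 1) (qc R 1) z1 = u0 * k0 + u1 * k1 + u2 * k2 ->
  K02 - K20 + comm22 k (pc R 0) (qc R 0) z0 (pc R ord_max) (qc R ord_max) z2 = v0 * k0 + v1 * k1 + v2 * k2 ->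
  [/\ a2 = b * (a + k0 - 3 * m), b2 = b ^+ 2 + k1 * b - 2 * m * g, m0 = b * k2, b0 = a1 &
    k0 * (g - m) - b * k1 + g * m = 0] /\
  [/\ g2 = k1 * (g - m) + b * (g + 2 * m), m1 = k2 * (g - m), K01 - K10 - (k0 - g) * k2 = 0 &
    m * b + K02 - K20 + b * k0 - (m - k0) * k1 = - b * m].
Proof.
move=> ag am -> -> -> -> -> -> -> -> -> -> -> -> -> -> ->.
rewrite /comm10 /comm20 /comm21 /comm11 /comm22 /pc /qc /=.
move=> -> -> -> -> -> -> -> -> -> [c1 c2] [c3 c4] [c5 c6] f1 f2 f3 g1 g3.
(* each conclusion comes from a single structure equation *)
split; split.
- by move: ag am f2; clear; lra.
- by move: ag am f3; clear; lra.
- by move: ag am c4; clear; lra.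
- by move: ag am f1; clear; lra.
- by move: ag am c2; clear; lra.
- by move: ag am c5; clear; lra.
- by move: ag am c6; clear; lra.
- by move: ag am g1; clear; lra.
- by move: ag am g3; clear; lra.
Qed.

Section FlatJacobi.
Context (R : realType) (c : R) (c0 : c != 0) (V : set 'rV[R]_3) (oV : open V).
Context (f Phi : 'rV[R]_3 -> 'M[R[i]]_3) (ad : adapted c V f Phi).
Context (imm : forall x v, V x -> Dmx f x v = 0 -> v = 0).
Context (l1 : forall x, V x -> lf c Phi x (fr c Phi 1 x) = 0).
Context (l2 : forall x, V x -> lf c Phi x (fr c Phi ord_max x) = 0).
Context (r0 : forall x, V x -> Im (rf c Phi x (fr c Phi 0 x)) = 0).

Local Notation E := (fr c Phi).
Local Notation B a b x := (bracket (E a) (E b) x).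
Let k := c / 4.
Let a x := af c Phi x (E 0 x).
Let b x := - Re (rf c Phi x (E 0 x)).
Let g x := - Re (rf c Phi x (E 1 x)).
Let m x := - Im (rf c Phi x (E ord_max x)).
Let k0 x := kf c Phi x (E 0 x).
Let k1 x := kf c Phi x (E 1 x).
Let k2 x := kf c Phi x (E ord_max x).

Lemma bracket_coframe x d e : V x ->
  [/\ coframe c Phi x (B d e x) 0 0 = - Im (comm10 (af c Phi x (E d x)) (af c Phi x (E e x))
        (pc R d) (qc R d) (rf c Phi x (E d x)) (pc R e) (qc R e) (rf c Phi x (E e x))),
      coframe c Phi x (B d e x) 0 1 = Re (comm20 (kf c Phi x (E d x)) (kf c Phi x (E e x))
        (pc R d) (qc R d) (rf c Phi x (E d x)) (pc R e) (qc R e) (rf c Phi x (E e x))),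
      coframe c Phi x (B d e x) 0 ord_max = Im (comm20 (kf c Phi x (E d x)) (kf c Phi x (E e x))
        (pc R d) (qc R d) (rf c Phi x (E d x)) (pc R e) (qc R e) (rf c Phi x (E e x))) &
      Re (comm10 (af c Phi x (E d x)) (af c Phi x (E e x))
        (pc R d) (qc R d) (rf c Phi x (E d x)) (pc R e) (qc R e) (rf c Phi x (E e x))) = 0].
Proof.
move=> Vx; have [H1 H2 _ _ _] := structure c0 oV ad imm d e Vx.
have [_ _ _ Re10] := ad.
split.
- by rewrite coframe0E; congr (- Im _).
- by rewrite coframe1E; congr Re.
- by rewrite coframe2E; congr Im.
- by rewrite -(Re10 x (B d e x) Vx); congr Re.
Qed.

(** The shape operator is selfadjoint.  In terms of the connection form this is
   the reality condition on [p] applied to brackets of frame fields. *)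
Lemma symmetry x : V x ->
  [/\ af c Phi x (E 1 x) = - Re (rf c Phi x (E 0 x)),
      af c Phi x (E ord_max x) = - Im (rf c Phi x (E 0 x)) &
      Re (rf c Phi x (E ord_max x)) = Im (rf c Phi x (E 1 x))].
Proof.
move=> Vx.
have [_ _ _] := bracket_coframe 0 1 Vx; have [_ _ _] := bracket_coframe 0 ord_max Vx.
have [_ _ _] := bracket_coframe 1 ord_max Vx.
rewrite /comm10 /pc /qc /=.
move: (rf c Phi x (E 0 x)) (rf c Phi x (E 1 x)) (rf c Phi x (E ord_max x)) => [? ?] [? ?] [? ?] /=.
move: (af c Phi x (E 0 x)) (af c Phi x (E 1 x)) (af c Phi x (E ord_max x)) => a0 a1 a2.
by move=> h1 h2 h3; split; lra.
Qed.

Lemma shape x : V x ->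
  [/\ a x != 0, a x * g x = b x ^+ 2 - k, a x * m x = - k &
    [/\ rf c Phi x (E 0 x) = (- b x)%:C, rf c Phi x (E 1 x) = (- g x)%:C,
      rf c Phi x (E ord_max x) = 'i * (- m x)%:C, af c Phi x (E 1 x) = b x &
      af c Phi x (E ord_max x) = 0]].
Proof.
move=> Vx; have [s1 s2 s3] := symmetry Vx.
have := l1 Vx; have := l2 Vx; have := r0 Vx.
have k_0 : k != 0 by rewrite mulf_neq0 ?invr_eq0 ?pnatr_eq0.
rewrite /lf !(qf_fr c0 oV ad imm)// /qc /= s1 s2 /a /b /g /m -/k.
move=> q1 q2 q3; have [n1 n2 n3 [z0 z1 z2]] := shape_alg k_0 s3 q1 q2 q3.
split; [exact: n1|exact: n2|exact: n3|split].
- exact: z0.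
- exact: z1.
- exact: z2.
- exact: erefl.
- exact: etrans (congr1 -%R q1) (oppr0 _).
Qed.

Let saf d : smooth V (fun y => af c Phi y (E d y)).
Proof.
have sO i j := smooth_O oV ad i j (smooth_fr c0 oV ad imm d).
by apply: smooth_add => //; [exact: smooth_Im (sO 1 1)|apply: smooth_opp => //; exact: smooth_Im (sO 0 0)].
Qed.

Let skf d : smooth V (fun y => kf c Phi y (E d y)).
Proof.
have sO i j := smooth_O oV ad i j (smooth_fr c0 oV ad imm d).
by apply: smooth_add => //; [exact: smooth_Im (sO ord_max ord_max)|apply: smooth_opp => //; exact: smooth_Im (sO 0 0)].
Qed.

Let srf d : smoothC V (fun y => rf c Phi y (E d y)).
Proof. exact: (smooth_O oV ad ord_max 1 (smooth_fr c0 oV ad imm d)). Qed.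

Let sb : smooth V b. Proof. by apply: smooth_opp => //; exact: smooth_Re (srf 0). Qed.
Let sg : smooth V g. Proof. by apply: smooth_opp => //; exact: smooth_Re (srf 1). Qed.
Let sm : smooth V m. Proof. by apply: smooth_opp => //; exact: smooth_Im (srf ord_max). Qed.

Let DCreal h x v : V x -> smooth V h -> DC (fun y => (- h y)%:C) x v = (- 'D_v h x)%:C.
Proof.
move=> Vx sh; apply/cplxP.
  rewrite ReDC /= -(derive_oppf v oV sh Vx).
  by apply: (derive_ext v oV Vx).
rewrite ImDC /= -[RHS](derive_cst (0 : R) x v).
by apply: (derive_ext v oV Vx).
Qed.

Let DCimag h x v : V x -> smooth V h -> DC (fun y => 'i * (- h y)%:C) x v = 'i * (- 'D_v h x)%:C.
Proof.
move=> Vx sh; rewrite (DC_mul v oV (smoothC_cst 'i oV) (smoothC_real oV (smooth_opp oV sh)) Vx).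
by rewrite DC_cst mul0r add0r DCreal.
Qed.

Lemma derive_shape x v : V x ->
  [/\ DC (fun y => rf c Phi y (E 0 y)) x v = (- 'D_v b x)%:C,
      DC (fun y => rf c Phi y (E 1 y)) x v = (- 'D_v g x)%:C,
      DC (fun y => rf c Phi y (E ord_max y)) x v = 'i * (- 'D_v m x)%:C,
      'D_v (fun y => af c Phi y (E 1 y)) x = 'D_v b x &
      'D_v (fun y => af c Phi y (E ord_max y)) x = 0].
Proof.
move=> Vx; split.
- rewrite -(DCreal v Vx sb); apply: (DC_ext v oV Vx) => y /shape [_ _ _ []] //.
- rewrite -(DCreal v Vx sg); apply: (DC_ext v oV Vx) => y /shape [_ _ _ []] //.
- rewrite -(DCimag v Vx sm); apply: (DC_ext v oV Vx) => y /shape [_ _ _ []] //.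
- by apply: (derive_ext v oV Vx) => y /shape [_ _ _ []].
- rewrite -[RHS](derive_cst (0 : R) x v).
  by apply: (derive_ext v oV Vx) => y /shape [_ _ _ []].
Qed.

Lemma expand3 x v : V x ->
  [/\ rf c Phi x v = (coframe c Phi x v 0 0)%:C * rf c Phi x (E 0 x)
        + (coframe c Phi x v 0 1)%:C * rf c Phi x (E 1 x)
        + (coframe c Phi x v 0 ord_max)%:C * rf c Phi x (E ord_max x),
      af c Phi x v = coframe c Phi x v 0 0 * af c Phi x (E 0 x)
        + coframe c Phi x v 0 1 * af c Phi x (E 1 x)
        + coframe c Phi x v 0 ord_max * af c Phi x (E ord_max x) &
      kf c Phi x v = coframe c Phi x v 0 0 * kf c Phi x (E 0 x)
        + coframe c Phi x v 0 1 * kf c Phi x (E 1 x)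
        + coframe c Phi x v 0 ord_max * kf c Phi x (E ord_max x)].
Proof.
move=> Vx; have H i j := O_expand c0 oV ad imm v i j Vx.
have alg3 (u0 u1 u2 a0 a1 a2 b0 b1 b2 : R) :
    u0 * a0 + u1 * a1 + u2 * a2 - (u0 * b0 + u1 * b1 + u2 * b2) =
    u0 * (a0 - b0) + u1 * (a1 - b1) + u2 * (a2 - b2) by ring.
have I i j : Im (Om c Phi x v i j) = coframe c Phi x v 0 0 * Im (Om c Phi x (E 0 x) i j)
   + coframe c Phi x v 0 1 * Im (Om c Phi x (E 1 x) i j)
   + coframe c Phi x v 0 ord_max * Im (Om c Phi x (E ord_max x) i j).
  apply: etrans (congr1 (@complex.Im R) (H i j)) (etrans (Im_sum _ _) _).
  exact: etrans (eq_bigr _ (fun d _ => Im_realM _ _)) (sum3 _).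
split.
- exact: etrans (H _ _) (sum3 _).
- apply: etrans (congr2 (fun u w => u - w) (I 1 1) (I 0 0)) _; exact: alg3.
- apply: etrans (congr2 (fun u w => u - w) (I ord_max ord_max) (I 0 0)) _; exact: alg3.
Qed.

Lemma codazzi_gauss x : V x ->
  [/\ 'D_(E ord_max x) a x = b x * (a x + k0 x - 3 * m x),
    'D_(E ord_max x) b x = b x ^+ 2 + k1 x * b x - 2 * m x * g x,
    'D_(E 0 x) m x = b x * k2 x,
    'D_(E 0 x) b x = 'D_(E 1 x) a x &
    k0 x * (g x - m x) - b x * k1 x + g x * m x = 0] /\
  [/\ 'D_(E ord_max x) g x = k1 x * (g x - m x) + b x * (g x + 2 * m x),
    'D_(E 1 x) m x = k2 x * (g x - m x),
    'D_(E 0 x) k1 x - 'D_(E 1 x) k0 x - (k0 x - g x) * k2 x = 0 &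
    m x * b x + 'D_(E 0 x) k2 x - 'D_(E ord_max x) k0 x + b x * k0 x
      - (m x - k0 x) * k1 x = - b x * m x].
Proof.
move=> Vx.
have [_ ag am [R0 R1 R2 A1 A2]] := shape Vx.
have D v := derive_shape v Vx.
have K01 := structure c0 oV ad imm 0 1 Vx.
have K02 := structure c0 oV ad imm 0 ord_max Vx.
have K12 := structure c0 oV ad imm 1 ord_max Vx.
have [X01 Y01 Z01 _] := bracket_coframe 0 1 Vx.
have [X02 Y02 Z02 _] := bracket_coframe 0 ord_max Vx.
have [X12 Y12 Z12 _] := bracket_coframe 1 ord_max Vx.
have [r01 a01 h01] := expand3 (B 0 1 x) Vx.
have [r02 a02 h02] := expand3 (B 0 ord_max x) Vx.
have [r12 a12 h12] := expand3 (B 1 ord_max x) Vx.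
have [_ _ C01 F01 G01] := K01; have [_ _ C02 F02 G02] := K02; have [_ _ C12 F12 _] := K12.
have [D00 D01 D02 D03 D04] := D (E 0 x).
have [D10 D11 D12 D13 D14] := D (E 1 x).
have [D20 D21 D22 D23 D24] := D (E ord_max x).
exact: (codazzi_gauss_alg ag am R0 R1 R2 A1 A2 D01 D02 D10 D12 D20 D21 D03 D04 D23 D14
  X01 Y01 Z01 X02 Y02 Z02 X12 Y12 Z12 (etrans C01 r01) (etrans C02 r02) (etrans C12 r12)
  (etrans F01 a01) (etrans F02 a02) (etrans F12 a12) (etrans G01 h01) (etrans G02 h02)).
Qed.

(** An adapted frame for which [S xi] lies in the plane of [xi] and [U] cannot have
   [l = 0] on the distribution. *)
Theorem no_flat_jacobi : V !=set0 -> False.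
Proof.
move=> V0; have k_0 : k != 0 by rewrite mulf_neq0 ?invr_eq0 ?pnatr_eq0.
apply: (scalar_contradiction oV V0 (X0 := E 0) (X1 := E 1) (X2 := E ord_max)
  (saf 0) sb sg sm (skf 0) (skf 1) (skf ord_max) k_0).
- by move=> x /shape [].
- by move=> x /shape [].
- by move=> x /shape [].
- by move=> x /codazzi_gauss [[]].
- by move=> x /codazzi_gauss [[]].
- by move=> x /codazzi_gauss [[]].
- by move=> x /codazzi_gauss [[]].
- by move=> x /codazzi_gauss [[]].
- by move=> x /codazzi_gauss [_ []].
- by move=> x /codazzi_gauss [_ []].
- by move=> x /codazzi_gauss [_ []].
- by move=> x /codazzi_gauss [_ []].
Qed.

End FlatJacobi.

(** * Completing a vector to a unitary frame *)

Lemma conjcM R (a b : R[i]) : conjc (a * b) = conjc a * conjc b.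
Proof. exact: rmorphM. Qed.

Lemma conjcB R (a b : R[i]) : conjc (a - b) = conjc a - conjc b.
Proof. exact: rmorphB. Qed.

Lemma hermE R (c : R) (z w : 'cV[R[i]]_3) :
  herm c z w = (Num.sg c)%:C * z 0 0 * conjc (w 0 0) + z 1 0 * conjc (w 1 0)
               + z ord_max 0 * conjc (w ord_max 0).
Proof.
rewrite /herm -mulmxA mulmx3 !mul_diag_mx !mxE /=.
by move: (w 0 0) (w 1 0) (w ord_max 0) => w0 w1 w2; ring.
Qed.

Lemma herm_real R (c : R) (z : 'cV[R[i]]_3) :
  herm c z z = (Re (herm c z z))%:C.
Proof.
have := herm_conj c z z; case: (herm c z z) => a b [] /= E.
by apply/cplxP; rewrite //=; lra.
Qed.

Lemma hermZ R (c : R) (a b : R[i]) (z w : 'cV[R[i]]_3) :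
  herm c (a *: z) (b *: w) = a * conjc b * herm c z w.
Proof.
rewrite !hermE !mxE !conjcM.
move: (conjc (w 0 0)) (conjc (w 1 0)) (conjc (w ord_max 0)) (conjc b) => w0 w1 w2 b'.
by ring.
Qed.

Definition frame_mx R (z y w : 'cV[R[i]]_3) : 'M[R[i]]_3 :=
  \matrix_(i, j) match nat_of_ord j with 0%N => z i 0 | 1%N => y i 0 | _ => w i 0 end.

Lemma unit_frame_mx R (c : R) (z y w : 'cV[R[i]]_3) :
  herm c z z = (4 / c)%:C -> herm c y y = 1 -> herm c w w = 1 ->
  herm c y z = 0 -> herm c w z = 0 -> herm c w y = 0 ->
  unit_frame c (frame_mx z y w).
Proof.
move=> zz yy ww yz wz wy.
have zy : herm c z y = 0 by rewrite herm_conj yz rmorph0.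
have zw : herm c z w = 0 by rewrite herm_conj wz rmorph0.
have yw : herm c y w = 0 by rewrite herm_conj wy rmorph0.
pose cl (j : 'I_3) : 'cV[R[i]]_3 := if j == 0 then z else if j == 1 then y else w.
have colE i j : frame_mx z y w i j = cl j i 0.
  by move: j; apply: ord3P; rewrite mxE.
have E i j : (adjmx (frame_mx z y w) *m herm_mx c *m frame_mx z y w) i j = herm c (cl j) (cl i).
  move: (frame_mx z y w) colE => P colE.
  rewrite hermE -mulmxA mulmx3 !mul_diag_mx !mxE /= !colE.
  move: (conjc (cl i 0 0)) (conjc (cl i 1 0)) (conjc (cl i ord_max 0)) (cl j) => a0 a1 a2 v'.
  by ring.
apply/matrixP; apply: ord3P; apply: ord3P; rewrite E /cl [RHS]mxE ?[X in _ = X *+ _]mxE /= ?mulr1n ?mulr0n //.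
Qed.

(** [H^-1] applied to the conjugate of the vector product, [H] the matrix of the
   Hermitian form: the result is orthogonal to both arguments. *)
Definition cross R (c : R) (z w : 'cV[R[i]]_3) : 'cV[R[i]]_3 :=
  \col_i match nat_of_ord i with
    | 0%N => (Num.sg c)%:C * conjc (z 1 0 * w ord_max 0 - z ord_max 0 * w 1 0)
    | 1%N => conjc (z ord_max 0 * w 0 0 - z 0 0 * w ord_max 0)
    | _ => conjc (z 0 0 * w 1 0 - z 1 0 * w 0 0) end.

Lemma sgC R (c : R) : c != 0 -> (Num.sg c)%:C = 1 \/ (Num.sg c)%:C = -1 :> R[i].
Proof.
rewrite neq_lt => /orP[c0|c0]; [right; rewrite ltr0_sg|left; rewrite gtr0_sg] => //.
by rewrite rmorphN rmorph1.
Qed.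

Lemma herm_crossl R (c : R) (z w : 'cV[R[i]]_3) : c != 0 ->
  herm c (cross c z w) z = 0.
Proof.
move=> c0; rewrite hermE !mxE /= !conjcB !conjcM.
move: (conjc (w 0 0)) (conjc (w 1 0)) (conjc (w ord_max 0)) => w0 w1 w2.
move: (conjc (z 0 0)) (conjc (z 1 0)) (conjc (z ord_max 0)) => z0 z1 z2.
by case: (sgC c0) => ->; ring.
Qed.

Lemma herm_crossr R (c : R) (z w : 'cV[R[i]]_3) : c != 0 ->
  herm c (cross c z w) w = 0.
Proof.
move=> c0; rewrite hermE !mxE /= !conjcB !conjcM.
move: (conjc (w 0 0)) (conjc (w 1 0)) (conjc (w ord_max 0)) => w0 w1 w2.
move: (conjc (z 0 0)) (conjc (z 1 0)) (conjc (z ord_max 0)) => z0 z1 z2.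
by case: (sgC c0) => ->; ring.
Qed.

Lemma herm_cross R (c : R) (z w : 'cV[R[i]]_3) : c != 0 ->
  herm c (cross c z w) (cross c z w) =
  (Num.sg c)%:C * (herm c z z * herm c w w - herm c z w * herm c w z).
Proof.
move=> c0; rewrite !hermE !mxE /= !conjcM !conjcB !conjcM !conjcK.
have -> : conjc (Num.sg c)%:C = (Num.sg c)%:C by case: (sgC c0) => ->; rewrite ?rmorphN rmorph1.
move: (conjc (w 0 0)) (conjc (w 1 0)) (conjc (w ord_max 0)) => w0 w1 w2.
move: (conjc (z 0 0)) (conjc (z 1 0)) (conjc (z ord_max 0)) => z0 z1 z2.
by case: (sgC c0) => ->; ring.
Qed.

(** One of the two last basis vectors always works: if [c < 0] since [z] is
   negative, if [c > 0] since [z <> 0]. *)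
Lemma cross_pos R (c : R) (z : 'cV[R[i]]_3) : c != 0 ->
  herm c z z = (4 / c)%:C ->
  exists a : 'cV[R[i]]_3, 0 < Re (herm c (cross c z a) (cross c z a)).
Proof.
move=> c0 /(congr1 (@complex.Re R)).
pose n i := Re (z i 0) ^+ 2 + Im (z i 0) ^+ 2.
have n0 i : 0 <= n i by rewrite addr_ge0// sqr_ge0.
have zE : Re (herm c z z) = Num.sg c * n 0 + n 1 + n ord_max.
  rewrite hermE /n; move: (z 0 0) (z 1 0) (z ord_max 0) (Num.sg c) => [a b] [a' b'] [d e] s.
  by rewrite /=; ring.
have D1 : Re (herm c (cross c z (delta_mx 1 0)) (cross c z (delta_mx 1 0))) =
    Num.sg c * n ord_max + n 0.
  rewrite (herm_cross _ _ c0) !hermE !mxE /= /n.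
  move: (z 0 0) (z 1 0) (z ord_max 0) => [a b] [a' b'] [d e].
  by move: c0; 
   rewrite neq_lt => /orP[c0|c0]; rewrite ?(ltr0_sg c0) ?(gtr0_sg c0) /=; ring.
have D2 : Re (herm c (cross c z (delta_mx ord_max 0)) (cross c z (delta_mx ord_max 0))) =
    Num.sg c * n 1 + n 0.
  rewrite (herm_cross _ _ c0) !hermE !mxE /= /n.
  move: (z 0 0) (z 1 0) (z ord_max 0) => [a b] [a' b'] [d e].
  by move: c0; rewrite neq_lt => /orP[c0|c0]; rewrite ?(ltr0_sg c0) ?(gtr0_sg c0) /=; ring.
rewrite zE /= => E.
move: (n0 0) (n0 1) (n0 ord_max) => h0 h1 h2.
move: (c0); rewrite neq_lt => /orP[cn|cp].
  exists (delta_mx 1 0); rewrite D1; move: E; rewrite !ltr0_sg// => E.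
  have : 4 / c < 0 by rewrite pmulr_rlt0// invr_lt0.
  by lra.
have c4 : 0 < 4 / c by rewrite divr_gt0.
move: E D1 D2; rewrite !gtr0_sg// => E D1 D2.
have [p|p] := ltP 0 (n ord_max + n 0).
  by exists (delta_mx 1 0); rewrite D1; lra.
by exists (delta_mx ord_max 0); rewrite D2; lra.
Qed.

(** * Unitary frames along a map to M_2(c) *)

Definition smooth_cv R (V : set 'rV[R]_3) (z : 'rV[R]_3 -> 'cV[R[i]]_3) :=
  forall i, smoothC V (fun x => z x i 0).

Lemma smoothC_opp R (U : set 'rV[R]_3) f : open U ->
  smoothC U f -> smoothC U (fun x => - f x).
Proof.
move=> oU fs; have S := smoothC_mul oU (smoothC_cst (-1) oU) fs.
by apply: smoothC_ext S => // x _; rewrite mulN1r.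
Qed.

Lemma smooth_cv_scale R (V : set 'rV[R]_3) (t : 'rV[R]_3 -> R) z : open V ->
  smooth V t -> smooth_cv V z -> smooth_cv V (fun x => (t x)%:C *: z x).
Proof.
move=> oV ts zs i; have S := smoothC_mul oV (smoothC_real oV ts) (zs i).
by apply: smoothC_ext S => // x _; rewrite [RHS]mxE.
Qed.

Lemma smoothC_herm R (c : R) (V : set 'rV[R]_3) z w : open V ->
  smooth_cv V z -> smooth_cv V w -> smoothC V (fun x => herm c (z x) (w x)).
Proof.
move=> oV zs ws.
have T i (a : R[i]) : smoothC V (fun x => a * z x i 0 * conjc (w x i 0)).
  apply: smoothC_mul => //; last exact: smoothC_conj.
  by apply: smoothC_mul => //; exact: smoothC_cst.
have S := smoothC_add oV (smoothC_add oV (T 0 (Num.sg c)%:C) (T 1 1)) (T ord_max 1).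
by apply: smoothC_ext S => // x _; rewrite hermE !mul1r.
Qed.

Lemma smooth_cross R (c : R) (V : set 'rV[R]_3) z w : open V ->
  smooth_cv V z -> smooth_cv V w -> smooth_cv V (fun x => cross c (z x) (w x)).
Proof.
move=> oV zs ws.
have T i j k l (a : R[i]) : smoothC V (fun x => a * conjc (z x i 0 * w x j 0 - z x k 0 * w x l 0)).
  apply: smoothC_mul => //; first exact: smoothC_cst.
  apply: smoothC_conj => //; apply: smoothC_add => //; first exact: smoothC_mul.
  by apply: smoothC_opp => //; exact: smoothC_mul.
apply: ord3P.
- by apply: smoothC_ext (T 1 ord_max ord_max 1 (Num.sg c)%:C) => // x _; rewrite [RHS]mxE.
- by apply: smoothC_ext (T ord_max 0 0 ord_max 1) => // x _; rewrite mul1r [RHS]mxE.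
- by apply: smoothC_ext (T 0 1 1 0 1) => // x _; rewrite mul1r [RHS]mxE.
Qed.

Lemma hermZr R (c : R) (t : R) (z w : 'cV[R[i]]_3) :
  herm c (t%:C *: z) w = t%:C * herm c z w.
Proof. by rewrite -[w in LHS]scale1r hermZ [conjc 1]rmorph1 mulr1. Qed.

Lemma hermZl R (c : R) (t : R) (z w : 'cV[R[i]]_3) :
  herm c z (t%:C *: w) = t%:C * herm c z w.
Proof. by rewrite -[z in LHS]scale1r hermZ mul1r; congr (_ * _); apply/cplxP; rewrite //= oppr0. Qed.

(** Normalize [e1 = cross z a] and take for [e2] the multiple
   [sqrt |k| cross z e1], which has norm 1 by [herm_cross]. *)
Lemma complete_frame R (c : R) (V : set 'rV[R]_3) z (a : 'cV[R[i]]_3) :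
  c != 0 -> open V -> smooth_cv V z ->
  (forall x, V x -> herm c (z x) (z x) = (4 / c)%:C) ->
  (forall x, V x -> 0 < Re (herm c (cross c (z x) a) (cross c (z x) a))) ->
  exists Phi, [/\ smooth_mx V Phi, forall x, V x -> unit_frame c (Phi x) &
    forall x i, Phi x i 0 = z x i 0].
Proof.
move=> c0 oV zs zz D.
pose y0 x := cross c (z x) a.
pose d x := Re (herm c (y0 x) (y0 x)).
have y0s : smooth_cv V y0 by apply: smooth_cross => // i; exact: smoothC_cst.
have ds : smooth V d by apply: smooth_Re; exact: smoothC_herm.
pose s x := (Num.sqrt (d x))^-1.
have ss : smooth V s.
  apply: smooth_inv => //; last exact: smooth_sqrt.
  by move=> x Vx; rewrite gt_eqF// sqrtr_gt0; exact: D.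
pose y x := (s x)%:C *: y0 x.
have ys : smooth_cv V y by exact: smooth_cv_scale.
have yy x : V x -> herm c (y x) (y x) = 1.
  move=> Vx; rewrite hermZr hermZl herm_real -!rmorphM /= -/(d x).
  have -> : s x * (s x * d x) = 1; last by [].
  have d0 := D x Vx; rewrite mulrA -invfM -expr2 sqr_sqrtr; last exact: ltW.
  by rewrite mulVf// gt_eqF.
have yz x : herm c (y x) (z x) = 0 by rewrite hermZr herm_crossl// mulr0.
(* [t^2 = |k|] *)
pose t := Num.sqrt (Num.sg c * c / 4).
have t2 : t * t = Num.sg c * c / 4.
  rewrite -expr2 sqr_sqrtr// -normrEsg.
  by rewrite divr_ge0.
pose w x := t%:C *: cross c (z x) (y x).
have ws : smooth_cv V w by apply: smooth_cv_scale => //; [exact: smooth_cst|exact: smooth_cross].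
have zy x : herm c (z x) (y x) = 0 by rewrite herm_conj yz rmorph0.
exists (fun x => frame_mx (z x) (y x) (w x)); split.
- move=> i j; move: j; apply: ord3P.
  + by apply: smoothC_ext (zs i) => // x _; rewrite [RHS]mxE.
  + by apply: smoothC_ext (ys i) => // x _; rewrite [RHS]mxE.
  + by apply: smoothC_ext (ws i) => // x _; rewrite [RHS]mxE.
- move=> x Vx; apply: unit_frame_mx => //.
  + exact: zz.
  + exact: yy.
  + rewrite hermZr hermZl herm_cross// zy mul0r subr0 zz// yy// mulr1 -!rmorphM.
    rewrite mulrA t2; suff -> : Num.sg c * c / 4 * (Num.sg c * (4 / c)) = 1 by [].
    have : Num.sg c * Num.sg c = 1 by rewrite -expr2 sqr_sg c0.
    move: (Num.sg c) => e e2.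
    by rewrite (_ : _ * _ = e * e); [|field].
  + by rewrite hermZr herm_crossl// mulr0.
  + by rewrite hermZr herm_crossr// mulr0.
- by move=> x i; rewrite mxE.
Qed.

Lemma frame_line_proj R (c : R) (Phi : 'M[R[i]]_3) (z : 'cV[R[i]]_3) :
  herm c z z = (4 / c)%:C -> (forall i, Phi i 0 = z i 0) ->
  Phi *m e00 R *m frinv c Phi = line_proj c z.
Proof.
move=> zz Pz.
have -> : Phi *m e00 R *m frinv c Phi = (c / 4)%:C *: (z *m adjmx z *m herm_mx c).
  rewrite frinvE !mulmxA scalemxAl; congr (_ *m _).
  apply/matrixP => i j; rewrite -mulmxA !mul_diag_mx -[LHS]/(_ i j).
  rewrite mulmx3 !mul_e00 /= !mxE /= !mulr0n !mul0r !addr0 mulr1n big_ord1 !mxE !Pz.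
  by rewrite mulrCA.
rewrite /line_proj zz; congr (_ *: _).
by rewrite -[(4 / c)%:C]/(real_complex R (4 / c)) -fmorphV invf_div.
Qed.

Lemma line_projZ R (c : R) (a : R[i]) (z : 'cV[R[i]]_3) : a != 0 ->
  line_proj c (a *: z) = line_proj c z.
Proof.
move=> a0; rewrite /line_proj hermZ.
have -> : adjmx (a *: z) = conjc a *: adjmx z.
  by apply/matrixP => i j; rewrite !mxE conjcM.
have a'0 : conjc a != 0 by rewrite conjc_eq0.
rewrite -scalemxAl -scalemxAr -!scalemxAl !scalerA; congr (_ *: _).
have aa : a * conjc a != 0 by rewrite mulf_neq0.
by rewrite [_ * herm c z z]mulrC invfM -mulrA mulVf ?mulr1.
Qed.

(** Near [x0] the line [f x] is spanned by [f x *m w0], where [w0] spans [f x0];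
   this vector depends smoothly on [x]. *)
Lemma frame_exists R (c : R) (U : set 'rV[R]_3) (f : 'rV[R]_3 -> 'M[R[i]]_3) x0 :
  c != 0 -> open U -> U x0 -> smooth_mx U f -> (forall x, U x -> M2 c (f x)) ->
  exists V Phi, [/\ open V, V x0, V `<=` U, smooth_mx V Phi &
    (forall x, V x -> unit_frame c (Phi x)) /\
    (forall x, V x -> f x = Phi x *m e00 R *m frinv c (Phi x))].
Proof.
move=> c0 oU Ux0 fs fM.
have [w0 [w0p fx0]] := fM x0 Ux0.
pose z0 x := f x *m w0.
have z0s : smooth_cv U z0.
  move=> i; have S : smoothC U (fun x => \sum_j f x i j * w0 j 0).
    by apply: smoothC_sum => // j; apply: smoothC_mul => //; exact: smoothC_cst.
  by apply: smoothC_ext S => // x _; rewrite [RHS]mxE.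
pose h x := Num.sg c * Re (herm c (z0 x) (z0 x)).
have hs : smooth U h.
  apply: smooth_mul => //; first exact: smooth_cst.
  by apply: smooth_Re; exact: smoothC_herm.
have herm0 z : 0 < Num.sg c * Re (herm c z z) -> herm c z z != 0.
  by move=> p; apply/eqP => E; move: p; rewrite E /= mulr0 ltxx.
pose V1 := [set x | U x /\ 0 < h x].
have oV1 : open V1 by exact: open_gt0.
have V1x0 : V1 x0.
  split=> //; rewrite /h /z0 fx0 line_projz//; exact: herm0.
have V1U : V1 `<=` U by move=> x [].
have fz0 x : V1 x -> f x = line_proj c (z0 x).
  move=> [Ux hx]; have [w [wp fx]] := fM x Ux.
  have z0w : z0 x = ((herm c w w)^-1 * (adjmx w *m herm_mx c *m w0) 0 0) *: w.
    rewrite /z0 fx /line_proj -scalemxAl -!mulmxA -scalerA; congr (_ *: _).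
    by rewrite {1}[adjmx w *m _]mx11_scalar mul_mx_scalar.
  rewrite z0w line_projZ//; apply/eqP => l0; move: hx; rewrite /h z0w l0 scale0r.
  by rewrite hermE !mxE !mulr0 !mul0r !addr0 mulr0 ltxx.
pose s x := (Num.sqrt ((c * Num.sg c) / 4 * h x))^-1.
have cs : 0 < c * Num.sg c by rewrite mulrC -normrEsg normr_gt0.
have sp x : V1 x -> 0 < (c * Num.sg c) / 4 * h x.
  by move=> [_ hx]; rewrite mulr_gt0// divr_gt0.
have ss : smooth V1 s.
  apply: smooth_inv => //; first by move=> x V1x; rewrite gt_eqF// sqrtr_gt0; exact: sp.
  apply: smooth_sqrt => //; apply: smooth_mul => //; first exact: smooth_cst.
  exact: smooth_restr V1U hs.
pose z x := (s x)%:C *: z0 x.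
have zs : smooth_cv V1 z.
  by apply: smooth_cv_scale => // i; exact: smoothC_restr V1U (z0s i).
have s0 x : V1 x -> s x != 0 by move=> V1x; rewrite gt_eqF// invr_gt0 sqrtr_gt0; exact: sp.
have zz x : V1 x -> herm c (z x) (z x) = (4 / c)%:C.
  move=> V1x; rewrite hermZr hermZl herm_real -!rmorphM /=; congr (_%:C).
  have p := sp x V1x; rewrite mulrA -invfM -expr2 sqr_sqrtr; last exact: ltW.
  have e2 : Num.sg c * Num.sg c = 1 by rewrite -expr2 sqr_sg c0.
  have : h x != 0 by case: V1x => _ /lt0r_neq0.
  rewrite /h; move: (Re _) (Num.sg c) e2 => r e e2 er0.
  have /norP[e0 r0] : ~~ ((e == 0) || (r == 0)) by rewrite -mulf_eq0.
  rewrite (_ : _ * r = 4 / c / (e * e)); first by rewrite e2 divr1.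
  by field; rewrite c0 r0 e0.
have fz x : V1 x -> f x = line_proj c (z x).
  move=> V1x; apply: etrans (fz0 x V1x) _; apply/esym; apply: line_projZ.
  by apply/eqP => -[E]; move: (s0 x V1x); rewrite E eqxx.
have [a ap] := cross_pos c0 (zz x0 V1x0).
pose d x := Re (herm c (cross c (z x) a) (cross c (z x) a)).
have ds : smooth V1 d.
  apply: smooth_Re; apply: smoothC_herm => //; apply: smooth_cross => // i; exact: smoothC_cst.
pose V := [set x | V1 x /\ 0 < d x].
have oV : open V by exact: open_gt0.
have VV1 : V `<=` V1 by move=> x [].
have zsV : smooth_cv V z by move=> i; exact: smoothC_restr VV1 (zs i).
have zzV x : V x -> herm c (z x) (z x) = (4 / c)%:C by move=> Vx; exact: zz (VV1 _ Vx).
have dV x : V x -> 0 < Re (herm c (cross c (z x) a) (cross c (z x) a)) by case.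
have [Phi [Ps uP Pz]] := complete_frame c0 oV zsV zzV dV.
exists V, Phi; split.
- exact: oV.
- exact: (conj V1x0 ap).
- by move=> x /VV1 /V1U.
- exact: Ps.
split; first exact: uP.
move=> x Vx; have V1x := VV1 x Vx.
apply: etrans (fz x V1x) _; apply/esym.
exact: (frame_line_proj (zz x V1x) (Pz x)).
Qed.

(** * Change of frame *)

(** Changes of unitary frame that keep [z] and act on [(e1, e2)]. *)
Definition gauge_mx R (a b d e : R[i]) : 'M[R[i]]_3 :=
  \matrix_(i, j) match nat_of_ord i, nat_of_ord j with
    | 0%N, 0%N => 1 | 1%N, 1%N => a | 2%N, 1%N => b | 1%N, 2%N => d | 2%N, 2%N => e
    | _, _ => 0 end.

Lemma addmxE (T : nmodType) m n (A B : 'M[T]_(m, n)) i j : (A + B) i j = A i j + B i j.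
Proof. by rewrite mxE. Qed.

Section Gauge.
Context (R : realType) (c : R) (c0 : c != 0) (V : set 'rV[R]_3) (oV : open V).
Context (f Phi : 'rV[R]_3 -> 'M[R[i]]_3) (Ps : smooth_mx V Phi).
Context (uP : forall x, V x -> unit_frame c (Phi x)).
Context (fE : forall x, V x -> f x = Phi x *m e00 R *m frinv c (Phi x)).
Context (a b d e : 'rV[R]_3 -> R[i]).
Context (sa : smoothC V a) (sb : smoothC V b) (sd : smoothC V d) (se : smoothC V e).
Context (aa : forall x, V x -> conjc (a x) * a x + conjc (b x) * b x = 1).
Context (dd : forall x, V x -> conjc (d x) * d x + conjc (e x) * e x = 1).
Context (ad : forall x, V x -> conjc (a x) * d x + conjc (b x) * e x = 0).

Let U x := gauge_mx (a x) (b x) (d x) (e x).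
Definition gauge x := Phi x *m U x.

Lemma smooth_gauge_mx : smooth_mx V U.
Proof.
move=> i j; rewrite -/(smoothC V (fun x => U x i j)).
move: i j; apply: ord3P; apply: ord3P;
  [apply: smoothC_ext (smoothC_cst 1 oV)|apply: smoothC_ext (smoothC_cst 0 oV)
  |apply: smoothC_ext (smoothC_cst 0 oV)|apply: smoothC_ext (smoothC_cst 0 oV)
  |apply: smoothC_ext sa|apply: smoothC_ext sd|apply: smoothC_ext (smoothC_cst 0 oV)
  |apply: smoothC_ext sb|apply: smoothC_ext se] => // x _; by rewrite [RHS]mxE.
Qed.

Lemma smooth_gauge : smooth_mx V gauge.
Proof. exact: smooth_mx_mul oV Ps smooth_gauge_mx. Qed.

Lemma adj_gauge_mx x : V x -> adjmx (U x) *m U x = 1%:M.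
Proof.
move=> Vx; have da : conjc (d x) * a x + conjc (e x) * b x = 0.
  have := congr1 (@conjc R) (ad Vx).
  move: (a x) (b x) (d x) (e x) => [a1 a2] [b1 b2] [d1 d2] [e1 e2] [] E1 E2.
  by apply/cplxP; rewrite /=; lra.
move: (aa Vx) (dd Vx) (ad Vx) da; rewrite /U.
move: (a x) (b x) (d x) (e x) => a' b' d' e' h1 h2 h3 h4.
apply/matrixP; apply: ord3P; apply: ord3P; rewrite mulmx3 !mxE /= ?mulr1n ?mulr0n;
  by rewrite ?oppr0 ?(mulr0, mul0r, mulr1, addr0, add0r).
Qed.

Lemma Kinv_gauge x : Kinv c *m adjmx (U x) = adjmx (U x) *m Kinv c.
Proof.
rewrite /U; move: (a x) (b x) (d x) (e x) => a' b' d' e'.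
apply/matrixP; apply: ord3P; apply: ord3P; rewrite mul_diag_mx mul_mx_diag !mxE /=;
  by rewrite ?oppr0 ?(mulr0, mul0r, mulr1, mul1r).
Qed.

Lemma frinv_gauge x : frinv c (gauge x) = adjmx (U x) *m frinv c (Phi x).
Proof. by rewrite !frinvE adjmxM !mulmxA Kinv_gauge. Qed.

Lemma gauge_unit x : V x -> unit_frame c (gauge x).
Proof.
move=> Vx.
have e1 : frinv c (gauge x) *m gauge x = 1%:M.
  rewrite frinv_gauge /gauge -!mulmxA (mulmxA (frinv _ _)) frinvM ?mul1mx ?adj_gauge_mx//.
  exact: uP.
have := congr1 (mulmx (Kmx c)) e1; rewrite mulmxA Kfrinv// mulmx1.
by [].
Qed.

Lemma gauge_f x : V x -> f x = gauge x *m e00 R *m frinv c (gauge x).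
Proof.
move=> Vx; apply: etrans (fE Vx) _; rewrite frinv_gauge /gauge -!mulmxA; congr (_ *m _); rewrite !mulmxA.
have UU : U x *m adjmx (U x) = 1%:M by apply: mulmx1C; exact: adj_gauge_mx.
have <- : e00 R *m U x = U x *m e00 R.
  apply/matrixP => i j; rewrite mul_e00 e00_mul /U.
  by move: i j; apply: ord3P; apply: ord3P; rewrite !mxE.
by rewrite -[in RHS](mulmxA (e00 R)) UU mulmx1.
Qed.

(** The transformation rule of a connection form, [u^-1 O u + u^-1 du]. *)
Lemma Om_gauge x v : V x ->
  Om c gauge x v = adjmx (U x) *m (Om c Phi x v *m U x + Dmx U x v).
Proof.
move=> Vx; rewrite !OmE frinv_gauge (Dmx_mul _ oV Ps smooth_gauge_mx Vx).
rewrite -!mulmxA; congr (_ *m _); rewrite mulmxDr !mulmxA frinvM ?mul1mx//.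
exact: uP.
Qed.

Lemma DU x v i j (w : R[i]) : (forall y, U y i j = w) -> Dmx U x v i j = 0.
Proof. by move=> h; rewrite DmxE (_ : (fun y => U y i j) = fun=> w) ?DC_cst//; apply/funext. Qed.

Lemma DU0 x v i : Dmx U x v i 0 = 0.
Proof.
move: i; apply: ord3P;
  [apply: (@DU x v _ _ 1)|apply: (@DU x v _ _ 0)|apply: (@DU x v _ _ 0)] => y; by rewrite mxE.
Qed.

Lemma gauge_p x v : V x ->
  Om c gauge x v 1 0 = conjc (a x) * Om c Phi x v 1 0 + conjc (b x) * Om c Phi x v ord_max 0.
Proof.
move=> Vx; rewrite Om_gauge// mulmx3 !addmxE.
rewrite !DU0.
rewrite !mulmx3; move: (Om c Phi x v) => O.
by rewrite !mxE /= oppr0 ?(mulr0, mul0r, mulr1, addr0, add0r).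
Qed.

Lemma gauge_q x v : V x ->
  Om c gauge x v ord_max 0 = conjc (d x) * Om c Phi x v 1 0 + conjc (e x) * Om c Phi x v ord_max 0.
Proof.
move=> Vx; rewrite Om_gauge// mulmx3 !addmxE.
rewrite !DU0.
rewrite !mulmx3; move: (Om c Phi x v) => O.
by rewrite !mxE /= oppr0 ?(mulr0, mul0r, mulr1, addr0, add0r).
Qed.

Lemma gauge_r x v : (forall y, a y = 1) -> (forall y, b y = 0) -> (forall y, d y = 0) -> V x ->
  Om c gauge x v ord_max 1 = conjc (e x) * Om c Phi x v ord_max 1.
Proof.
move=> a1 b0 d0 Vx; rewrite Om_gauge// mulmx3 !addmxE.
have D0 i : Dmx U x v i 1 = 0.
  move: i; apply: ord3P;
    [apply: (@DU x v _ _ 0)|apply: (@DU x v _ _ 1)|apply: (@DU x v _ _ 0)] => y; by rewrite mxE /= ?a1 ?b0.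
rewrite !D0 !mulmx3; move: (Om c Phi x v) => O.
rewrite !mxE /= a1 b0 d0 ?oppr0 (rmorph0 (@conjc R)).
by rewrite ?(mulr0, mul0r, mulr1, addr0, add0r).
Qed.
End Gauge.

(** * The unit normal *)

Lemma skew3_eq0 R (o : 'I_3 -> 'I_3 -> R) : (forall i j, o i j = - o j i) ->
  o 1 ord_max = 0 -> o ord_max 0 = 0 -> o 0 1 = 0 -> forall i j, o i j = 0.
Proof.
move=> oC h0 h1 h2.
have od i : o i i = 0 by have := oC i i; lra.
by apply: ord3P; apply: ord3P; rewrite ?od ?h0 ?h1 ?h2 // oC ?h0 ?h1 ?h2 oppr0.
Qed.

Lemma Re_conjC R (a b a' b' : R[i]) :
  Re (a * conjc b + a' * conjc b') = Re (conjc a * b + conjc a' * b').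
Proof. by move: a b a' b' => [a1 a2] [b1 b2] [d1 d2] [e1 e2] /=; ring. Qed.

Lemma Om_lin3 R (c : R) (V : set 'rV[R]_3) Phi x v i j : open V -> smooth_mx V Phi -> V x ->
  Om c Phi x v i j = (v 0 0)%:C * Om c Phi x (e_ R 0) i j + (v 0 1)%:C * Om c Phi x (e_ R 1) i j
    + (v 0 ord_max)%:C * Om c Phi x (e_ R ord_max) i j.
Proof. by move=> oV Ps Vx; apply: etrans (Om_lin c v i j oV Ps Vx) _; exact: sum3. Qed.

(** Multiplication by [i] maps the kernel of the Kaehler form restricted to a
   real hyperplane to the normal line of the hyperplane; the kernel of an
   antisymmetric form in dimension 3 is spanned by the vector of its
   coefficients. *)
Lemma normal_perp R (a b d a' b' d' : R[i]) (v0 v1 v2 : R) :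
  let om x x' y y' : R := Im (conjc x * y + conjc x' * y') in
  let n x y z : R[i] := 'i * ((om b b' d d')%:C * x + (om d d' a a')%:C * y + (om a a' b b')%:C * z) in
  Re (conjc (n a b d) * (v0%:C * a + v1%:C * b + v2%:C * d)
            + conjc (n a' b' d') * (v0%:C * a' + v1%:C * b' + v2%:C * d')) = 0.
Proof.
move: a b d a' b' d' => [a1 a2] [b1 b2] [d1 d2] [a1' a2'] [b1' b2'] [d1' d2'] /=.
by ring.
Qed.

Definition row3 R (a b d : R) : 'rV[R]_3 :=
  \row_j (if j == 0 then a else if j == 1 then b else d).

Lemma row30 R (a b d : R) : row3 a b d 0 0 = a.
Proof. by rewrite mxE. Qed.

Lemma row31 R (a b d : R) : row3 a b d 0 1 = b.
Proof. by rewrite mxE. Qed.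

Lemma row32 R (a b d : R) : row3 a b d 0 ord_max = d.
Proof. by rewrite mxE. Qed.

Lemma Re_scale R (t : R) (a b p q : R[i]) :
  Re (conjc a * p + conjc b * q) = 0 ->
  Re (conjc (t%:C * a) * p + conjc (t%:C * b) * q) = 0.
Proof.
move: a b p q => [a1 a2] [b1 b2] [p1 p2] [q1 q2] /= /(congr1 ( *%R t)).
by rewrite mulr0 => E; apply: etrans E; ring.
Qed.

Section Normal.
Context (R : realType) (c : R) (c0 : c != 0) (V : set 'rV[R]_3) (oV : open V).
Context (f Phi : 'rV[R]_3 -> 'M[R[i]]_3) (Ps : smooth_mx V Phi).
Context (uP : forall x, V x -> unit_frame c (Phi x)).
Context (fE : forall x, V x -> f x = Phi x *m e00 R *m frinv c (Phi x)).
Context (imm : forall x v, V x -> Dmx f x v = 0 -> v = 0).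

Let p x j := Om c Phi x (e_ R j) 1 0.
Let q x j := Om c Phi x (e_ R j) ord_max 0.
Let om x i j := Im (conjc (p x i) * p x j + conjc (q x i) * q x j).

Lemma smooth_om i j : smooth V (fun x => om x i j).
Proof.
have O k := Om_smooth c oV Ps (smooth_e oV k).
apply: smooth_Im; apply: smoothC_add => //; apply: smoothC_mul => //; try apply: smoothC_conj => //;
  [exact: (O i 1 0)|exact: (O j 1 0)|exact: (O i ord_max 0)|exact: (O j ord_max 0)].
Qed.

Lemma Df_kernel x v : V x -> Om c Phi x v 1 0 = 0 -> Om c Phi x v ord_max 0 = 0 -> v = 0.
Proof.
move=> Vx p0 q0; apply: (imm Vx); rewrite (Df_frame c0 oV Ps uP fE v Vx) /qf p0 q0.
have -> : tmx c 0 0 = 0.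
  apply/matrixP; apply: ord3P; apply: ord3P; rewrite !mxE //=; apply/cplxP; rewrite /=; ring.
by rewrite mulmx0 mul0mx.
Qed.

(** A real subspace of dimension 3 of [C^2] is not totally real: otherwise the
   real Gram matrix of three independent vectors would be the Hermitian one,
   whose rank is at most 2. *)
Lemma om_neq0 x : V x -> ~ (om x 1 ord_max = 0 /\ om x ord_max 0 = 0 /\ om x 0 1 = 0).
Proof.
move=> Vx [h0 [h1 h2]].
have omC i j : om x i j = - om x j i.
  rewrite /om; move: (p x i) (p x j) (q x i) (q x j) => [a1 a2] [b1 b2] [d1 d2] [e1 e2] /=; ring.
have om0 := skew3_eq0 omC h0 h1 h2.
pose A : 'M[R[i]]_(3, 2) := \matrix_(i, j) if j == 0 then conjc (p x i) else conjc (q x i).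
have AE i j : (A *m adjmx A) i j = conjc (p x i) * p x j + conjc (q x i) * q x j.
  by rewrite [LHS]mxE big_ord_recl big_ord1; congr (_ * _ + _ * _); rewrite !mxE /= ?conjcK.
have gE : map_mx (real_complex R) (gram c f x) = A *m adjmx A.
  apply/matrixP => i j; rewrite [LHS]mxE AE [gram _ _ _ _ _]mxE.
  rewrite !(Df_frame c0 oV Ps uP fE _ Vx) (kmetric_tmx _ _ _ _ c0 (uP Vx)).
  apply/cplxP; last exact: esym (om0 i j).
  exact: (Re_conjC (p x i) (p x j) (q x i) (q x j)).
have /negP nu : gram c f x \notin unitmx.
  rewrite -(map_unitmx (real_complex R)) gE -row_free_unit /row_free.
  apply/eqP => r3; have := leq_trans (mxrankM_maxl A (adjmx A)) (rank_leq_col A).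
  by rewrite r3.
apply: nu; rewrite -row_free_unit -kermx_eq0; apply/rowV0P => v /sub_kermxP vG.
have : kmetric c (Dmx f x v) (Dmx f x v) = 0.
  have fs : smooth_mx V f.
    have S := smooth_mx_mul oV (smooth_mx_mul oV Ps (smooth_mx_cst (e00 R) oV)) (smooth_frinv c oV Ps).
    by apply: smooth_mx_ext S => // y Vy; rewrite (fE Vy).
  rewrite {2}(Dmx_lin v oV fs Vx) kmetric_sumr big1// => m _.
  rewrite kmetricZr (Dmx_lin v oV fs Vx) kmetric_suml.
  rewrite (eq_bigr (fun i => v 0 i * gram c f x i m)); last first.
    by move=> i _; rewrite kmetricZl [gram _ _ _ _ _]mxE.
  by move/rowP/(_ m): vG; rewrite mxE => ->; rewrite mxE mulr0.
rewrite !(Df_frame c0 oV Ps uP fE _ Vx) (kmetric_tmx _ _ _ _ c0 (uP Vx)) /qf => E.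
apply: (Df_kernel Vx); move: E;
  move: (Om c Phi x v 1 0) (Om c Phi x v ord_max 0) => [a1 a2] [b1 b2] /= E;
  (have {E} : a1 ^+ 2 + a2 ^+ 2 + (b1 ^+ 2 + b2 ^+ 2) = 0 by rewrite -[RHS]E; ring);
  move/eqP; rewrite paddr_eq0 ?addr_ge0 ?sqr_ge0// !paddr_eq0 ?sqr_ge0// !sqrf_eq0;
  by case/andP => /andP[/eqP e1 /eqP e2] /andP[/eqP e3 /eqP e4]; rewrite ?e1 ?e2 ?e3 ?e4.
Qed.

(** Rotate [(e1, e2)] by the element of [SU(2)] taking [e1] to the unit normal. *)
Lemma adapted_exists x0 : V x0 -> exists W Psi, [/\ open W, W x0, W `<=` V & adapted c W f Psi].
Proof.
move=> Vx0.
pose w x := row3 (om x 1 ord_max) (om x ord_max 0) (om x 0 1).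
pose n1 x := 'i * Om c Phi x (w x) 1 0.
pose n2 x := 'i * Om c Phi x (w x) ord_max 0.
have ws : smooth_rv V w.
  by apply: ord3P; [apply: smooth_ext (smooth_om 1 ord_max)|apply: smooth_ext (smooth_om ord_max 0)
    |apply: smooth_ext (smooth_om 0 1)] => // x _;
    rewrite ?row30 ?row31 ?row32.
have Os := Om_smooth c oV Ps ws.
have n1s : smoothC V n1 by exact: (smoothC_mul oV (smoothC_cst _ oV) (Os 1 0)).
have n2s : smoothC V n2 by exact: (smoothC_mul oV (smoothC_cst _ oV) (Os ord_max 0)).
have nE x : V x ->
    n1 x = 'i * ((om x 1 ord_max)%:C * p x 0 + (om x ord_max 0)%:C * p x 1 + (om x 0 1)%:C * p x ord_max)
    /\ n2 x = 'i * ((om x 1 ord_max)%:C * q x 0 + (om x ord_max 0)%:C * q x 1 + (om x 0 1)%:C * q x ord_max).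
  move=> Vx.
  have w0 : w x 0 0 = om x 1 ord_max by exact: row30.
  have w1 : w x 0 1 = om x ord_max 0 by exact: row31.
  have w2 : w x 0 ord_max = om x 0 1 by exact: row32.
  by rewrite -w0 -w1 -w2; split; congr ('i * _); exact: (Om_lin3 c (w x) _ _ oV Ps Vx).
have n_perp x v : V x ->
    Re (conjc (n1 x) * Om c Phi x v 1 0 + conjc (n2 x) * Om c Phi x v ord_max 0) = 0.
  move=> Vx; have [e1 e2] := nE x Vx.
  move: (n1 x) (n2 x) e1 e2 => m1 m2 -> ->.
  have L1 := Om_lin3 c v 1 0 oV Ps Vx; have L2 := Om_lin3 c v ord_max 0 oV Ps Vx.
  apply: etrans (congr1 (@complex.Re R)
    (congr2 +%R (congr1 ( *%R _) L1) (congr1 ( *%R _) L2))) _.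
  exact: (normal_perp (p x 0) (p x 1) (p x ord_max) (q x 0) (q x 1) (q x ord_max)).
pose d x := Re (conjc (n1 x) * n1 x + conjc (n2 x) * n2 x).
have ds : smooth V d.
  apply: smooth_Re; apply: smoothC_add => //; apply: smoothC_mul => //; exact: smoothC_conj.
have dE x : d x = Re (n1 x) ^+ 2 + Im (n1 x) ^+ 2
    + (Re (n2 x) ^+ 2 + Im (n2 x) ^+ 2).
  by rewrite /d; move: (n1 x) (n2 x) => [a1 a2] [b1 b2] /=; ring.
have d0 x : V x -> 0 < d x.
  move=> Vx; rewrite lt_neqAle dE !addr_ge0 ?sqr_ge0// andbT eq_sym.
  apply/eqP => /eqP E; move: E.
  rewrite paddr_eq0 ?addr_ge0 ?sqr_ge0// !paddr_eq0 ?sqr_ge0// !sqrf_eq0.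
  case/andP => /andP[/eqP a1 /eqP a2] /andP[/eqP b1 /eqP b2].
  have iK (z : R[i]) : Re ('i * z) = 0 -> Im ('i * z) = 0 -> z = 0.
    by case: z => z1 z2 /= h1 h2; apply/cplxP; rewrite /=; lra.
  have w0 := Df_kernel Vx (iK _ a1 a2) (iK _ b1 b2).
  have z0 i : (0 : 'rV[R]_3) 0 i = 0 by rewrite mxE.
  move/rowP: w0 => w0; apply: (om_neq0 Vx); split; [|split].
  - exact: etrans (esym (row30 _ (om x ord_max 0) (om x 0 1))) (etrans (w0 0) (z0 0)).
  - exact: etrans (esym (row31 (om x 1 ord_max) _ (om x 0 1))) (etrans (w0 1) (z0 1)).
  - exact: etrans (esym (row32 (om x 1 ord_max) (om x ord_max 0) _)) (etrans (w0 ord_max) (z0 _)).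
pose s x := (Num.sqrt (d x))^-1.
have ss : smooth V s.
  apply: smooth_inv => //; last exact: smooth_sqrt.
  by move=> x Vx; rewrite gt_eqF// sqrtr_gt0 d0.
pose a x := (s x)%:C * n1 x. pose b x := (s x)%:C * n2 x.
have sa : smoothC V a by apply: smoothC_mul => //; exact: smoothC_real.
have sb : smoothC V b by apply: smoothC_mul => //; exact: smoothC_real.
have sd : smoothC V (fun x => - conjc (b x)).
  by apply: smoothC_opp => //; exact: smoothC_conj.
have se : smoothC V (fun x => conjc (a x)) by exact: smoothC_conj.
have s2 x : V x -> s x * s x * d x = 1.
  move=> Vx; rewrite -invfM -expr2 sqr_sqrtr ?mulVf// ?gt_eqF ?d0//.
  by apply: ltW; exact: d0.
have aa x : V x -> conjc (a x) * a x + conjc (b x) * b x = 1.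
  move=> /s2; rewrite dE /a /b; move: (s x) (n1 x) (n2 x) => t [a1 a2] [b1 b2] /= E.
  by apply/cplxP; rewrite /= -?E; ring.
have dd x : V x -> conjc (- conjc (b x)) * - conjc (b x) + conjc (conjc (a x)) * conjc (a x) = 1.
  move=> /aa; move: (a x) (b x) => [a1 a2] [b1 b2] [] E1 E2.
  by apply/cplxP; rewrite /=; lra.
have ad x : V x -> conjc (a x) * - conjc (b x) + conjc (b x) * conjc (a x) = 0.
  by move=> _; ring.
exists V, (gauge Phi a b (fun x => - conjc (b x)) (fun x => conjc (a x))).
split; [exact: oV|exact: Vx0|by []|split].
- exact: (smooth_gauge oV Ps sa sb sd se).
- exact: (gauge_unit c0 uP aa dd ad).
- exact: (gauge_f fE aa dd ad).
- move=> x v Vx; rewrite (gauge_p c0 oV Ps uP sa sb sd se v Vx).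
  exact: Re_scale (n_perp x v Vx).
Qed.
End Normal.

(** * Rotating the frame of the holomorphic distribution *)

Lemma adapted_restr R (c : R) (V W : set 'rV[R]_3) f Phi :
  W `<=` V -> adapted c V f Phi -> adapted c W f Phi.
Proof.
move=> WV [h1 h2 h3 h4]; split; first exact: smooth_mx_restr WV h1.
- by move=> x /WV; exact: h2.
- by move=> x /WV; exact: h3.
- by move=> x v /WV; exact: h4.
Qed.

Section Rotate.
Context (R : realType) (c : R) (c0 : c != 0) (V : set 'rV[R]_3) (oV : open V).
Context (f Phi : 'rV[R]_3 -> 'M[R[i]]_3) (ad : adapted c V f Phi).
Context (imm : forall x v, V x -> Dmx f x v = 0 -> v = 0).

Let r0 x := rf c Phi x (fr c Phi 0 x).
Context (r0n : forall x, V x -> r0 x != 0).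

Let Ps : smooth_mx V Phi. Proof. by case: ad. Qed.
Let uP x : V x -> unit_frame c (Phi x). Proof. by case: ad => _ + _ _; exact. Qed.
Let fE x : V x -> f x = Phi x *m e00 R *m frinv c (Phi x). Proof. by case: ad => _ _ + _; exact. Qed.
Let Re10 x v : V x -> Re (Om c Phi x v 1 0) = 0. Proof. by case: ad => _ _ _; exact. Qed.

(** Multiplying [e2] by a phase multiplies [rf] by the conjugate phase and leaves
   the structure field unchanged. *)
Lemma rotate_exists : exists Psi, adapted c V f Psi /\
  forall x, V x -> Im (rf c Psi x (fr c Psi 0 x)) = 0.
Proof.
have rs : smoothC V r0 := smooth_rf oV ad (smooth_fr c0 oV ad imm 0).
pose n x := Re (r0 x) * Re (r0 x) + Im (r0 x) * Im (r0 x).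
have ns : smooth V n.
  by case: rs => rs1 rs2; apply: smooth_add => //; exact: smooth_mul.
have n0 x : V x -> 0 < n x.
  move=> /r0n; rewrite /n; case: (r0 x) => a b /= ab.
  rewrite lt_neqAle addr_ge0 -?expr2 ?sqr_ge0// andbT eq_sym.
  apply: contra ab; rewrite paddr_eq0 ?sqr_ge0// !sqrf_eq0 => /andP[/eqP-> /eqP->].
  by [].
pose s x := (Num.sqrt (n x))^-1.
have ss : smooth V s.
  apply: smooth_inv => //; last exact: smooth_sqrt.
  by move=> x Vx; rewrite gt_eqF// sqrtr_gt0 n0.
pose la x := (s x)%:C * r0 x.
have sla : smoothC V la by exact: smoothC_mul oV (smoothC_real oV ss) rs.
have s1 := smoothC_cst (1 : R[i]) oV. have s0 := smoothC_cst (0 : R[i]) oV.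
have s2 x : V x -> s x * s x * n x = 1.
  move=> Vx; rewrite -invfM -expr2 sqr_sqrtr ?mulVf// ?gt_eqF ?n0//.
  by apply: ltW; exact: n0.
have aa x : V x -> conjc (1 : R[i]) * 1 + conjc (0 : R[i]) * 0 = 1 :> R[i].
  by move=> _; rewrite mulr0 addr0 mulr1; exact: rmorph1.
have dd x : V x -> conjc (0 : R[i]) * 0 + conjc (la x) * la x = 1 :> R[i].
  move=> /s2; rewrite /n /la; move: (s x) (r0 x) => t [a1 a2] /= E.
  by apply/cplxP; rewrite /= -?E; ring.
have adl x : V x -> conjc (1 : R[i]) * 0 + conjc (0 : R[i]) * la x = 0.
  by move=> _; rewrite mulr0 add0r (rmorph0 (@conjc R)) mul0r.
pose Psi := gauge Phi (fun=> 1) (fun=> 0) (fun=> 0) la.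
have pE x v : V x -> Om c Psi x v 1 0 = Om c Phi x v 1 0.
  move=> Vx; apply: etrans (gauge_p c0 oV Ps uP s1 s0 s0 sla v Vx) _.
  by rewrite (rmorph0 (@conjc R)) (rmorph1 (@conjc R)) mul0r addr0 mul1r.
have qE x v : V x -> Om c Psi x v ord_max 0 = conjc (la x) * Om c Phi x v ord_max 0.
  move=> Vx; apply: etrans (gauge_q c0 oV Ps uP s1 s0 s0 sla v Vx) _.
  by rewrite (rmorph0 (@conjc R)) mul0r add0r.
have rE x v : V x -> Om c Psi x v ord_max 1 = conjc (la x) * Om c Phi x v ord_max 1.
  by move=> Vx; exact: (gauge_r c0 oV Ps uP s1 s0 s0 sla v _ _ _ Vx).
have adP : adapted c V f Psi.
  split.
  - exact: (smooth_gauge oV Ps s1 s0 s0 sla).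
  - exact: (gauge_unit c0 uP aa dd adl).
  - exact: (gauge_f fE aa dd adl).
  - by move=> x v Vx; rewrite (pE x v Vx); exact: Re10.
exists Psi; split => // x Vx.
have xiE : fr c Psi 0 x = fr c Phi 0 x.
  apply: (coframe_inj c0 oV adP imm Vx).
  apply: etrans (coframe_fr c0 oV adP imm 0 Vx) _; apply: etrans (esym (coframe_fr c0 oV ad imm 0 Vx)) _.
  have q0 := qf_xi c0 oV ad imm Vx.
  apply/rowP; apply: ord3P.
  - by rewrite !coframe0E pE.
  - by rewrite !coframe1E q0 /qf qE// -[Om _ _ _ _ _ _]/(qf c Phi x _) q0 mulr0.
  - by rewrite !coframe2E q0 /qf qE// -[Om _ _ _ _ _ _]/(qf c Phi x _) q0 mulr0.
rewrite xiE /rf (rE _ _ Vx) -[Om _ _ _ _ _ _]/(r0 x) /la.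
by move: (r0 x) (s x) => [a b] t /=; ring.
Qed.
End Rotate.

(** * Extending vector fields from a chart *)

Section Charts.
Context (R : realType) (M : topologicalType) (A : set (chart R M)) (sA : smooth_atlas A).

Let ch a : A a -> is_chart a. Proof. by case: sA => h _ _; exact: h. Qed.

Lemma ccod_open a : A a -> open (ccod a). Proof. by move=> /ch[[]]. Qed.
Lemma cdom_open a : A a -> open (cdom a). Proof. by move=> /ch[[]]. Qed.
Lemma cinvK a x : A a -> ccod a x -> cmap a (cinv a x) = x.
Proof. by move=> /ch[_ _ h _ _] /h[]. Qed.
Lemma cinv_dom a x : A a -> ccod a x -> cdom a (cinv a x).
Proof. by move=> /ch[_ _ h _ _] /h[]. Qed.
Lemma cmapK a p : A a -> cdom a p -> cinv a (cmap a p) = p.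
Proof. by move=> /ch[_ h _ _ _] /h[]. Qed.
Lemma cmap_cod a p : A a -> cdom a p -> ccod a (cmap a p).
Proof. by move=> /ch[_ h _ _ _] /h[]. Qed.
Lemma cinv_cont a x : A a -> ccod a x -> {for x, continuous (cinv a)}.
Proof. by move=> /ch[_ _ _ _ h] /h. Qed.

Lemma open_preim a (P : set M) : A a -> open P -> open (ccod a `&` (cinv a @^-1` P)).
Proof.
move=> Aa oP; rewrite openE => x [ax Px].
apply: filterI; first by apply: open_nbhs_nbhs; split => //; exact: ccod_open.
exact: (cinv_cont Aa ax) (open_nbhs_nbhs (conj oP Px)).
Qed.

Lemma overlap_open a b : A a -> A b -> open (overlap a b).
Proof. by move=> Aa Ab; apply: open_preim => //; exact: cdom_open. Qed.

Lemma transition_smooth a b : A a -> A b -> smooth_rv (overlap a b) (transition a b).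
Proof. by move=> Aa Ab; case: sA => _ _; exact. Qed.

Lemma overlap_self a : A a -> overlap a a = ccod a.
Proof.
by move=> Aa; apply/seteqP; split=> [x []//|x ax]; split => //; exact: cinv_dom.
Qed.

Lemma transition_overlap a b x : A a -> A b -> overlap a b x -> overlap b a (transition a b x).
Proof.
move=> Aa Ab [ax bx]; split; first exact: cmap_cod.
by rewrite /transition /= cmapK//; exact: cinv_dom.
Qed.

Lemma cinv_transition a b x : A a -> A b -> overlap a b x -> cinv b (transition a b x) = cinv a x.
Proof. by move=> Aa Ab [ax bx]; exact: cmapK. Qed.

Lemma transitionK a b x : A a -> A b -> overlap a b x -> transition b a (transition a b x) = x.
Proof.
move=> Aa Ab abx; rewrite {1}/transition /= cinv_transition//.
by apply: cinvK => //; case: abx.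
Qed.

Lemma transition_diff a b x : A a -> A b -> overlap a b x -> differentiable (transition a b) x.
Proof.
by move=> Aa Ab; exact: smooth_rv_diff (overlap_open Aa Ab) (transition_smooth Aa Ab).
Qed.

(** Chain rule for the cocycle of transition maps. *)
Lemma derive_transition_comp a b d x v : A a -> A b -> A d ->
  overlap a b x -> cdom d (cinv a x) ->
  'D_('D_v (transition a b) x) (transition b d) (transition a b x) = 'D_v (transition a d) x.
Proof.
move=> Aa Ab Ad abx dx.
have adx : overlap a d x by case: abx => ax _; split.
have bdx : overlap b d (transition a b x).
  by split; [case: (transition_overlap Aa Ab abx)|rewrite /preimage/= cinv_transition].
pose W := overlap a b `&` overlap a d.
have oW : open W by apply: openI; exact: overlap_open.
have dab := transition_diff Aa Ab abx.
have dbd := transition_diff Ab Ad bdx.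
have dad := transition_diff Aa Ad adx.
apply/rowP => i; rewrite (derive_rv _ _ dbd) (derive_rv _ _ dad).
have dbdi : differentiable (fun y => transition b d y 0 i) (transition a b x).
  exact: smooth_diff (overlap_open Ab Ad) (transition_smooth Ab Ad i) bdx.
apply: etrans (esym (derive_comp v dab dbdi)) _.
apply: (derive_ext _ oW (conj abx adx)) => y [aby ady] /=.
by rewrite /transition /= cmapK//; case: aby.
Qed.

(** The vector field on the manifold that is [Z] in the chart [a] and 0 outside its
   domain. *)
Definition pushfield (a : chart R M) (Z : 'rV[R]_3 -> 'rV[R]_3) (b : chart R M) (y : 'rV[R]_3) : 'rV[R]_3 :=
  if `[< cdom a (cinv b y) >] then
    'D_(Z (transition b a y)) (transition a b) (transition b a y)
  else 0.

Lemma pushfield_in a Z b x : A a -> A b -> overlap a b x ->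
  pushfield a Z b (transition a b x) = 'D_(Z x) (transition a b) x.
Proof.
move=> Aa Ab abx; rewrite /pushfield cinv_transition// transitionK//.
by case: asboolP => // nx; case: nx; case: abx => ax _; exact: cinv_dom.
Qed.

Lemma pushfield_self a Z x : A a -> ccod a x -> pushfield a Z a x = Z x.
Proof.
move=> Aa ax; have aax : overlap a a x by rewrite overlap_self.
have E y : ccod a y -> transition a a y = y by move=> ay; exact: cinvK.
rewrite -{1}(E x ax) pushfield_in//.
by rewrite (derive_ext _ (ccod_open Aa) ax E) derive_id.
Qed.

Context (hM : hausdorff_space M) (a : chart R M) (Aa : A a).
Context (Z : 'rV[R]_3 -> 'rV[R]_3) (K : set 'rV[R]_3).
Context (Zs : smooth_rv (ccod a) Z) (cK : compact K) (Ka : K `<=` ccod a).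
Context (Z0 : forall x, ~ K x -> Z x = 0).

(** A point of another chart either lies in the domain of [a], where the field is
   the image of [Z] under a transition map, or has a neighbourhood that avoids
   the image of [K]; this image is closed since the manifold is Hausdorff. *)
Lemma pushfield_smooth b : A b -> smooth_rv (ccod b) (pushfield a Z b).
Proof.
move=> Ab i; apply: smooth_local => y yb.
have oba := overlap_open Ab Aa.
have [ya|ya] := pselect (cdom a (cinv b y)).
  exists (overlap b a) => //.
  have oab := overlap_open Aa Ab.
  have s1 : smooth (overlap a b) (fun x => 'D_(Z x) (fun x => transition a b x 0 i) x).
    apply: (smooth_Dfield oab _ (transition_smooth Aa Ab i)) => j.
    by apply: smooth_restr (Zs j) => x [].
  have s2 := smooth_comp oab oba (fun y => transition_overlap Ab Aa) (transition_smooth Ab Aa) s1.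
  apply: (smooth_ext oba _ s2) => y' bay' /=.
  have aby' := transition_overlap Ab Aa bay'.
  apply: etrans (esym (derive_rv _ _ (transition_diff Aa Ab aby'))) _.
  by rewrite -(pushfield_in Z Aa Ab aby') (transitionK Ab Aa bay').
pose W := ccod b `&` (cinv b @^-1` (~` (cinv a @` K))).
have oW : open W.
  apply: open_preim => //; rewrite openC.
  apply: compact_closed => //; apply: continuous_compact => //.
  apply: continuous_in_subspaceT => x; rewrite inE => Kx.
  exact: (cinv_cont Aa (Ka Kx)).
exists W.
  by split => // -[x Kx xy]; apply: ya; rewrite -xy; apply: cinv_dom => //; exact: Ka.
have s0 := smooth_cst (0 : R) oW.
apply: (smooth_ext oW _ s0) => y' [by' nK]; rewrite /pushfield.
case: asboolP => [ay'|_]; last by rewrite mxE.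
rewrite Z0; first by rewrite derive0 mxE.
by move=> Kx; apply: nK; exists (transition b a y') => //; exact: cmapK.
Qed.

Lemma pushfield_vector_field : vector_field A (pushfield a Z).
Proof.
split; first exact: pushfield_smooth.
move=> b d y Ab Ad bdy.
have [ay|ay] := pselect (cdom a (cinv b y)); last first.
  rewrite /pushfield cinv_transition//.
  have -> : `[< cdom a (cinv b y) >] = false by apply/negbTE/asboolPn.
  by rewrite derive0.
pose x := transition b a y.
have bay : overlap b a y by split => //; case: bdy.
have abx : overlap a b x := transition_overlap Ab Aa bay.
have xy : transition a b x = y := transitionK Ab Aa bay.
have ax : cinv a x = cinv b y := cinv_transition Ab Aa bay.
have adx : cdom d (cinv a x) by rewrite ax; case: bdy.
have bdx : transition b d y = transition a d x by rewrite /transition /= ax.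
have adx' : overlap a d x by split => //; case: abx.
have Zb : pushfield a Z b y = 'D_(Z x) (transition a b) x.
  by rewrite -(pushfield_in Z Aa Ab abx) xy.
rewrite bdx (pushfield_in Z Aa Ad adx') Zb -(derive_transition_comp _ Aa Ab Ad abx adx).
by rewrite xy.
Qed.

End Charts.

(** * Structure field of an adapted frame *)

(** [J] is skew for the metric. *)
Lemma kmetric_cstruct R (c : R) (P X Y : 'M[R[i]]_3) :
  kmetric c X (cstruct P Y) = - kmetric c (cstruct P X) Y.
Proof.
suff E : \tr (X *m cstruct P Y) = - \tr (cstruct P X *m Y) by rewrite /kmetric E cReN mulrN.
rewrite /cstruct -scalemxAr -scalemxAl !mxtraceZ -[RHS]mulrN.
congr (_ * _).
have e1 : \tr (X *m (Y *m P)) = \tr (P *m X *m Y) by rewrite mulmxA mxtrace_mulC mulmxA.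
have e2 : \tr (X *m (P *m Y)) = \tr (X *m P *m Y) by rewrite mulmxA.
rewrite mulmxBr mulmxBl !raddfB /= e1 e2.
by move: (\tr _) (\tr _) => a b; ring.
Qed.

Lemma induced_kmetric R (c : R) (U : set 'rV[R]_3) (f : 'rV[R]_3 -> 'M[R[i]]_3) x v w :
  open U -> smooth_mx U f -> U x ->
  Defs.induced c f x v w = kmetric c (Dmx f x v) (Dmx f x w).
Proof.
move=> oU fs Ux; rewrite /Defs.induced (Dmx_lin w oU fs Ux) kmetric_sumr mxE.
apply: eq_bigr => m _; rewrite kmetricZr mulrC [w^T _ _]mxE; congr (_ * _).
rewrite (Dmx_lin v oU fs Ux) kmetric_suml mxE; apply: eq_bigr => i _.
by rewrite kmetricZl [gram _ _ _ _ _]mxE.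
Qed.

Lemma scaleN2D R (D : 'M[R[i]]_3) : (-2 : R)%:C *: D + D = - D.
Proof.
rewrite -{2}[D]scale1r -scalerDl -[RHS]scaleN1r; congr (_ *: _).
by apply/cplxP; rewrite /=; ring.
Qed.

Section StructureField.
Context (R : realType) (c : R) (c0 : c != 0) (V : set 'rV[R]_3) (oV : open V).
Context (f Phi : 'rV[R]_3 -> 'M[R[i]]_3) (ad : adapted c V f Phi).
Context (imm : forall x v, V x -> Dmx f x v = 0 -> v = 0).

Let Ps : smooth_mx V Phi. Proof. by case: ad. Qed.
Let uP x : V x -> unit_frame c (Phi x). Proof. by case: ad => _ + _ _; exact. Qed.
Let fE x : V x -> f x = Phi x *m e00 R *m frinv c (Phi x). Proof. by case: ad => _ _ + _; exact. Qed.
Let Re10 x v : V x -> Re (Om c Phi x v 1 0) = 0. Proof. by case: ad => _ _ _; exact. Qed.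

Lemma Df_fr x a : V x ->
  Dmx f x (fr c Phi a x) = Phi x *m tmx c (pc R a) (qc R a) *m frinv c (Phi x).
Proof.
by move=> Vx; rewrite (Df_tmx c0 oV ad _ Vx) (O10_fr c0 oV ad imm)// (qf_fr c0 oV ad imm).
Qed.

(** The distribution is invariant under [J]. *)
Lemma cstruct_fr x a : V x -> a != 0 -> exists w,
  cstruct (f x) (Dmx f x (fr c Phi a x)) = Dmx f x w.
Proof.
move=> Vx; rewrite Df_fr// fE// (cstruct_tmx _ _ c0 (uP Vx)).
move: a; apply: ord3P => // _.
  by exists (fr c Phi ord_max x); rewrite Df_fr// /pc /qc /= mulr0 mulr1.
(* the opposite of [fr 1], in a form to which linearity applies *)
exists ((-2) *: fr c Phi 1 x + fr c Phi 1 x).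
rewrite (Dmx_dirD _ _ _ oV (smooth_fmx oV ad) Vx) Df_fr//.
rewrite scaleN2D -mulNmx -mulmxN; congr (_ *m _ *m _).
apply/matrixP; apply: ord3P; apply: ord3P; rewrite !mxE /= /pc /qc /=; apply/cplxP; rewrite /=; ring.
Qed.

Lemma xi_structure_field : structure_field c f V (fr c Phi 0).
Proof.
exists (fun x => Phi x *m tmx c 1 0 *m frinv c (Phi x)).
  split.
    apply: smooth_mx_mul => //; last exact: smooth_frinv.
    by apply: smooth_mx_mul => //; exact: smooth_mx_cst.
  move=> x Vx; split.
  - by rewrite fE//; apply: tangent_tmx => //; exact: uP.
  - rewrite kmetric_tmx//; last exact: uP.
    by rewrite /=; ring.
  - move=> v; rewrite (Df_tmx c0 oV ad v Vx) kmetric_tmx//; last exact: uP.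
    have := Re10 v Vx; move: (Om c Phi x v 1 0) (qf c Phi x v) => [a1 a2] [b1 b2] /= ->.
    by ring.
move=> x Vx; rewrite Df_fr// fE// cstruct_tmx//; last exact: uP.
rewrite -mulNmx -mulmxN; congr (_ *m _ *m _).
apply/matrixP; apply: ord3P; apply: ord3P; rewrite !mxE /= /pc /qc /=; apply/cplxP; rewrite /=; ring.
Qed.

End StructureField.

(** * From the Lie derivative to the operator *)

Lemma Dmx_0 R F (x : 'rV[R]_3) : Dmx F x 0 = 0.
Proof. by apply/matrixP => i j; rewrite DmxE [RHS]mxE /DC !derive0. Qed.

Lemma Dmx_scale R (U : set 'rV[R]_3) F x v (t : R) : open U ->
  smooth_mx U F -> U x -> Dmx F x (t *: v) = t%:C *: Dmx F x v.
Proof.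
by move=> oU Fs Ux; rewrite -[t *: v]addr0 (Dmx_dirD _ _ _ oU Fs Ux) Dmx_0 addr0.
Qed.

(** A product with a bump function extends smoothly by 0. *)
Lemma smooth_cutoff R (V K U : set 'rV[R]_3) (rho h : 'rV[R]_3 -> R) :
  open V -> open U -> compact K -> K `<=` V -> (forall x, ~ K x -> rho x = 0) ->
  smooth setT rho -> smooth V h -> smooth U (fun x => rho x * h x).
Proof.
move=> oV oU cK KV r0 rs hs; apply: smooth_local => x Ux.
have [Kx|nK] := pselect (K x).
  exists V; first exact: KV.
  by apply: smooth_mul => //; exact: smooth_restr (@subsetT _ V) rs.
have oK : open (~` K) by rewrite openC; apply: compact_closed => //; exact: Rhausdorff_rV.
exists (~` K) => //; apply: (smooth_ext oK _ (smooth_cst 0 oK)) => y nKy.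
by rewrite r0// mul0r.
Qed.

Section LieParallel.
Context (R : realType) (c : R) (c0 : c != 0) (M : topologicalType) (A : set (chart R M)).
Context (F : M -> 'M[R[i]]_3).
Context (cm : connected_manifold A) (rh : real_hypersurface c A F).
Context (lp : lie_D_parallel c A F) (a : chart R M) (Aa : A a).
Context (V : set 'rV[R]_3) (oV : open V) (Va : V `<=` ccod a) (Phi : 'rV[R]_3 -> 'M[R[i]]_3).
Context (ad : adapted c V (F \o cinv a) Phi).

Let sA : smooth_atlas A. Proof. by case: cm. Qed.
Let hM : hausdorff_space M. Proof. by case: cm. Qed.
Let imm x v : V x -> Dmx (F \o cinv a) x v = 0 -> v = 0.
Proof. by move=> Vx; case: rh => _ _; apply => //; exact: Va. Qed.
Let fs b : A b -> smooth_mx (ccod b) (F \o cinv b).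
Proof. by case: rh => _ h _; exact: h. Qed.

(** The derivative of the immersion does not depend on the chart. *)
Lemma push_Df b x v : A b -> overlap a b x ->
  Dmx (F \o cinv b) (transition a b x) ('D_v (transition a b) x) = Dmx (F \o cinv a) x v.
Proof.
move=> Ab abx.
have oab := overlap_open sA Aa Ab.
have [bx _] := transition_overlap sA Aa Ab abx.
have dt := transition_diff sA Aa Ab abx.
have E y : overlap a b y -> (F \o cinv b) (transition a b y) = (F \o cinv a) y.
  by move=> aby; rewrite /= (cinv_transition sA Aa Ab aby).
have oc := ccod_open sA Ab.
apply/matrixP => i j; have [sr si] := fs Ab i j.
rewrite !DmxE; apply/cplxP; rewrite ?ReDC ?ImDC.
  have dg := smooth_diff oc sr bx.
  apply: etrans (esym (derive_comp v dt dg)) _.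
  by apply: (derive_ext _ oab abx) => y /E /= ->.
have dg := smooth_diff oc si bx.
apply: etrans (esym (derive_comp v dt dg)) _.
by apply: (derive_ext _ oab abx) => y /E /= ->.
Qed.

(** For a vector [W] of the distribution, [g(W, xi) = - G(W, J N) = G(J W, N)],
   and [J W] is tangent to the hypersurface, hence orthogonal to every local
   unit normal field. *)
Lemma pushfield_in_D Z s : s != 0 ->
  (forall x, (V x /\ exists h : R, Z x = h *: fr c Phi s x) \/ Z x = 0) ->
  in_D c A F (pushfield a Z).
Proof.
move=> s0 Zfr b V' xi' y Ab [oV' V'b [N' [N's N'p] xiE]] V'y.
have yb := V'b _ V'y.
rewrite (induced_kmetric c _ _ (ccod_open sA Ab) (fs Ab) yb) (xiE y V'y).
rewrite kmetricC kmetricNl kmetricC.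
have [_ _ Nperp] := N'p y V'y.
have [ay|ay] := pselect (cdom a (cinv b y)); last first.
  rewrite /pushfield (_ : `[< cdom a (cinv b y) >] = false); last exact/negbTE/asboolPn.
  by rewrite Dmx_0 kmetric0l oppr0.
pose x := transition b a y.
have bay : overlap b a y by [].
have abx : overlap a b x := transition_overlap sA Ab Aa bay.
have xy : transition a b x = y := transitionK sA Ab Aa bay.
have fE : (F \o cinv b) y = (F \o cinv a) x.
  by rewrite /= (cinv_transition sA Ab Aa bay).
have Zb : pushfield a Z b y = 'D_(Z x) (transition a b) x.
  by rewrite -(pushfield_in sA Z Aa Ab abx) xy.
have DZ : Dmx (F \o cinv b) y (pushfield a Z b y) = Dmx (F \o cinv a) x (Z x).
  by rewrite Zb -{1}xy push_Df.
rewrite DZ fE; case: (Zfr x) => [[Vx [h ->]]|->]; last by rewrite Dmx_0 kmetric0l oppr0.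
rewrite (Dmx_scale _ _ (ccod_open sA Aa) (fs Aa) (Va Vx)) kmetricZl kmetric_cstruct.
have [w ->] := cstruct_fr c0 oV ad imm Vx s0.
rewrite -(push_Df w Ab abx) xy kmetricC Nperp.
by rewrite oppr0 mulr0 oppr0.
Qed.

Lemma lf_scale x v (t : R) : V x -> lf c Phi x (t *: v) = t%:C * lf c Phi x v.
Proof.
move=> Vx; have [Ps _ _ _] := ad.
have E : Om c Phi x (t *: v) = t%:C *: Om c Phi x v.
  by rewrite !OmE (Dmx_scale v t oV Ps Vx) scalemxAr.
have OE i j : Om c Phi x (t *: v) i j = t%:C * Om c Phi x v i j by rewrite E mxE.
have aE : af c Phi x (t *: v) = t * af c Phi x v.
  apply: etrans (congr2 (fun u w => Im u - Im w) (OE 1 1) (OE 0 0)) _.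
  exact: etrans (congr2 (fun u w => u - w) (Im_realM _ _) (Im_realM _ _)) (esym (mulrBr _ _ _)).
have alg (r a' k u w : R[i]) (b : R) :
    r * (t * b)%:C - a' * (t%:C * u) + k * (t%:C * w) = t%:C * (r * b%:C - a' * u + k * w).
  by rewrite rmorphM /=; ring.
rewrite /lf aE; apply: etrans (alg _ _ _ _ _ _); congr (_ - _ * _ + _ * _); exact: OE.
Qed.

Lemma smooth_rv_bracket X Y : smooth_rv V X -> smooth_rv V Y -> smooth_rv V (bracket X Y).
Proof.
move=> Xs Ys i.
have S := smooth_sub_fun oV (smooth_Dfield oV Xs (Ys i)) (smooth_Dfield oV Ys (Xs i)).
apply: (smooth_ext oV _ S) => x Vx.
rewrite /bracket [RHS]mxE [X in _ = _ + X]mxE.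
rewrite (derive_rv _ _ (smooth_rv_diff oV Ys Vx)) (derive_rv _ _ (smooth_rv_diff oV Xs Vx)).
by [].
Qed.

(** Take [Y = rho xi] and [X = rho g E] with [E = fr s], where [rho] is a bump
   function and [g] an affine function vanishing at [x0] and not constant along
   [xi].  Then [l Y = 0], so that [(L_X l) Y = - l [X, Y]], and at [x0] the
   bracket is a nonzero multiple of [E] since [X] vanishes there. *)
Theorem lf_fr_eq0 x0 s : V x0 -> s != 0 -> lf c Phi x0 (fr c Phi s x0) = 0.
Proof.
move=> Vx0 s0.
have [rho [K [rs r0 cK KV rK]]] := bump_exists oV Vx0.
have xi0 : fr c Phi 0 x0 != 0.
  apply/eqP => E; have := coframe_xi c0 oV ad imm 0 Vx0; rewrite E.
  rewrite (coframe_lin oV ad) // mul0mx mxE /= => /eqP.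
  by rewrite eq_sym oner_eq0.
have [k wk] := rV0Pn _ xi0.
pose g (x : 'rV[R]_3) := x 0 k - x0 0 k.
have gs U : open U -> smooth U g.
  by move=> oU; apply: smooth_sub_fun => //; [exact: smooth_coord|exact: smooth_cst].
pose Z x := (rho x * g x) *: fr c Phi s x.
pose W x := rho x *: fr c Phi 0 x.
have oa := ccod_open sA Aa.
have frs b : smooth_rv V (fr c Phi b) by exact: (smooth_fr c0 oV ad imm).
have Zs : smooth_rv (ccod a) Z.
  move=> i; have S := smooth_cutoff oV oa cK KV rK rs (smooth_mul oV (gs V oV) (frs s i)).
  by apply: (smooth_ext oa _ S) => x _; rewrite [RHS]mxE mulrA.
have Ws : smooth_rv (ccod a) W.
  move=> i; have S := smooth_cutoff oV oa cK KV rK rs (frs 0 i).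
  by apply: (smooth_ext oa _ S) => x _; rewrite [RHS]mxE.
have Ka : K `<=` ccod a by move=> x /KV /Va.
have Z0 x : ~ K x -> Z x = 0 by move=> /rK E; rewrite /Z E mul0r scale0r.
have W0 x : ~ K x -> W x = 0 by move=> /rK E; rewrite /W E scale0r.
pose X := pushfield a Z. pose Y := pushfield a W.
have vX : vector_field A X by exact: (pushfield_vector_field sA hM Aa Zs cK Ka Z0).
have vY : vector_field A Y by exact: (pushfield_vector_field sA hM Aa Ws cK Ka W0).
have dX : in_D c A F X.
  apply: (pushfield_in_D s0) => x; have [Kx|/Z0 ->] := pselect (K x); [left|by right].
  by split; [exact: KV|exists (rho x * g x)].
have XZ x : V x -> X a x = Z x by move=> /Va ax; exact: (pushfield_self sA).
have YW x : V x -> Y a x = W x by move=> /Va ax; exact: (pushfield_self sA).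
have Xs : smooth_rv V (X a) by move=> i; exact: smooth_restr Va (vX.1 a Aa i).
have Ys : smooth_rv V (Y a) by move=> i; exact: smooth_restr Va (vY.1 a Aa i).
have := lp vX dX vY Aa (And3 oV Va (xi_structure_field c0 oV ad imm)) Vx0.
pose f := F \o cinv a; pose xi := fr c Phi 0.
rewrite /lie_jacobi -/f -/xi.
have xiJ x : V x -> lf c Phi x (xi x) = 0.
  by move=> Vx; rewrite /lf (qf_xi c0 oV ad imm)// mulr0 addr0 mulrC subrr.
have J0 x : V x -> jacobi c f xi (Y a) x = 0.
  move=> Vx; have [J1 J2] := jacobi_frame c0 oV ad imm Vx Ys.
  apply: (coframe0_inj c0 oV ad imm Vx).
  have {}J2 : qf c Phi x (jacobi c f xi (Y a) x) = 0.
    by apply: etrans J2 _; rewrite (YW x Vx) -/(lf c Phi x (W x)) lf_scale// xiJ// mulr0.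
  apply/rowP; apply: ord3P; rewrite [RHS]mxE; first exact: J1.
  - by rewrite coframe1E J2.
  - by rewrite coframe2E J2.
(* [l Y] vanishes near [x0], so only [l [X, Y]] remains *)
have B0 : bracket (X a) (jacobi c f xi (Y a)) x0 = 0.
  rewrite /bracket (J0 x0 Vx0) derive0 subr0.
  by rewrite (derive_ext _ oV Vx0 J0) derive_cst.
rewrite B0 sub0r => /eqP; rewrite oppr_eq0 => /eqP JB.
have [_] := jacobi_frame c0 oV ad imm Vx0 (smooth_rv_bracket Xs Ys).
rewrite -/f -/xi JB => L0.
have {}L0 : lf c Phi x0 (bracket (X a) (Y a) x0) = 0.
  apply: etrans (esym L0) _.
  by rewrite qfE !(coframe_lin oV ad)// mul0mx !mxE.
have Xx0 : X a x0 = 0 by rewrite XZ// /Z /g subrr mulr0 scale0r.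
pose t := rho x0 * (fr c Phi 0 x0 0 k * rho x0).
have BE : bracket (X a) (Y a) x0 = (- t) *: fr c Phi s x0.
  rewrite /bracket Xx0 derive0 sub0r (YW x0 Vx0) scaleNr; congr (- _).
  apply/rowP => i; rewrite (derive_rv _ _ (smooth_rv_diff oV Xs Vx0)) [RHS]mxE.
  have rV : smooth V rho by exact: smooth_restr (@subsetT _ V) rs.
  have hs := smooth_mul oV rV (frs s i).
  rewrite (derive_ext (g := fun x => g x * (rho x * fr c Phi s x 0 i)) _ oV Vx0); last first.
    by move=> x Vx; rewrite XZ// mxE mulrCA mulrA.
  rewrite (derive_mulf _ oV (gs V oV) hs Vx0) /g subrr mul0r addr0.
  have -> : 'D_(W x0) (fun x : 'rV[R]_3 => x 0 k - x0 0 k) x0 = W x0 0 k.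
    rewrite (derive_addf _ oV (smooth_coord k oV) (smooth_cst (- x0 0 k) oV) Vx0).
    by rewrite derive_cst addr0 derive_coord.
  by rewrite /W mxE /t; ring.
move: L0; rewrite BE lf_scale// => /eqP; rewrite mulf_eq0 => /orP[|/eqP//].
move=> /eqP -[/eqP]; rewrite oppr_eq0 /t !mulf_eq0.
by rewrite (negbTE r0) (negbTE wk).
Qed.

End LieParallel.

(** * Nonexistence *)

Local Close Scope complex_scope.

Theorem mainTheorem1 (R : realType) (c : R) (hc : c != 0) :
  ~ exists (M : topologicalType) (A : set (chart R M)) (F : M -> 'M[R[i]]_3),
      [/\ connected_manifold A, real_hypersurface c A F &
          lie_D_parallel c A F].
Proof.
move=> [M [A [F [cm rh lp]]]].
have [sA _ _ [p0 _] _] := cm.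
have [_ cov _] := sA.
have [a Aa pa] := cov p0.
have oU := ccod_open sA Aa.
have [FM Fs Fi] := rh.
have [V0 [Phi0 [oV0 V0x V0U Ps0 [uP0 fE0]]]] :=
  frame_exists hc oU (cmap_cod sA Aa pa) (Fs a Aa) (fun x _ => FM (cinv a x)).
have imm0 x v : V0 x -> Dmx (F \o cinv a) x v = 0 -> v = 0 by move=> /V0U; exact: Fi.
have [V [Phi [oV Vx VV0 ad]]] := adapted_exists hc oV0 Ps0 uP0 fE0 imm0 V0x.
have Va : V `<=` ccod a by move=> x /VV0 /V0U.
have imm x v : V x -> Dmx (F \o cinv a) x v = 0 -> v = 0 by move=> /Va; exact: Fi.
pose r0 x := rf c Phi x (fr c Phi 0 x).
have rs : smoothC V r0 := smooth_rf oV ad (smooth_fr hc oV ad imm 0).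
pose n x := Re (r0 x) * Re (r0 x) + Im (r0 x) * Im (r0 x).
have ns : smooth V n.
  by case: rs => rs1 rs2; apply: smooth_add => //; exact: smooth_mul.
(* [S xi] has a component in the distribution exactly on [W] *)
pose W := [set x | V x /\ n x != 0].
have oW : open W by exact: open_neq0.
have WV : W `<=` V by move=> x [].
have lfl U Psi : open U -> U `<=` V -> adapted c U (F \o cinv a) Psi ->
    U !=set0 -> (forall x, U x -> Im (rf c Psi x (fr c Psi 0 x)) = 0) -> False.
  move=> oU' UV adU U0 Im0.
  have Ua : U `<=` ccod a by move=> x /UV /Va.
  have immU x v : U x -> Dmx (F \o cinv a) x v = 0 -> v = 0 by move=> /UV; exact: imm.
  have l s x : U x -> s != 0 -> lf c Psi x (fr c Psi s x) = 0.
    exact: (lf_fr_eq0 hc cm rh lp Aa oU' Ua adU).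
  apply: (no_flat_jacobi hc oU' adU immU _ _ Im0 U0) => x Ux; exact: l.
have [[x1 Wx1]|nW] := pselect (W !=set0).
  have immW x v : W x -> Dmx (F \o cinv a) x v = 0 -> v = 0 by move=> /WV; exact: imm.
  have r0n x : W x -> r0 x != 0.
    by move=> [_ nx]; apply: contra nx => /eqP E; rewrite /n E /= mulr0 addr0.
  have [Psi [adP ImP]] := rotate_exists hc oW (adapted_restr WV ad) immW r0n.
  by apply: (lfl W Psi) => //; exists x1.
apply: (lfl V Phi) => //; first by exists (cmap a p0).
move=> x Vx'; have : n x == 0 by apply: contra_notT nW => nx; exists x.
rewrite /n -/(r0 x) paddr_eq0 -?expr2 ?sqr_ge0// !sqrf_eq0 => /andP[_ /eqP].
by [].
Qed.
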